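(* Let $\mathcal{P}_+$ be a local functional of fermion number $N_F=1$ each of whose monomials consists only of $+$fields, with at least one field. If $Q_-\mathcal{P}_+=0$, then $$\mathcal{P}_+=\mathcal{C}_+ + Q_-\mathcal{Q}_+,$$ where $\mathcal{C}_+$ is a (possibly zero) finite linear combination of $+$type CLR terms with $N_F=1$, and $\mathcal{Q}_+$ is a local functional of fermion number $N_F=2$ each of whose monomials consists only of $+$fields, with at least one field. Similarly, let $\mathcal{P}_-$ be a local functional with $N_F=1$ each of whose monomials consists only of $-$fields, with at least one field. If $Q_+\mathcal{P}_-=0$, then $\mathcal{P}_-=\mathcal{C}_- + Q_+\mathcal{Q}_-$, where $\mathcal{C}_-$ is a (possibly zero) finite linear combination of $-$type CLR terms with $N_F=1$, and $\mathcal{Q}_-$ is a local functional with $N_F=2$ each of whose monomials consists only of $-$fields, with at least one field.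
   Context: Lattice sites are labelled by integers $n$ (lattice spacing $1$). For each site $n$ there are Grassmann-even variables $\phi_{+n},\phi_{-n},F_{+n},F_{-n}$ and Grassmann-odd variables $\chi_{+n},\chi_{-n},\bar\chi_{+n},\bar\chi_{-n}$. Variables with subscript $+$ (resp. $-$) are called $+$fields (resp. $-$fields). The fermion number $N_F$ is additive, with $N_F=0$ for $\phi_\pm,F_\pm$, $N_F=+1$ for $\chi_\pm$, and $N_F=-1$ for $\bar\chi_\pm$. A coefficient $C_{m_0m_1\cdots m_I}\in\mathbb{C}$ is a translationally invariant local coefficient (TILC) if (i) $C_{m_0+1,\dots,m_I+1}=C_{m_0,\dots,m_I}$, so that $C_{m_0\cdots m_I}=C(m_0-m_1,\dots,m_0-m_I)$, and (ii) there exist $L,M>0$ such that $|C(k_1,\dots,k_I)|<L\,e^{-M|k_\ell|}$ for each $\ell$ whenever $|k_\ell|$ is large. A local functional is a finite sum of terms $\sum_{m_0,\dots,m_I}C_{m_0\cdots m_I}X^{(0)}_{m_0}\cdots X^{(I)}_{m_I}$, where $C$ is a TILC and each $X^{(j)}$ is one of the lattice variables above. The difference operator $\nabla$ is a two-index TILC, $\nabla_{mn}=\nabla(m-n)$, with $(\nabla X)_m=\sum_n\nabla_{mn}X_n$, and its generating function $\tilde\nabla(z)=\sum_k\nabla(k)z^k$ satisfies $\tilde\nabla(1)=0$. $Q_+$ and $Q_-$ are Grassmann-odd derivations, obeying $Q(AB)=(QA)B+(-1)^{|A|}A(QB)$ with $|A|$ the Grassmann parity of $A$. On the variables they act as follows.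 - $Q_+$: $\phi_{+n}\mapsto\bar\chi_{+n}$, $\bar\chi_{+n}\mapsto0$, $\chi_{+n}\mapsto F_{+n}$, $F_{+n}\mapsto0$, $\phi_{-n}\mapsto0$, $\bar\chi_{-n}\mapsto0$, $\chi_{-n}\mapsto -i(\nabla\phi_-)_n$, $F_{-n}\mapsto -i(\nabla\bar\chi_-)_n$. - $Q_-$: $\phi_{-n}\mapsto-\bar\chi_{-n}$, $\bar\chi_{-n}\mapsto0$, $\chi_{-n}\mapsto F_{-n}$, $F_{-n}\mapsto0$, $\phi_{+n}\mapsto0$, $\bar\chi_{+n}\mapsto0$, $\chi_{+n}\mapsto i(\nabla\phi_+)_n$, $F_{+n}\mapsto -i(\nabla\bar\chi_+)_n$. A TILC $C_{mn_1\cdots n_k}$ ($k\ge0$), totally symmetric in $n_1,\dots,n_k$, satisfies the cyclic Leibniz rule (CLR) if for all sites $n_0,\dots,n_k$ one has $\sum_{p}\sum_m\nabla_{m n_{p(0)}}C_{m n_{p(1)}\cdots n_{p(k)}}=0$, where $p$ runs over the cyclic permutations of $\{0,1,\dots,k\}$. A $\pm$type CLR term with $N_F=1$ is a functional $\sum_{m,n_1,\dots,n_k}C_{mn_1\cdots n_k}\chi_{\pm m}\phi_{\pm n_1}\cdots\phi_{\pm n_k}$ with such a $C$.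
   Formalization: The difference operator ∇ is additionally assumed not identically zero; for ∇=0 the claim fails, e.g. for P_+ = Σ_m F_{+m}χ_{+m}, which is closed but neither a CLR combination nor Q_- of anything nonzero. *)

(* Defs.v *)
From Stdlib Require Import Bool Reals ZArith List Permutation.
From Coquelicot Require Import Coquelicot.
Import ListNotations.
Open Scope R_scope.
Open Scope bool_scope.

Inductive fkind := Phi | Fld | Chi | Chib.

(* a variable type: (sign, kind); sign = true for a +field, false for a -field *)
Definition vtype := (bool * fkind)%type.
Definition lvar := (bool * fkind * Z)%type.

Definition vt (v : lvar) : vtype := fst v.
Definition site (v : lvar) : Z := snd v.

Definition fkind_eqb (a b : fkind) : bool :=
  match a, b with
  | Phi, Phi | Fld, Fld | Chi, Chi | Chib, Chib => true
  | _, _ => false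
  end.
Definition vtype_eqb (a b : vtype) : bool :=
  Bool.eqb (fst a) (fst b) && fkind_eqb (snd a) (snd b).

Definition all_vtypes : list vtype :=
  [(true,Phi);(true,Fld);(true,Chi);(true,Chib);
   (false,Phi);(false,Fld);(false,Chi);(false,Chib)].

Definition odd_kind (k : fkind) : bool :=
  match k with Chi | Chib => true | _ => false end.
Definition odd_var (v : lvar) : bool := odd_kind (snd (vt v)).

Definition NF_kind (k : fkind) : Z :=
  match k with Phi => 0 | Fld => 0 | Chi => 1 | Chib => -1 end%Z.
Definition NF (ks : list vtype) : Z :=
  fold_right Z.add 0%Z (map (fun t => NF_kind (snd t)) ks).

Definition dflt_var : lvar := (true, Phi, 0%Z).

Definition csum (l : list C) : C := fold_right Cplus (RtoC 0) l.

Definition remove_nth {A} (j : nat) (l : list A) : list A :=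
  firstn j l ++ skipn (S j) l.

(* Koszul sign of moving the j-th letter of the word w to the front:
   (-1)^(|w_j| * #(odd letters among w_0..w_(j-1))) *)
Definition ksign (w : list lvar) (j : nat) : C :=
  if odd_var (nth j w dflt_var)
     && Nat.odd (length (filter odd_var (firstn j w)))
  then RtoC (-1) else RtoC 1.

Definition zpartial (a : Z -> C) (N : nat) : C :=
  csum (map (fun k => a (Z.of_nat k - Z.of_nat N)%Z) (seq 0 (2 * N + 1))).

Definition zsum_to (a : Z -> C) (l : C) : Prop :=
  forall eps : R, 0 < eps -> exists N0 : nat, forall N : nat, (N0 <= N)%nat ->
    Cmod (Cminus (zpartial a N) l) < eps.

(** * Translationally invariant local coefficients
    A coefficient C_{m_0 ... m_I} with n = I+1 indices is a function on lists
    of sites (only its values on lists of length n matter). *)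
Definition TILC (n : nat) (Cf : list Z -> C) : Prop :=
  (forall l, length l = n -> Cf (map (Z.add 1) l) = Cf l) /\
  exists L M K : R, 0 < L /\ 0 < M /\
    forall l, length l = n -> forall i : nat, (1 <= i < n)%nat ->
      K < IZR (Z.abs (nth 0 l 0%Z - nth i l 0%Z)) ->
      Cmod (Cf l) < L * exp (- M * IZR (Z.abs (nth 0 l 0%Z - nth i l 0%Z))).

(** * Local functionals
    A lterm  sum_{m_0..m_I} C_{m_0..m_I} X^(0)_{m_0} ... X^(I)_{m_I}
    is represented by (list of the types of X^(0),...,X^(I), C).
    A local functional is a finite list (sum) of terms with TILC coefficients. *)
Definition lterm := (list vtype * (list Z -> C))%type.

Definition local_functional (P : list lterm) : Prop :=
  List.Forall (fun t => TILC (length (fst t)) (snd t)) P.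

(* Graded-symmetrized coefficient of a lterm on a word w = v_0 ... v_I of
   variables:  sum over permutations sigma with Koszul sign of
   [types match] C(sites of w o sigma).  A functional Phi equals
   (1/n!) sum_w f(w) v_0...v_{n-1} with f its symmetrized coefficient, and two
   functionals are equal iff their symmetrized coefficients agree. *)
Fixpoint symc (ks : list vtype) (Cf : list Z -> C) (w : list lvar) : C :=
  match ks with
  | [] => match w with [] => Cf [] | _ => RtoC 0 end
  | k :: ks' =>
      csum (map (fun j =>
        let v := nth j w dflt_var in
        if vtype_eqb (vt v) k
        then Cmult (ksign w j) (symc ks' (fun l => Cf (site v :: l)) (remove_nth j w))
        else RtoC 0) (seq 0 (length w)))
  end.

Definition coef (P : list lterm) (w : list lvar) : C :=
  csum (map (fun t => symc (fst t) (snd t) w) P).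

(** * The supercharges.  q v u is the coefficient of the variable u in Q v. *)
Definition qminus (nabla : Z -> C) (v u : lvar) : C :=
  match v, u with
  | (false, Phi, n), (false, Chib, m) => if Z.eqb n m then RtoC (-1) else RtoC 0
  | (false, Chi, n), (false, Fld, m) => if Z.eqb n m then RtoC 1 else RtoC 0
  | (true, Chi, n), (true, Phi, m) => Cmult Ci (nabla (n - m)%Z)
  | (true, Fld, n), (true, Chib, m) => Cmult (Copp Ci) (nabla (n - m)%Z)
  | _, _ => RtoC 0
  end.

Definition qplus (nabla : Z -> C) (v u : lvar) : C :=
  match v, u with
  | (true, Phi, n), (true, Chib, m) => if Z.eqb n m then RtoC 1 else RtoC 0
  | (true, Chi, n), (true, Fld, m) => if Z.eqb n m then RtoC 1 else RtoC 0
  | (false, Chi, n), (false, Phi, m) => Cmult (Copp Ci) (nabla (n - m)%Z)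
  | (false, Fld, n), (false, Chib, m) => Cmult (Copp Ci) (nabla (n - m)%Z)
  | _, _ => RtoC 0
  end.

(* Q_image q f h : the functional with symmetrized coefficient f is mapped by
   the odd derivation Q (with Q v = sum_u q v u * u) to the functional with
   symmetrized coefficient h:
   h(w) = sum_j ksign w j * sum_v q(v, w_j) f(v :: w without w_j). *)
Definition Q_image (q : lvar -> lvar -> C) (f h : list lvar -> C) : Prop :=
  forall w : list lvar,
    zsum_to (fun n =>
      csum (map (fun j =>
        Cmult (ksign w j)
          (csum (map (fun st =>
             Cmult (q (fst st, snd st, n) (nth j w dflt_var))
                   (f ((fst st, snd st, n) :: remove_nth j w))) all_vtypes)))
        (seq 0 (length w))))
      (h w).

Definition rot (r : nat) (l : list Z) : list Z := skipn r l ++ firstn r l.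

Definition CLR (nabla : Z -> C) (k : nat) (Cf : list Z -> C) : Prop :=
  forall ns : list Z, length ns = S k ->
    zsum_to (fun m => csum (map (fun r =>
        let ns' := rot r ns in
        Cmult (nabla (m - hd 0 ns')%Z) (Cf (m :: tl ns'))) (seq 0 (S k))))
      (RtoC 0).

Definition clr_data := (nat * (list Z -> C))%type.

Definition is_CLR_coef (nabla : Z -> C) (d : clr_data) : Prop :=
  TILC (S (fst d)) (snd d) /\
  (forall m ns ns', length ns = fst d -> Permutation ns ns' ->
     snd d (m :: ns) = snd d (m :: ns')) /\
  CLR nabla (fst d) (snd d).

Definition clr_term (s : bool) (d : clr_data) : lterm :=
  ((s, Chi) :: repeat (s, Phi) (fst d), snd d).

Definition clr_combination (s : bool) (Cs : list (C * clr_data)) : list lterm :=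
  map (fun cd => let t := clr_term s (snd cd) in
                 (fst t, fun l => Cmult (fst cd) (snd t l))) Cs.

Definition pure_terms (s : bool) (nf : Z) (P : list lterm) : Prop :=
  List.Forall (fun t => fst t <> [] /\ List.Forall (fun k => fst k = s) (fst t) /\ NF (fst t) = nf) P.

(* Main.v *)
(** The differential acts on a word of fields letter by letter, replacing an
    excited letter (chi or F) by its partner (phi or bar chi) and convolving with
    nabla; on functions of words it is the Koszul differential of the n commuting
    operators "convolution by nabla in the i-th site". Translation invariance
    leaves n - 1 independent relative sites. Convolution by nabla in one relative
    site has a left inverse preserving exponential decay: nabla, viewed as a
    Laurent series, has no zero on suitable circles of radius slightly larger and
    slightly smaller than 1, and 1/nabla expanded on the outer (inner) circle
    inverts it on positive (negative) relative sites. Hence the complex is exact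
    wherever at least two letters are excited. With N_F = 1 the number of excited
    letters is 1 plus the number of letters bar chi and F, so only the words
    chi phi ... phi are left over, and on those closedness is the cyclic Leibniz
    rule. Averaging over permutations with Koszul signs commutes with the
    differential, so that a primitive may be sought without symmetry. *)

Require Import Defs.
From Stdlib Require Import Reals ZArith List.
From Stdlib Require Import Bool Permutation Lra Lia ClassicalEpsilon.
From Coquelicot Require Import Coquelicot.
Import ListNotations.
Open Scope R_scope.

(** * Symmetric summation over the integers *)

(** The symbol of [nabla] may vanish on the unit circle, so an inverse kernel taken on a nearby
    circle decays in one direction and grows in the other. A reference site z makes the growth
    harmless: for a letter at x the kernel is chosen by the side of z on which x lies, so that it
    decays in x - z, while its growth in k - z is slower than the decay of the coefficient about z.
    For translation invariance z has to move with the word, so it is the site of the first letter.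
    The differential displaces that letter as well, and therefore the primitive is built in two
    rounds: on words with an excited head, where the head is left alone, and then on words with a
    ground head, once the contribution of the first round is subtracted. Zero-free circles come from
    a quantitative identity principle: at a limit of zeros a Laurent series is divided again and
    again by the linear factor, each division costing a fixed factor and no decay, which forces
    vanishing on a disc whose radius does not depend on the point. Rates of decay shrink only
    finitely often, so the primitive is local. *)

Lemma csum_app l1 l2 : csum (l1 ++ l2) = Cplus (csum l1) (csum l2).
Proof.
  induction l1 as [|x l IH]; simpl; [now rewrite Cplus_0_l|].
  unfold csum in *; simpl; rewrite IH; ring.
Qed.

Lemma csum_cons x l : csum (x :: l) = Cplus x (csum l).
Proof. reflexivity. Qed.

Lemma csum_plus {A} (f g : A -> C) l :
  csum (map (fun x => Cplus (f x) (g x)) l) = Cplus (csum (map f l)) (csum (map g l)).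
Proof. induction l as [|x l IH]; simpl map; rewrite ?csum_cons; [unfold csum; simpl; ring|]. rewrite IH; ring. Qed.

Lemma csum_scal {A} (c : C) (f : A -> C) l :
  csum (map (fun x => Cmult c (f x)) l) = Cmult c (csum (map f l)).
Proof. induction l as [|x l IH]; simpl map; rewrite ?csum_cons; [unfold csum; simpl; ring|]. rewrite IH; ring. Qed.

Lemma csum_ext {A} (f g : A -> C) l :
  (forall x, In x l -> f x = g x) -> csum (map f l) = csum (map g l).
Proof.
  induction l as [|x l IH]; intros H; [reflexivity|].
  simpl map; rewrite !csum_cons, IH by (intros; apply H; now right).
  rewrite (H x) by now left. reflexivity.
Qed.

Lemma csum_0 {A} (f : A -> C) l : (forall x, In x l -> f x = RtoC 0) -> csum (map f l) = RtoC 0.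
Proof.
  intros H. induction l as [|x l IH]; [reflexivity|].
  simpl map; rewrite csum_cons, IH by (intros; apply H; now right).
  rewrite (H x) by now left. ring.
Qed.

Lemma Cmod_le_abs (z : C) : Cmod z <= Rabs (Re z) + Rabs (Im z).
Proof.
  destruct z as [x y]; unfold Re, Im; simpl fst; simpl snd.
  replace (x, y) with (Cplus (RtoC x) (Cmult Ci (RtoC y))).
  - eapply Rle_trans; [apply Cmod_triangle|].
    rewrite Cmod_mult, Cmod_R, Cmod_R.
    assert (Cmod Ci = 1) by (unfold Cmod, Ci; simpl; replace (0 * (0 * 1) + 1 * (1 * 1)) with 1 by ring; apply sqrt_1).
    rewrite H; lra.
  - unfold Cplus, Cmult, Ci, RtoC; simpl; f_equal; ring.
Qed.

Lemma Re_le_Cmod (z : C) : Rabs (Re z) <= Cmod z.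
Proof. apply Rle_trans with (2 := Rmax_Cmod z). apply Rmax_l. Qed.
Lemma Im_le_Cmod (z : C) : Rabs (Im z) <= Cmod z.
Proof. apply Rle_trans with (2 := Rmax_Cmod z). apply Rmax_r. Qed.

Lemma Cmod_minus_sym (x y : C) : Cmod (Cminus x y) = Cmod (Cminus y x).
Proof. rewrite <- Cmod_opp; f_equal; ring. Qed.

Lemma Cmod_tri_minus (x y z : C) : Cmod (Cminus x z) <= Cmod (Cminus x y) + Cmod (Cminus y z).
Proof. replace (Cminus x z) with (Cplus (Cminus x y) (Cminus y z)) by ring. apply Cmod_triangle. Qed.

Lemma zpartial_0 a : zpartial a 0 = a 0%Z.
Proof. unfold zpartial, csum; simpl. now rewrite Cplus_0_r. Qed.

Lemma zpartial_S a N :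
  zpartial a (S N) = Cplus (zpartial a N) (Cplus (a (Z.of_nat (S N))) (a (- Z.of_nat (S N))%Z)).
Proof.
  unfold zpartial.
  replace (2 * S N + 1)%nat with (S (2 * N + 1 + 1)) by lia.
  rewrite <- cons_seq. rewrite seq_app. rewrite map_cons, map_app.
  rewrite csum_cons, csum_app. rewrite <- seq_shift, map_map.
  rewrite (csum_ext _ (fun k => a (Z.of_nat k - Z.of_nat N)%Z)) by (intros; f_equal; lia).
  change (map (fun k => a (Z.of_nat k - Z.of_nat (S N))%Z) (seq (1 + (2 * N + 1)) 1)) with [a (Z.of_nat (0 + S (2 * N + 1)) - Z.of_nat (S N))%Z].
  rewrite csum_cons; change (csum []) with (RtoC 0).
  replace (Z.of_nat (0 + S (2 * N + 1)) - Z.of_nat (S N))%Z with (Z.of_nat (S N)) by lia.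
  replace (Z.of_nat 0 - Z.of_nat (S N))%Z with (- Z.of_nat (S N))%Z by lia.
  ring.
Qed.

Fixpoint rpart (a : Z -> C) (N : nat) : R :=
  match N with
  | O => Cmod (a 0%Z)
  | S N' => rpart a N' + (Cmod (a (Z.of_nat N)) + Cmod (a (- Z.of_nat N)%Z))
  end.

Lemma rpart_step a N : rpart a N <= rpart a (S N).
Proof. simpl rpart; pose proof (Cmod_ge_0 (a (Z.of_nat (S N)))); pose proof (Cmod_ge_0 (a (- Z.of_nat (S N))%Z)); simpl in *; lra. Qed.

Lemma rpart_mono a N M : (N <= M)%nat -> rpart a N <= rpart a M.
Proof. induction 1; [lra|]. eapply Rle_trans; [apply IHle|apply rpart_step]. Qed.

Lemma rpart_ge0 a N : 0 <= rpart a N.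
Proof. apply Rle_trans with (rpart a 0); [apply Cmod_ge_0|apply rpart_mono; lia]. Qed.

(** Absolute summability. Unlike [zsum_to], which only controls symmetric partial sums, it permits
    shifts of the index and exchange of sums. *)
Definition asum (a : Z -> C) : Prop := exists B, forall N, rpart a N <= B.
Definition rtot (a : Z -> C) : R := real (Lim_seq (rpart a)).
(* Meaningless when the symmetric partial sums diverge. *)
Definition zsum (a : Z -> C) : C :=
  (real (Lim_seq (fun N => Re (zpartial a N))), real (Lim_seq (fun N => Im (zpartial a N)))).

Lemma rtot_lim a : asum a -> is_lim_seq (rpart a) (rtot a).
Proof. intros [B HB]. apply Lim_seq_correct'. apply (ex_finite_lim_seq_incr _ B); [apply rpart_step|exact HB]. Qed.

Lemma rpart_le_rtot a N : asum a -> rpart a N <= rtot a.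
Proof.
  intros H. refine (is_lim_seq_incr_compare (rpart a) (rtot a) _ _ N); [now apply rtot_lim|apply rpart_step].
Qed.

Lemma zpartial_diff_dom a b c N M : 0 <= c -> (forall k, Cmod (a k) <= c * Cmod (b k)) -> (N <= M)%nat ->
  Cmod (Cminus (zpartial a M) (zpartial a N)) <= c * (rpart b M - rpart b N).
Proof.
  intros Hc Hab. induction 1.
  - replace (Cminus (zpartial a N) (zpartial a N)) with (RtoC 0) by ring. rewrite Cmod_0. lra.
  - rewrite zpartial_S.
    replace (Cminus (Cplus (zpartial a m) (Cplus (a (Z.of_nat (S m))) (a (- Z.of_nat (S m))%Z))) (zpartial a N))
      with (Cplus (Cminus (zpartial a m) (zpartial a N)) (Cplus (a (Z.of_nat (S m))) (a (- Z.of_nat (S m))%Z))) by ring.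
    eapply Rle_trans; [apply Cmod_triangle|].
    pose proof (Cmod_triangle (a (Z.of_nat (S m))) (a (- Z.of_nat (S m))%Z)).
    pose proof (Hab (Z.of_nat (S m))). pose proof (Hab (- Z.of_nat (S m))%Z).
    change (rpart b (S m)) with (rpart b m + (Cmod (b (Z.of_nat (S m))) + Cmod (b (- Z.of_nat (S m))%Z))).
    nra.
Qed.

Lemma rpart_dom a b c N : (forall k, Cmod (a k) <= c * Cmod (b k)) -> rpart a N <= c * rpart b N.
Proof.
  intros H. induction N as [|N IH]; [apply H|].
  change (rpart a N + (Cmod (a (Z.of_nat (S N))) + Cmod (a (- Z.of_nat (S N))%Z))
   <= c * (rpart b N + (Cmod (b (Z.of_nat (S N))) + Cmod (b (- Z.of_nat (S N))%Z)))).
  pose proof (H (Z.of_nat (S N))). pose proof (H (- Z.of_nat (S N))%Z). lra.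
Qed.

Lemma asum_dom a b c : 0 <= c -> (forall k, Cmod (a k) <= c * Cmod (b k)) -> asum b -> asum a.
Proof.
  intros Hc H [B HB]. exists (c * B). intros N.
  apply Rle_trans with (c * rpart b N); [now apply rpart_dom|]. now apply Rmult_le_compat_l.
Qed.

Lemma zsum_to_comp a l : is_lim_seq (fun N => Re (zpartial a N)) (Re l) ->
  is_lim_seq (fun N => Im (zpartial a N)) (Im l) -> zsum_to a l.
Proof.
  intros H1 H2 eps He.
  apply is_lim_seq_spec in H1. apply is_lim_seq_spec in H2.
  assert (He2 : 0 < eps / 2) by lra.
  destruct (H1 (mkposreal _ He2)) as [N1 HN1]. destruct (H2 (mkposreal _ He2)) as [N2 HN2]. simpl in *.
  exists (max N1 N2). intros N HN.
  eapply Rle_lt_trans; [apply Cmod_le_abs|].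
  specialize (HN1 N ltac:(lia)). specialize (HN2 N ltac:(lia)).
  destruct (zpartial a N) as [x y], l as [x' y']; unfold Re, Im in *; simpl in *. unfold Rminus in *; lra.
Qed.

Lemma zsum_correct a : asum a -> zsum_to a (zsum a).
Proof.
  intros Ha.
  assert (HC : forall p : C -> R, (forall z, Rabs (p z) <= Cmod z) -> (forall x y, p (Cminus x y) = p x - p y) ->
    ex_finite_lim_seq (fun N => p (zpartial a N))).
  { intros p Hp Hl. apply ex_lim_seq_cauchy_corr. intros eps.
    assert (HR : ex_lim_seq_cauchy (rpart a)).
    { apply ex_lim_seq_cauchy_corr. exists (rtot a). now apply rtot_lim. }
    destruct (HR eps) as [N0 HN0]. exists N0.
    assert (G : forall n m, (N0 <= n)%nat -> (n <= m)%nat -> Rabs (p (zpartial a n) - p (zpartial a m)) < eps).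
    { intros n m Hn Hm. rewrite Rabs_minus_sym, <- Hl. eapply Rle_lt_trans; [apply Hp|].
      eapply Rle_lt_trans; [apply (zpartial_diff_dom a a 1 n m); [lra| intros; lra|exact Hm]|].
      specialize (HN0 m n ltac:(lia) Hn). rewrite Rmult_1_l.
      eapply Rle_lt_trans; [apply Rle_abs|exact HN0]. }
    intros n m Hn Hm. destruct (Nat.le_ge_cases n m); [now apply G|]. rewrite Rabs_minus_sym; now apply G. }
  apply zsum_to_comp; unfold zsum, Re, Im; simpl; apply Lim_seq_correct'.
  - apply (HC fst); [apply Re_le_Cmod| intros [] []; unfold Cminus, Cplus, Copp; simpl; ring].
  - apply (HC snd); [apply Im_le_Cmod| intros [] []; unfold Cminus, Cplus, Copp; simpl; ring].
Qed.

Lemma zsum_to_unique a l1 l2 : zsum_to a l1 -> zsum_to a l2 -> l1 = l2.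
Proof.
  intros H1 H2. destruct (Ceq_dec l1 l2) as [|Hn]; [assumption|exfalso].
  assert (Hp : 0 < Cmod (Cminus l1 l2)).
  { apply Cmod_gt_0. intros E. apply Hn. replace l1 with (Cplus (Cminus l1 l2) l2) by ring. rewrite E; ring. }
  destruct (H1 (Cmod (Cminus l1 l2) / 2)) as [N1 HN1]; [lra|].
  destruct (H2 (Cmod (Cminus l1 l2) / 2)) as [N2 HN2]; [lra|].
  specialize (HN1 (max N1 N2) ltac:(lia)). specialize (HN2 (max N1 N2) ltac:(lia)).
  pose proof (Cmod_tri_minus l1 (zpartial a (max N1 N2)) l2) as T.
  rewrite (Cmod_minus_sym l1 (zpartial a (max N1 N2))) in T. lra.
Qed.

Lemma zsum_unique a l : zsum_to a l -> asum a -> zsum a = l.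
Proof. intros H Ha. eapply zsum_to_unique; [apply zsum_correct, Ha|exact H]. Qed.

Lemma zpartial_ext a b N : (forall k, a k = b k) -> zpartial a N = zpartial b N.
Proof. intros H. unfold zpartial. apply csum_ext. intros; apply H. Qed.

Lemma zsum_to_ext a b l : (forall k, a k = b k) -> zsum_to a l -> zsum_to b l.
Proof. intros H Ha eps He. destruct (Ha eps He) as [N HN]. exists N. intros. rewrite <- (zpartial_ext a b); auto. Qed.

Lemma zsum_ext a b : (forall k, a k = b k) -> zsum a = zsum b.
Proof.
  intros H. unfold zsum. f_equal; f_equal; apply Lim_seq_ext; intros n; now rewrite (zpartial_ext a b).
Qed.

Lemma zpartial_plus a b N : zpartial (fun k => Cplus (a k) (b k)) N = Cplus (zpartial a N) (zpartial b N).
Proof. unfold zpartial. apply csum_plus. Qed.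
Lemma zpartial_scal c a N : zpartial (fun k => Cmult c (a k)) N = Cmult c (zpartial a N).
Proof. unfold zpartial. apply csum_scal. Qed.

Lemma zsum_to_plus a b l m : zsum_to a l -> zsum_to b m -> zsum_to (fun k => Cplus (a k) (b k)) (Cplus l m).
Proof.
  intros H1 H2 eps He. destruct (H1 (eps / 2)) as [N1 HN1]; [lra|]. destruct (H2 (eps / 2)) as [N2 HN2]; [lra|].
  exists (max N1 N2). intros N HN. rewrite zpartial_plus.
  replace (Cminus (Cplus (zpartial a N) (zpartial b N)) (Cplus l m)) with
    (Cplus (Cminus (zpartial a N) l) (Cminus (zpartial b N) m)) by ring.
  eapply Rle_lt_trans; [apply Cmod_triangle|].
  specialize (HN1 N ltac:(lia)). specialize (HN2 N ltac:(lia)). lra.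
Qed.

Lemma zsum_to_scal c a l : zsum_to a l -> zsum_to (fun k => Cmult c (a k)) (Cmult c l).
Proof.
  intros H eps He. pose proof (Cmod_ge_0 c) as Hc.
  destruct (H (eps / (Cmod c + 1))) as [N0 HN0].
  { apply Rdiv_lt_0_compat; lra. }
  exists N0. intros N HN. rewrite zpartial_scal.
  replace (Cminus (Cmult c (zpartial a N)) (Cmult c l)) with (Cmult c (Cminus (zpartial a N) l)) by ring.
  rewrite Cmod_mult. specialize (HN0 N HN).
  apply Rle_lt_trans with (Cmod c * (eps / (Cmod c + 1))).
  - apply Rmult_le_compat_l; lra.
  - apply Rlt_le_trans with ((Cmod c + 1) * (eps / (Cmod c + 1))).
    + apply Rmult_lt_compat_r; [apply Rdiv_lt_0_compat|]; lra.
    + right; field; lra.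
Qed.

Lemma zsum_to_0 a : (forall k, a k = RtoC 0) -> zsum_to a (RtoC 0).
Proof.
  intros H eps He. exists 0%nat. intros N _. unfold zpartial. rewrite csum_0 by (intros; apply H).
  replace (Cminus (RtoC 0) (RtoC 0)) with (RtoC 0) by ring. rewrite Cmod_0; lra.
Qed.

Lemma asum_0 a : (forall k, a k = RtoC 0) -> asum a.
Proof.
  intros H. exists 0. intros N. induction N; simpl rpart; rewrite !H, ?Cmod_0; lra.
Qed.

Lemma zsum_0 a : (forall k, a k = RtoC 0) -> zsum a = RtoC 0.
Proof. intros H. apply zsum_unique; [now apply zsum_to_0|now apply asum_0]. Qed.

Lemma asum_plus a b : asum a -> asum b -> asum (fun k => Cplus (a k) (b k)).
Proof.
  intros [A HA] [B HB]. exists (A + B). intros N.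
  apply Rle_trans with (rpart a N + rpart b N); [|specialize (HA N); specialize (HB N); lra].
  clear. induction N as [|N IH]; simpl rpart; [apply Cmod_triangle|].
  simpl in *.
  pose proof (Cmod_triangle (a (Z.pos (Pos.of_succ_nat N))) (b (Z.pos (Pos.of_succ_nat N)))).
  pose proof (Cmod_triangle (a (Z.neg (Pos.of_succ_nat N))) (b (Z.neg (Pos.of_succ_nat N)))). lra.
Qed.

Lemma asum_scal c a : asum a -> asum (fun k => Cmult c (a k)).
Proof. apply (asum_dom _ _ (Cmod c)); [apply Cmod_ge_0|intros; rewrite Cmod_mult; lra]. Qed.

Lemma zsum_plus a b : asum a -> asum b -> zsum (fun k => Cplus (a k) (b k)) = Cplus (zsum a) (zsum b).
Proof. intros Ha Hb. apply zsum_unique; [apply zsum_to_plus; now apply zsum_correct|now apply asum_plus]. Qed.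

Lemma zsum_scal c a : asum a -> zsum (fun k => Cmult c (a k)) = Cmult c (zsum a).
Proof. intros Ha. apply zsum_unique; [apply zsum_to_scal; now apply zsum_correct|now apply asum_scal]. Qed.

Lemma zsum_to_bound a l B N0 : zsum_to a l -> (forall N, (N0 <= N)%nat -> Cmod (zpartial a N) <= B) -> Cmod l <= B.
Proof.
  intros H HB. apply Rnot_lt_le. intros Hlt.
  destruct (H (Cmod l - B)) as [N1 HN1]; [lra|].
  specialize (HN1 (max N0 N1) ltac:(lia)). specialize (HB (max N0 N1) ltac:(lia)).
  pose proof (Cmod_triangle (zpartial a (max N0 N1)) (Cminus l (zpartial a (max N0 N1)))) as T.
  replace (Cplus (zpartial a (max N0 N1)) (Cminus l (zpartial a (max N0 N1)))) with l in T by ring.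
  rewrite (Cmod_minus_sym l (zpartial a (max N0 N1))) in T. lra.
Qed.

Lemma zsum_to_minus_const a l c : zsum_to a l -> forall N0,
  forall B, (forall N, (N0 <= N)%nat -> Cmod (Cminus (zpartial a N) c) <= B) -> Cmod (Cminus l c) <= B.
Proof.
  intros H N0 B HB. apply Rnot_lt_le. intros Hlt.
  destruct (H (Cmod (Cminus l c) - B)) as [N1 HN1]; [lra|].
  specialize (HN1 (max N0 N1) ltac:(lia)). specialize (HB (max N0 N1) ltac:(lia)).
  pose proof (Cmod_tri_minus l (zpartial a (max N0 N1)) c) as T.
  rewrite (Cmod_minus_sym l (zpartial a (max N0 N1))) in T. lra.
Qed.

Lemma zsum_tail a b c N : 0 <= c -> (forall k, Cmod (a k) <= c * Cmod (b k)) -> asum b ->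
  Cmod (Cminus (zsum a) (zpartial a N)) <= c * (rtot b - rpart b N).
Proof.
  intros Hc H Hb.
  apply (zsum_to_minus_const a (zsum a) _ (zsum_correct a (asum_dom a b c Hc H Hb)) N).
  intros M HM. eapply Rle_trans; [now apply (zpartial_diff_dom a b c)|].
  apply Rmult_le_compat_l; [assumption|]. pose proof (rpart_le_rtot b M Hb); lra.
Qed.

Lemma zpartial_le a b c N : (forall k, Cmod (a k) <= c * Cmod (b k)) -> Cmod (zpartial a N) <= c * rpart b N.
Proof.
  intros H. induction N as [|N IH]; [rewrite zpartial_0; apply H|].
  rewrite zpartial_S. change (rpart b (S N)) with (rpart b N + (Cmod (b (Z.of_nat (S N))) + Cmod (b (- Z.of_nat (S N))%Z))).
  eapply Rle_trans; [apply Cmod_triangle|].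
  pose proof (Cmod_triangle (a (Z.of_nat (S N))) (a (- Z.of_nat (S N))%Z)).
  pose proof (H (Z.of_nat (S N))). pose proof (H (- Z.of_nat (S N))%Z). lra.
Qed.

Lemma zsum_le a b c : 0 <= c -> (forall k, Cmod (a k) <= c * Cmod (b k)) -> asum b -> Cmod (zsum a) <= c * rtot b.
Proof.
  intros Hc H Hb.
  apply (zsum_to_bound a _ _ 0%nat (zsum_correct a (asum_dom a b c Hc H Hb))).
  intros N _. eapply Rle_trans; [apply (zpartial_le a b c N H)|].
  apply Rmult_le_compat_l; [assumption|now apply rpart_le_rtot].
Qed.

Lemma zsum_zpartial (a : Z -> Z -> C) N : (forall j, asum (a j)) ->
  zpartial (fun j => zsum (a j)) N = zsum (fun k => zpartial (fun j => a j k) N) /\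
  asum (fun k => zpartial (fun j => a j k) N).
Proof.
  intros H. unfold zpartial.
  induction (seq 0 (2 * N + 1)) as [|x l [IH1 IH2]]; simpl map.
  - split; [symmetry; now apply zsum_0|now apply asum_0].
  - split.
    + rewrite csum_cons, IH1, <- zsum_plus by auto. apply zsum_ext. intros; reflexivity.
    + now apply (asum_plus (a (Z.of_nat x - Z.of_nat N)%Z)).
Qed.

(** Fubini under a product majorant: a finite partial sum over j passes through the sum over k, and
    what is left is at most the tail of [al] times the total of [be]. *)
Lemma zsum_swap (a : Z -> Z -> C) (al be : Z -> C) : asum al -> asum be ->
  (forall j k, Cmod (a j k) <= Cmod (al j) * Cmod (be k)) ->
  zsum (fun j => zsum (fun k => a j k)) = zsum (fun k => zsum (fun j => a j k)).
Proof.
  intros Hal Hbe H.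
  assert (H1 : forall j, asum (a j)).
  { intros j. apply (asum_dom _ be (Cmod (al j))); [apply Cmod_ge_0|apply H|assumption]. }
  assert (H2 : forall k, asum (fun j => a j k)).
  { intros k. apply (asum_dom _ al (Cmod (be k))); [apply Cmod_ge_0|intros j; rewrite Rmult_comm; apply H|assumption]. }
  assert (Hr : forall b, asum b -> 0 <= rtot b).
  { intros b Hb. eapply Rle_trans; [apply (rpart_ge0 b 0)|now apply rpart_le_rtot]. }
  assert (H3 : asum (fun k => zsum (fun j => a j k))).
  { apply (asum_dom _ be (rtot al)); [now apply Hr| |assumption].
    intros k. rewrite Rmult_comm. apply zsum_le; [apply Cmod_ge_0| |assumption].
    intros j; rewrite Rmult_comm; apply H. }
  assert (H4 : asum (fun j => zsum (a j))).
  { apply (asum_dom _ al (rtot be)); [now apply Hr| |assumption].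
    intros j. rewrite Rmult_comm. apply zsum_le; [apply Cmod_ge_0| |assumption]. apply H. }
  apply zsum_unique; [|assumption].
  intros eps He. pose proof (rtot_lim al Hal) as HL. apply is_lim_seq_spec in HL.
  (* The added 1 covers the case where the total of [be] is 0. *)
  assert (Hd : 0 < eps / (rtot be + 1)).
  { apply Rdiv_lt_0_compat; [lra|]. pose proof (Hr be Hbe); lra. }
  destruct (HL (mkposreal _ Hd)) as [N0 HN0]. simpl in HN0.
  exists N0. intros N HN.
  destruct (zsum_zpartial a N H1) as [E1 E2]. change (fun j => zsum (fun k => a j k)) with (fun j => zsum (a j)); rewrite E1.
  rewrite Cmod_minus_sym.
  replace (Cminus (zsum (fun k => zsum (fun j => a j k))) (zsum (fun k => zpartial (fun j => a j k) N)))
    with (zsum (fun k => Cminus (zsum (fun j => a j k)) (zpartial (fun j => a j k) N))).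
  2:{ unfold Cminus at 1.
      rewrite (zsum_ext _ (fun k => Cplus (zsum (fun j => a j k)) (Cmult (Copp (RtoC 1)) (zpartial (fun j => a j k) N)))) by (intros; ring).
      rewrite zsum_plus, zsum_scal; auto using asum_scal. ring. }
  eapply Rle_lt_trans.
  - apply (zsum_le _ be (rtot al - rpart al N)); [pose proof (rpart_le_rtot al N Hal); lra| |assumption].
    intros k. rewrite Rmult_comm. apply zsum_tail; [apply Cmod_ge_0| |assumption].
    intros j; rewrite Rmult_comm; apply H.
  - specialize (HN0 N HN). pose proof (rpart_le_rtot al N Hal). rewrite Rabs_left1 in HN0 by lra.
    pose proof (Hr be Hbe).
    apply Rle_lt_trans with ((rtot al - rpart al N) * (rtot be + 1)); [nra|].
    apply Rlt_le_trans with (eps / (rtot be + 1) * (rtot be + 1)).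
    + apply Rmult_lt_compat_r; lra.
    + right; field; lra.
Qed.

Lemma zpartial_shift a N :
  zpartial (fun k => a (k + 1)%Z) N = Cplus (zpartial a N) (Cminus (a (Z.of_nat (S N))) (a (- Z.of_nat N)%Z)).
Proof.
  induction N as [|N IH].
  - rewrite !zpartial_0. simpl. ring.
  - rewrite zpartial_S, IH, zpartial_S.
    replace (Z.of_nat (S N) + 1)%Z with (Z.of_nat (S (S N))) by lia.
    replace (- Z.of_nat (S N) + 1)%Z with (- Z.of_nat N)%Z by lia. ring.
Qed.

(** Symmetric partial sums are not invariant under shifts: the two boundary terms of
    [zpartial_shift] have to tend to 0, which absolute summability provides. *)
Lemma zsum_to_shift a l : asum a -> zsum_to a l -> zsum_to (fun k => a (k + 1)%Z) l.
Proof.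
  intros Ha H eps He. destruct (H (eps / 2)) as [N1 HN1]; [lra|].
  pose proof (rtot_lim a Ha) as HL. apply is_lim_seq_spec in HL.
  assert (He4 : 0 < eps / 4) by lra.
  destruct (HL (mkposreal _ He4)) as [N2 HN2]. simpl in HN2.
  exists (S (max N1 N2)). intros N HN. rewrite zpartial_shift.
  replace (Cminus (Cplus (zpartial a N) (Cminus (a (Z.of_nat (S N))) (a (- Z.of_nat N)%Z))) l)
    with (Cplus (Cminus (zpartial a N) l) (Cplus (a (Z.of_nat (S N))) (Copp (a (- Z.of_nat N)%Z)))) by ring.
  eapply Rle_lt_trans; [apply Cmod_triangle|].
  pose proof (Cmod_triangle (a (Z.of_nat (S N))) (Copp (a (- Z.of_nat N)%Z))) as T. rewrite Cmod_opp in T.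
  specialize (HN1 N ltac:(lia)).
  assert (T1 : forall M, (S N2 <= M)%nat -> Cmod (a (Z.of_nat M)) + Cmod (a (- Z.of_nat M)%Z) < eps / 4).
  { intros [|M] HM; [lia|].
    pose proof (HN2 M ltac:(lia)) as X. pose proof (rpart_le_rtot a (S M) Ha) as Y.
    change (rpart a (S M)) with (rpart a M + (Cmod (a (Z.of_nat (S M))) + Cmod (a (- Z.of_nat (S M))%Z))) in Y.
    apply Rabs_def2 in X. lra. }
  pose proof (T1 N ltac:(lia)). pose proof (T1 (S N) ltac:(lia)).
  pose proof (Cmod_ge_0 (a (Z.of_nat N))). pose proof (Cmod_ge_0 (a (- Z.of_nat (S N))%Z)). lra.
Qed.

Lemma zpartial_neg a N : zpartial (fun k => a (- k)%Z) N = zpartial a N.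
Proof.
  induction N as [|N IH]; [now rewrite !zpartial_0|].
  rewrite !zpartial_S, IH, Z.opp_involutive. ring.
Qed.

Lemma zsum_neg a : zsum (fun k => a (- k)%Z) = zsum a.
Proof. unfold zsum. f_equal; f_equal; apply Lim_seq_ext; intros n; now rewrite zpartial_neg. Qed.

(** * Exponential weights and exponentially dominated families *)

Definition ew (nu : R) (t : Z) : R := exp (- nu * IZR (Z.abs t)).

Lemma ew_pos nu t : 0 < ew nu t. Proof. apply exp_pos. Qed.

Lemma exp_le x y : x <= y -> exp x <= exp y.
Proof. intros [H| ->]; [left; now apply exp_increasing|lra]. Qed.

Lemma IZR_abs_ge0 t : 0 <= IZR (Z.abs t). Proof. apply IZR_le; lia. Qed.

Lemma ew_le1 nu t : 0 <= nu -> ew nu t <= 1.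
Proof. intros H. unfold ew. rewrite <- exp_0. apply exp_le. pose proof (IZR_abs_ge0 t). nra. Qed.

Lemma ew_mono nu mu t : mu <= nu -> ew nu t <= ew mu t.
Proof. intros H. apply exp_le. pose proof (IZR_abs_ge0 t). nra. Qed.

Lemma ew_mul nu mu t : ew nu t * ew mu t = ew (nu + mu) t.
Proof. unfold ew. rewrite <- exp_plus. f_equal; ring. Qed.

Lemma ew_tri nu s t : 0 <= nu -> ew nu s * ew nu t <= ew nu (s + t).
Proof.
  intros H. unfold ew. rewrite <- exp_plus. apply exp_le.
  assert (IZR (Z.abs (s + t)) <= IZR (Z.abs s) + IZR (Z.abs t)) by (rewrite <- plus_IZR; apply IZR_le; lia). nra.
Qed.

Lemma ew_opp nu t : ew nu (- t) = ew nu t.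
Proof. unfold ew. now rewrite Z.abs_opp. Qed.

Lemma ew_0 nu : ew nu 0 = 1.
Proof. unfold ew. simpl. rewrite Rmult_0_r. apply exp_0. Qed.

Lemma Cmod_ew nu t : Cmod (RtoC (ew nu t)) = ew nu t.
Proof. rewrite Cmod_R. apply Rabs_right. left; apply ew_pos. Qed.

Lemma ew_nat nu n : ew nu (Z.of_nat n) = exp (- nu) ^ n.
Proof.
  unfold ew. rewrite Z.abs_eq, <- INR_IZR_INZ by lia. induction n as [|n IH].
  - simpl. rewrite Rmult_0_r; apply exp_0.
  - rewrite S_INR. simpl pow. rewrite <- IH, <- exp_plus. f_equal; ring.
Qed.

Lemma ew_asum nu : 0 < nu -> asum (fun k => RtoC (ew nu k)).
Proof.
  intros H. set (x := exp (- nu)).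
  assert (Hx : 0 < x < 1).
  { split; [apply exp_pos|]. unfold x. rewrite <- exp_0. apply exp_increasing; lra. }
  exists (1 + 2 * (x / (1 - x))). intros N.
  apply Rle_trans with (1 + 2 * (1 - x ^ N) * (x / (1 - x))).
  - induction N as [|N IH].
    + simpl. rewrite Cmod_ew, ew_0. lra.
    + change (rpart (fun k => RtoC (ew nu k)) N + (Cmod (ew nu (Z.of_nat (S N))) + Cmod (ew nu (- Z.of_nat (S N)))) <=
        1 + 2 * (1 - x ^ S N) * (x / (1 - x))).
      rewrite !Cmod_ew, ew_opp, ew_nat. fold x. simpl pow.
      replace (1 + 2 * (1 - x * x ^ N) * (x / (1 - x))) with (1 + 2 * (1 - x ^ N) * (x / (1 - x)) + (x * x ^ N + x * x ^ N)) by (field; lra).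
      lra.
  - assert (0 < x ^ N) by (apply pow_lt; lra).
    assert (0 < x / (1 - x)) by (apply Rdiv_lt_0_compat; lra). nra.
Qed.

Definition SS (nu : R) : R := rtot (fun k => RtoC (ew nu k)).

Lemma SS_ge1 nu : 0 < nu -> 1 <= SS nu.
Proof.
  intros H. eapply Rle_trans; [|apply (rpart_le_rtot _ 0%nat (ew_asum nu H))].
  simpl. rewrite Cmod_ew, ew_0; lra.
Qed.

Definition edom (a : Z -> C) : Prop :=
  exists D nu, 0 < nu /\ forall k, Cmod (a k) <= D * ew nu k.

Lemma dom_ge0 (x D e : R) : 0 <= x -> 0 < e -> x <= D * e -> 0 <= D.
Proof. intros. apply Rnot_lt_le. intros Hd. nra. Qed.

(** Recentring from z to 0 costs the constant [/ ew nu z], so domination may be checked about any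
    convenient site. *)
Lemma edom_at a D nu z : 0 < nu -> (forall k, Cmod (a k) <= D * ew nu (k - z)) -> edom a.
Proof.
  intros Hn H.
  assert (HD : 0 <= D) by (apply (dom_ge0 (Cmod (a 0%Z)) D (ew nu (0 - z))); [apply Cmod_ge_0|apply ew_pos|apply H]).
  exists (D * / ew nu z), nu. split; [assumption|]. intros k.
  eapply Rle_trans; [apply H|]. rewrite Rmult_assoc. apply Rmult_le_compat_l; [assumption|].
  apply (Rmult_le_reg_l (ew nu z)); [apply ew_pos|]. rewrite <- Rmult_assoc, Rinv_r, Rmult_1_l by (pose proof (ew_pos nu z); lra).
  eapply Rle_trans; [apply ew_tri; lra|]. right; f_equal; lia.
Qed.

Lemma edom_asum a : edom a -> asum a.
Proof.
  intros (D & nu & Hn & H). apply (asum_dom _ (fun k => RtoC (ew nu k)) D).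
  - apply (dom_ge0 (Cmod (a 0%Z)) D (ew nu 0)); [apply Cmod_ge_0|apply ew_pos|apply H].
  - intros k; rewrite Cmod_ew; apply H.
  - now apply ew_asum.
Qed.

Lemma edom_shift a z : edom a -> edom (fun k => a (k + z)%Z).
Proof.
  intros (D & nu & Hn & H). apply (edom_at _ D nu (- z) Hn). intros k.
  replace (k - - z)%Z with (k + z)%Z by lia. apply H.
Qed.

Lemma edom_ext a b : (forall k, a k = b k) -> edom a -> edom b.
Proof. intros E (D & nu & Hn & H). exists D, nu. split; auto. intros k. rewrite <- E; auto. Qed.

Lemma edom_neg a : edom a -> edom (fun k => a (- k)%Z).
Proof. intros (D & nu & Hn & H). exists D, nu. split; auto. intros k. rewrite <- (ew_opp nu k). apply H. Qed.

Lemma edom_scal c a : edom a -> edom (fun k => Cmult c (a k)).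
Proof.
  intros (D & nu & Hn & H). exists (Cmod c * D), nu. split; auto. intros k. rewrite Cmod_mult, Rmult_assoc.
  apply Rmult_le_compat_l; [apply Cmod_ge_0|apply H].
Qed.

Lemma edom_bmul a b B : edom a -> (forall k, Cmod (b k) <= B) -> edom (fun k => Cmult (a k) (b k)).
Proof.
  intros (D & nu & Hn & H) HB. exists (D * B), nu. split; auto. intros k. rewrite Cmod_mult.
  replace (D * B * ew nu k) with ((D * ew nu k) * B) by ring.
  apply Rmult_le_compat; try apply Cmod_ge_0; auto.
Qed.

Lemma zsum_shift1 a : edom a -> zsum (fun k => a (k + 1)%Z) = zsum a.
Proof.
  intros H. apply zsum_unique.
  - apply zsum_to_shift; [now apply edom_asum|]. apply zsum_correct; now apply edom_asum.
  - apply edom_asum. now apply (edom_shift a 1).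
Qed.

Lemma zsum_shift a z : edom a -> zsum (fun k => a (k + z)%Z) = zsum a.
Proof.
  assert (Hp : forall n b, edom b -> zsum (fun k => b (k + Z.of_nat n)%Z) = zsum b).
  { induction n as [|n IH]; intros b Hb.
    - apply zsum_ext; intros; f_equal; lia.
    - rewrite <- (IH b Hb). rewrite <- (zsum_shift1 (fun k => b (k + Z.of_nat n)%Z)).
      + apply zsum_ext. intros; f_equal; lia.
      + now apply edom_shift. }
  intros Ha. destruct (Z_le_gt_dec 0 z) as [Hz|Hz].
  - rewrite <- (Hp (Z.to_nat z) a Ha). apply zsum_ext. intros; f_equal; lia.
  - rewrite <- (Hp (Z.to_nat (- z)) (fun k => a (k + z)%Z)) by now apply edom_shift.
    apply zsum_ext. intros; f_equal; lia.
Qed.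

(** A shift of the index centres the weight, so the bound is uniform in z. Later convolution
    estimates put part of the decay into such a centred sum and keep the rest. *)
Lemma zsum_le_at a D nu z : 0 < nu -> (forall k, Cmod (a k) <= D * ew nu (k - z)) -> Cmod (zsum a) <= D * SS nu.
Proof.
  intros Hn H. rewrite <- (zsum_shift a z) by now apply (edom_at a D nu z).
  apply zsum_le.
  - apply (dom_ge0 (Cmod (a 0%Z)) D (ew nu (0 - z))); [apply Cmod_ge_0|apply ew_pos|apply H].
  - intros k. rewrite Cmod_ew. eapply Rle_trans; [apply H|]. right. do 2 f_equal; lia.
  - now apply ew_asum.
Qed.

Lemma zsum_swap_at (a : Z -> Z -> C) D nu z1 z2 : 0 < nu ->
  (forall j k, Cmod (a j k) <= D * (ew nu (j - z1) * ew nu (k - z2))) ->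
  zsum (fun j => zsum (fun k => a j k)) = zsum (fun k => zsum (fun j => a j k)).
Proof.
  intros Hn H.
  assert (HD : 0 <= D).
  { apply (dom_ge0 (Cmod (a 0%Z 0%Z)) D (ew nu (0 - z1) * ew nu (0 - z2))); [apply Cmod_ge_0| |apply H].
    apply Rmult_lt_0_compat; apply ew_pos. }
  apply (zsum_swap a (fun j => RtoC (D * ew nu (j - z1))) (fun k => RtoC (ew nu (k - z2)))).
  - apply edom_asum. apply (edom_at _ D nu z1 Hn). intros k. rewrite Cmod_R, Rabs_right; [lra|].
    apply Rle_ge, Rmult_le_pos; [assumption|left; apply ew_pos].
  - apply edom_asum. apply (edom_at _ 1 nu z2 Hn). intros k. rewrite Cmod_ew; lra.
  - intros j k. rewrite Cmod_ew, Cmod_R, Rabs_right.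
    + rewrite Rmult_assoc; apply H.
    + apply Rle_ge, Rmult_le_pos; [assumption|left; apply ew_pos].
Qed.

Lemma zsum_delta (v : Z -> C) x : zsum (fun k => if Z.eqb k x then v k else RtoC 0) = v x.
Proof.
  set (a := fun k => if Z.eqb k x then v k else RtoC 0).
  assert (Ha : edom a).
  { apply (edom_at a (Cmod (v x)) 1 x); [lra|]. intros k. unfold a. destruct (Z.eqb_spec k x) as [->|].
    - rewrite Z.sub_diag, ew_0; lra.
    - rewrite Cmod_0. apply Rmult_le_pos; [apply Cmod_ge_0|left; apply ew_pos]. }
  rewrite <- (zsum_shift a x Ha). apply zsum_unique; [|apply edom_asum; now apply edom_shift].
  intros eps He. exists 0%nat. intros N _.
  replace (zpartial (fun k => a (k + x)%Z) N) with (v x).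
  - replace (Cminus (v x) (v x)) with (RtoC 0) by ring. rewrite Cmod_0; lra.
  - induction N as [|N IH].
    + rewrite zpartial_0. unfold a. rewrite Z.add_0_l, Z.eqb_refl. reflexivity.
    + rewrite zpartial_S, <- IH. unfold a.
      destruct (Z.eqb_spec (Z.of_nat (S N) + x) x); [lia|].
      destruct (Z.eqb_spec (- Z.of_nat (S N) + x) x); [lia|]. ring.
Qed.

(** * Laurent series and their zeros *)

(** The k-th power of the point e^(x + i th). In logarithmic polar coordinates a circle is a fixed
    x, and an annulus around the unit circle is |x| <= mu. *)
Definition cz (x th : R) (k : Z) : C :=
  (exp (IZR k * x) * cos (IZR k * th), exp (IZR k * x) * sin (IZR k * th)).

Lemma cz_add x th j k : cz x th (j + k) = Cmult (cz x th j) (cz x th k).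
Proof.
  unfold cz, Cmult; simpl. rewrite plus_IZR, !Rmult_plus_distr_r, exp_plus, cos_plus, sin_plus. f_equal; ring.
Qed.

Lemma cz_0 x th : cz x th 0 = RtoC 1.
Proof. unfold cz, RtoC. rewrite !Rmult_0_l, exp_0, cos_0, sin_0. f_equal; ring. Qed.

Lemma Cmod_cz x th k : Cmod (cz x th k) = exp (IZR k * x).
Proof.
  unfold Cmod, cz; simpl fst; simpl snd.
  pose proof (sin2_cos2 (IZR k * th)) as E. unfold Rsqr in E.
  replace ((exp (IZR k * x) * cos (IZR k * th)) ^ 2 + (exp (IZR k * x) * sin (IZR k * th)) ^ 2)
    with (exp (IZR k * x) ^ 2 * (sin (IZR k * th) * sin (IZR k * th) + cos (IZR k * th) * cos (IZR k * th))) by ring.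
  rewrite E, Rmult_1_r. apply sqrt_pow2. left; apply exp_pos.
Qed.

Lemma exp_ew x mu k : Rabs x <= mu -> exp (IZR k * x) * ew mu k <= 1.
Proof.
  intros H. unfold ew. rewrite <- exp_plus, <- exp_0. apply exp_le. rewrite abs_IZR.
  apply Rle_trans with (Rabs (IZR k) * Rabs x + - mu * Rabs (IZR k)); [|pose proof (Rabs_pos (IZR k)); nra].
  pose proof (Rle_abs (IZR k * x)) as T. rewrite Rabs_mult in T. lra.
Qed.

Lemma exp_le_ew x mu k : Rabs x <= mu -> exp (IZR k * x) <= / ew mu k.
Proof.
  intros H. pose proof (exp_ew x mu k H). pose proof (ew_pos mu k).
  apply (Rmult_le_reg_r (ew mu k)); [assumption|]. rewrite Rinv_l by lra. assumption.
Qed.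

(* The value at w = e^(x + i th) of the Laurent series with coefficients c. *)
Definition laurent (c : Z -> C) (x th : R) : C := zsum (fun k => Cmult (c k) (cz x th k)).

Lemma cz_dom c A M mu x th k : Rabs x <= mu -> Cmod (c k) <= A * ew M k ->
  Cmod (Cmult (c k) (cz x th k)) <= A * ew (M - mu) k.
Proof.
  intros Hx H. rewrite Cmod_mult, Cmod_cz.
  replace (A * ew (M - mu) k) with (A * ew M k * / ew mu k).
  - apply Rmult_le_compat; [apply Cmod_ge_0|left; apply exp_pos|assumption|now apply exp_le_ew].
  - replace M with (M - mu + mu) at 1 by ring. rewrite <- ew_mul. field. pose proof (ew_pos mu k); lra.
Qed.

Lemma cz_edom c A M mu x th : mu < M -> Rabs x <= mu -> (forall k, Cmod (c k) <= A * ew M k) ->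
  edom (fun k => Cmult (c k) (cz x th k)).
Proof. intros Hm Hx H. exists A, (M - mu). split; [lra|]. intros k. now apply cz_dom. Qed.

Lemma laurent_bound c A M mu x th : mu < M -> Rabs x <= mu -> (forall k, Cmod (c k) <= A * ew M k) ->
  Cmod (laurent c x th) <= A * SS (M - mu).
Proof.
  intros Hm Hx H. apply (zsum_le_at _ A (M - mu) 0); [lra|]. intros k. rewrite Z.sub_0_r. now apply cz_dom.
Qed.

(* Quotient of the Laurent series by [w' - w], where w = e^(x + i th) is a zero. *)
Definition quot (c : Z -> C) (x th : R) (k : Z) : C :=
  zsum (fun j => if Z.ltb k j then Cmult (c j) (cz x th (j - k - 1)) else RtoC 0).

(** The factor lost when a series is divided by the linear factor at a zero. It depends neither on
    the series nor on the zero, and the rate M is kept, so divisions can be iterated. *)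
Definition qcst (M mu : R) := exp mu * SS (M - mu).

Section Quotient.
Variables (c : Z -> C) (A M mu x th : R).
Hypotheses (Hmu : mu < M) (Hx : Rabs x <= mu) (Hc : forall k, Cmod (c k) <= A * ew M k).
Hypothesis Hz : laurent c x th = RtoC 0.

Let HA : 0 <= A.
Proof. apply (dom_ge0 (Cmod (c 0%Z)) A (ew M 0)); [apply Cmod_ge_0|apply ew_pos|apply Hc]. Qed.

Let Hmu0 : 0 <= mu.
Proof. pose proof (Rabs_pos x); lra. Qed.

Let term_edom k : edom (fun j => Cmult (c j) (cz x th (j - k - 1))).
Proof.
  apply (edom_ext (fun j => Cmult (cz x th (- k - 1)) (Cmult (c j) (cz x th j)))).
  - intros j. replace (j - k - 1)%Z with (j + (- k - 1))%Z by lia. rewrite cz_add. ring.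
  - apply edom_scal. now apply (cz_edom c A M mu).
Qed.

Let part_edom (P : Z -> bool) k : edom (fun j => if P j then Cmult (c j) (cz x th (j - k - 1)) else RtoC 0).
Proof.
  destruct (term_edom k) as (D & nu & Hn & H). exists D, nu. split; [assumption|]. intros j.
  destruct (P j); [apply H|]. rewrite Cmod_0. eapply Rle_trans; [apply Cmod_ge_0|apply H].
Qed.

(** The right and left tails of the series at its zero add up to 0. The right tail is small for
    large k and the left one for large -k, so the quotient decays in both directions. *)
Lemma quot_other k :
  quot c x th k = Copp (zsum (fun j => if Z.leb j k then Cmult (c j) (cz x th (j - k - 1)) else RtoC 0)).
Proof.
  assert (E : Cplus (quot c x th k) (zsum (fun j => if Z.leb j k then Cmult (c j) (cz x th (j - k - 1)) else RtoC 0)) = RtoC 0).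
  { unfold quot. rewrite <- zsum_plus by (apply edom_asum, part_edom).
    rewrite (zsum_ext _ (fun j => Cmult (cz x th (- k - 1)) (Cmult (c j) (cz x th j)))).
    - rewrite zsum_scal by (apply edom_asum; now apply (cz_edom c A M mu)).
      change (zsum (fun j => Cmult (c j) (cz x th j))) with (laurent c x th). rewrite Hz. ring.
    - intros j. replace (j - k - 1)%Z with (j + (- k - 1))%Z by lia. rewrite cz_add.
      destruct (Z.ltb_spec k j), (Z.leb_spec j k); try lia; ring. }
  set (u := zsum _) in *. replace (quot c x th k) with (Cminus (Cplus (quot c x th k) u) u) by ring. rewrite E. ring.
Qed.

Lemma quot_bound k : Cmod (quot c x th k) <= A * qcst M mu * ew M k.
Proof.
  unfold qcst.
  assert (Hexp : 1 <= exp mu) by (rewrite <- exp_0; apply exp_le; assumption).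
  assert (HS : 1 <= SS (M - mu)) by (apply SS_ge1; lra).
  pose proof (ew_pos M k).
  destruct (Z_le_gt_dec 0 k) as [Hk|Hk].
  - apply Rle_trans with (A * ew M k * SS (M - mu)).
    2:{ replace (A * (exp mu * SS (M - mu)) * ew M k) with (exp mu * (A * ew M k * SS (M - mu))) by ring.
        assert (0 <= A * ew M k * SS (M - mu)) by (repeat apply Rmult_le_pos; lra). nra. }
    apply (zsum_le_at _ _ (M - mu) (k + 1)); [lra|]. intros j.
    destruct (Z.ltb_spec k j) as [Hj|Hj].
    + rewrite Cmod_mult, Cmod_cz.
      apply Rle_trans with ((A * ew M j) * / ew mu (j - k - 1)).
      * apply Rmult_le_compat; [apply Cmod_ge_0|left; apply exp_pos|apply Hc|now apply exp_le_ew].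
      * rewrite !Rmult_assoc. apply Rmult_le_compat_l; [assumption|].
        unfold ew. rewrite <- exp_Ropp, <- !exp_plus. apply exp_le.
        rewrite !Z.abs_eq by lia. replace (j - (k + 1))%Z with (j - k - 1)%Z by lia.
        rewrite !minus_IZR. nra.
    + rewrite Cmod_0. repeat apply Rmult_le_pos; try lra; left; apply ew_pos.
  (* For negative k the left tail is estimated; there |j - k - 1| = (k - j) + 1, and the extra 1 is
     the origin of the factor [exp mu]. *)
  - rewrite quot_other, Cmod_opp.
    replace (A * (exp mu * SS (M - mu)) * ew M k) with (A * exp mu * ew M k * SS (M - mu)) by ring.
    apply (zsum_le_at _ _ (M - mu) k); [lra|]. intros j.
    destruct (Z.leb_spec j k) as [Hj|Hj].
    + rewrite Cmod_mult, Cmod_cz.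
      apply Rle_trans with ((A * ew M j) * / ew mu (j - k - 1)).
      * apply Rmult_le_compat; [apply Cmod_ge_0|left; apply exp_pos|apply Hc|now apply exp_le_ew].
      * rewrite !Rmult_assoc. apply Rmult_le_compat_l; [assumption|].
        unfold ew. rewrite <- exp_Ropp, <- !exp_plus. apply exp_le.
        rewrite !Z.abs_neq by lia. rewrite !opp_IZR, !minus_IZR. nra.
    + rewrite Cmod_0. repeat apply Rmult_le_pos; try lra; left; apply exp_pos.
Qed.

Lemma quot_rec k : c k = Cminus (quot c x th (k - 1)) (Cmult (cz x th 1) (quot c x th k)).
Proof.
  unfold quot. rewrite <- zsum_scal by (apply edom_asum, part_edom).
  rewrite (zsum_ext (fun j => if (k - 1 <? j)%Z then _ else _)
    (fun j => Cplus (if Z.eqb j k then c j else RtoC 0)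
        (Cmult (cz x th 1) (if Z.ltb k j then Cmult (c j) (cz x th (j - k - 1)) else RtoC 0)))).
  - rewrite zsum_plus, zsum_delta; [ring| |apply asum_scal, edom_asum, part_edom].
    apply edom_asum. apply (edom_at _ (Cmod (c k)) 1 k); [lra|]. intros j.
    destruct (Z.eqb_spec j k) as [->|]; [rewrite Z.sub_diag, ew_0; lra|].
    rewrite Cmod_0. apply Rmult_le_pos; [apply Cmod_ge_0|left; apply ew_pos].
  - intros j. destruct (Z.ltb_spec (k - 1) j), (Z.eqb_spec j k), (Z.ltb_spec k j); try lia.
    + subst j. replace (k - (k - 1) - 1)%Z with 0%Z by lia. rewrite cz_0. ring.
    + replace (j - (k - 1) - 1)%Z with (1 + (j - k - 1))%Z by lia. rewrite cz_add. ring.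
    + ring.
Qed.

Lemma laurent_quot x' th' : Rabs x' <= mu ->
  laurent c x' th' = Cmult (Cminus (cz x' th' 1) (cz x th 1)) (laurent (quot c x th) x' th').
Proof.
  intros Hx'. set (q := quot c x th).
  assert (Hq : edom (fun k => Cmult (q k) (cz x' th' k))).
  { apply (cz_edom q (A * qcst M mu) M mu); auto. exact quot_bound. }
  unfold laurent.
  rewrite (zsum_ext _ (fun k => Cplus (Cmult (cz x' th' 1) (Cmult (q (k + (-1))%Z) (cz x' th' (k + (-1))%Z)))
     (Cmult (Copp (cz x th 1)) (Cmult (q k) (cz x' th' k))))).
  - assert (Hs := edom_shift _ (-1) Hq). cbv beta in Hs.
    rewrite zsum_plus, !zsum_scal; auto using asum_scal, edom_asum.
    rewrite (zsum_shift (fun k => Cmult (q k) (cz x' th' k)) (-1) Hq). ring.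
  - intros k. rewrite (quot_rec k) at 1. fold q. replace k with (1 + (k + -1))%Z at 3 by lia. rewrite cz_add.
    replace (k - 1)%Z with (k + -1)%Z by lia.
    replace (cz x' th' k) with (Cmult (cz x' th' 1) (cz x' th' (k + -1))) by (rewrite <- cz_add; f_equal; lia). ring.
Qed.
End Quotient.

Lemma qcst_pos M mu : mu < M -> 0 < qcst M mu.
Proof. intros. apply Rmult_lt_0_compat; [apply exp_pos|]. pose proof (SS_ge1 (M - mu)); lra. Qed.

(* Subtracting the value at w from the constant coefficient and dividing by [w' - w] gives the Lipschitz bound. *)
Lemma laurent_lip c A M mu : mu < M -> 0 <= mu -> (forall k, Cmod (c k) <= A * ew M k) ->
  exists K, 0 <= K /\ forall x th x' th', Rabs x <= mu -> Rabs x' <= mu ->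
    Cmod (Cminus (laurent c x' th') (laurent c x th)) <= K * Cmod (Cminus (cz x' th' 1) (cz x th 1)).
Proof.
  intros Hmu Hmu0 Hc.
  assert (HA : 0 <= A) by (apply (dom_ge0 (Cmod (c 0%Z)) A (ew M 0)); [apply Cmod_ge_0|apply ew_pos|apply Hc]).
  assert (HS : 1 <= SS (M - mu)) by (apply SS_ge1; lra).
  set (A' := A + A * SS (M - mu)).
  assert (HA' : 0 <= A') by (unfold A'; nra).
  pose proof (qcst_pos M mu Hmu) as Hq.
  exists (A' * qcst M mu * SS (M - mu)). split; [apply Rmult_le_pos; [apply Rmult_le_pos|]; lra|].
  intros x th x' th' Hx Hx'.
  set (v := laurent c x th).
  set (c' := fun k => Cplus (c k) (if Z.eqb k 0 then Copp v else RtoC 0)).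
  assert (Hd : forall y t, asum (fun k => if Z.eqb k 0 then Cmult (Copp v) (cz y t k) else RtoC 0)).
  { intros y t. apply edom_asum. exists (Cmod v), 1. split; [lra|]. intros k.
    destruct (Z.eqb_spec k 0) as [->|].
    - rewrite cz_0, Cmult_1_r, Cmod_opp, ew_0; lra.
    - rewrite Cmod_0. apply Rmult_le_pos; [apply Cmod_ge_0|left; apply ew_pos]. }
  assert (HL : forall y t, Rabs y <= mu -> laurent c' y t = Cminus (laurent c y t) v).
  { intros y t Hy. unfold laurent at 1, c'.
    rewrite (zsum_ext _ (fun k => Cplus (Cmult (c k) (cz y t k)) (if Z.eqb k 0 then Cmult (Copp v) (cz y t k) else RtoC 0))).
    - rewrite zsum_plus; [|apply edom_asum; now apply (cz_edom c A M mu)|apply Hd].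
      rewrite (zsum_delta (fun k => Cmult (Copp v) (cz y t k))), cz_0. unfold laurent. ring.
    - intros k. destruct (Z.eqb k 0); ring. }
  assert (Hc' : forall k, Cmod (c' k) <= A' * ew M k).
  { intros k. unfold c'. eapply Rle_trans; [apply Cmod_triangle|]. unfold A'. rewrite Rmult_plus_distr_r.
    apply Rplus_le_compat; [apply Hc|]. destruct (Z.eqb_spec k 0) as [->|].
    - rewrite ew_0, Rmult_1_r, Cmod_opp. now apply (laurent_bound c A M mu).
    - rewrite Cmod_0. pose proof (ew_pos M k). apply Rmult_le_pos; [|lra]. nra. }
  rewrite <- (HL x' th' Hx').
  assert (Hz : laurent c' x th = RtoC 0) by (rewrite HL by assumption; unfold v; ring).
  rewrite (laurent_quot c' A' M mu x th Hmu Hx Hc' Hz x' th' Hx'), Cmod_mult, Rmult_comm.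
  apply Rmult_le_compat_r; [apply Cmod_ge_0|].
  apply (laurent_bound _ _ M mu); [assumption..|]. intros k. now apply quot_bound.
Qed.

Lemma Cmult_integral (z w : C) : Cmult z w = RtoC 0 -> z = RtoC 0 \/ w = RtoC 0.
Proof.
  intros E. destruct (Ceq_dec z (RtoC 0)) as [|Hz]; [now left|].
  destruct (Ceq_dec w (RtoC 0)) as [|Hw]; [now right|]. now elim (Cmult_neq_0 z w Hz Hw).
Qed.

(** The point is a limit of other zeros in the annulus. Distinctness is required of the points and
    not of the coordinates, because angles differing by 2 PI give the same point. *)
Definition acc_zero (c : Z -> C) (mu x th : R) : Prop :=
  forall delta, 0 < delta -> exists x' th', Rabs x' <= mu /\ cz x' th' 1 <> cz x th 1 /\
    Cmod (Cminus (cz x' th' 1) (cz x th 1)) < delta /\ laurent c x' th' = RtoC 0.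

Lemma acc_zero_zero c A M mu x th : mu < M -> Rabs x <= mu -> (forall k, Cmod (c k) <= A * ew M k) ->
  acc_zero c mu x th -> laurent c x th = RtoC 0.
Proof.
  intros Hmu Hx Hc Hacc.
  destruct (laurent_lip c A M mu Hmu) as (K & HK & HL); [pose proof (Rabs_pos x); lra|assumption|].
  destruct (Ceq_dec (laurent c x th) (RtoC 0)) as [|Hn]; [assumption|exfalso].
  apply Cmod_gt_0 in Hn.
  destruct (Hacc (Cmod (laurent c x th) / (K + 1))) as (x' & th' & Hx' & _ & Hd & E).
  { apply Rdiv_lt_0_compat; lra. }
  specialize (HL x th x' th' Hx Hx'). rewrite E in HL.
  replace (Cminus (RtoC 0) (laurent c x th)) with (Copp (laurent c x th)) in HL by ring. rewrite Cmod_opp in HL.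
  assert (K * Cmod (Cminus (cz x' th' 1) (cz x th 1)) <= K * (Cmod (laurent c x th) / (K + 1))) by (apply Rmult_le_compat_l; lra).
  assert ((K + 1) * (Cmod (laurent c x th) / (K + 1)) = Cmod (laurent c x th)) by (field; lra).
  assert (0 < Cmod (laurent c x th) / (K + 1)) by (apply Rdiv_lt_0_compat; lra).
  lra.
Qed.

(** A limit of zeros survives the division: at the other zeros the linear factor does not vanish, so
    the quotient does. Rate and annulus stay the same, only a power of [qcst] appears. *)
Lemma acc_zero_pow c A M mu x th : mu < M -> Rabs x <= mu -> (forall k, Cmod (c k) <= A * ew M k) ->
  acc_zero c mu x th -> forall m, exists cm, (forall k, Cmod (cm k) <= A * qcst M mu ^ m * ew M k) /\
    acc_zero cm mu x th /\
    forall x' th', Rabs x' <= mu -> laurent c x' th' = Cmult (Cpow (Cminus (cz x' th' 1) (cz x th 1)) m) (laurent cm x' th').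
Proof.
  intros Hmu Hx Hc Hacc m. induction m as [|m (cm & H1 & H2 & H3)].
  - exists c. split; [|split]; auto.
    + intros k. simpl. rewrite Rmult_1_r. apply Hc.
    + intros. simpl. ring.
  - pose proof (acc_zero_zero cm _ M mu x th Hmu Hx H1 H2) as Hz.
    exists (quot cm x th). split; [|split].
    + intros k. eapply Rle_trans; [apply (quot_bound cm _ M mu x th Hmu Hx H1 Hz)|]. simpl. right; ring.
    + intros d Hd. destruct (H2 d Hd) as (x' & th' & Hx' & Hne & Hd' & E).
      exists x', th'. repeat split; auto.
      rewrite (laurent_quot cm _ M mu x th Hmu Hx H1 Hz x' th' Hx') in E.
      apply Cmult_integral in E. destruct E as [E|E]; [|assumption]. exfalso; apply Hne.
      replace (cz x' th' 1) with (Cplus (Cminus (cz x' th' 1) (cz x th 1)) (cz x th 1)) by ring. rewrite E; ring.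
    + intros x' th' Hx'. rewrite (H3 x' th' Hx'), (laurent_quot cm _ M mu x th Hmu Hx H1 Hz x' th' Hx').
      simpl Cpow. ring.
Qed.

Lemma Cmod_pow z m : Cmod (Cpow z m) = Cmod z ^ m.
Proof. induction m; simpl; [apply Cmod_1|]. now rewrite Cmod_mult, IHm. Qed.

(** After m divisions the value is at most a constant times r^m, where r is [qcst] times the
    distance of the two points; let m grow. The radius 1/[qcst] is the same at every point, which
    lets zeros be propagated. *)
Lemma acc_zero_disc c A M mu x th : mu < M -> Rabs x <= mu -> (forall k, Cmod (c k) <= A * ew M k) ->
  acc_zero c mu x th -> forall x' th', Rabs x' <= mu ->
  qcst M mu * Cmod (Cminus (cz x' th' 1) (cz x th 1)) < 1 -> laurent c x' th' = RtoC 0.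
Proof.
  intros Hmu Hx Hc Hacc x' th' Hx' Hd.
  set (r := qcst M mu * Cmod (Cminus (cz x' th' 1) (cz x th 1))) in *.
  assert (Hr : 0 <= r) by (apply Rmult_le_pos; [left; now apply qcst_pos|apply Cmod_ge_0]).
  assert (HS : 1 <= SS (M - mu)) by (apply SS_ge1; lra).
  assert (HA : 0 <= A) by (apply (dom_ge0 (Cmod (c 0%Z)) A (ew M 0)); [apply Cmod_ge_0|apply ew_pos|apply Hc]).
  assert (Hm : forall m, Cmod (laurent c x' th') <= r ^ m * (A * SS (M - mu))).
  { intros m. destruct (acc_zero_pow c A M mu x th Hmu Hx Hc Hacc m) as (cm & H1 & _ & H3).
    rewrite (H3 x' th' Hx'), Cmod_mult, Cmod_pow. unfold r. rewrite Rpow_mult_distr.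
    replace (qcst M mu ^ m * Cmod (Cminus (cz x' th' 1) (cz x th 1)) ^ m * (A * SS (M - mu)))
      with (Cmod (Cminus (cz x' th' 1) (cz x th 1)) ^ m * (A * qcst M mu ^ m * SS (M - mu))) by ring.
    apply Rmult_le_compat_l; [apply pow_le, Cmod_ge_0|]. now apply (laurent_bound _ _ M mu). }
  destruct (Ceq_dec (laurent c x' th') (RtoC 0)) as [|Hn]; [assumption|exfalso].
  apply Cmod_gt_0 in Hn.
  destruct (pow_lt_1_zero r) with (y := Cmod (laurent c x' th') / (A * SS (M - mu) + 1)) as [N HN].
  - rewrite Rabs_right; lra.
  - apply Rdiv_lt_0_compat; nra.
  - specialize (HN N ltac:(lia)). rewrite Rabs_right in HN by (apply Rle_ge, pow_le; lra).
    specialize (Hm N). set (B := A * SS (M - mu)) in *. assert (0 <= B) by (unfold B; nra).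
    assert (r ^ N * (B + 1) < Cmod (laurent c x' th') / (B + 1) * (B + 1)) by (apply Rmult_lt_compat_r; lra).
    replace (Cmod (laurent c x' th') / (B + 1) * (B + 1)) with (Cmod (laurent c x' th')) in H0 by (field; lra).
    assert (0 <= r ^ N) by (apply pow_le; lra). nra.
Qed.

Lemma cos_lip a b : Rabs (cos a - cos b) <= Rabs (a - b).
Proof.
  destruct (MVT_gen cos b a (fun t => - sin t)) as (t & _ & E).
  - intros; apply is_derive_Reals, derivable_pt_lim_cos.
  - intros; apply continuity_cos.
  - rewrite E, Rabs_mult, Rabs_Ropp. pose proof (Rabs_pos (a - b)).
    assert (Rabs (sin t) <= 1) by (apply Rabs_le; apply SIN_bound). nra.
Qed.
Lemma sin_lip a b : Rabs (sin a - sin b) <= Rabs (a - b).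
Proof.
  destruct (MVT_gen sin b a cos) as (t & _ & E).
  - intros; apply is_derive_Reals, derivable_pt_lim_sin.
  - intros; apply continuity_sin.
  - rewrite E, Rabs_mult. pose proof (Rabs_pos (a - b)).
    assert (Rabs (cos t) <= 1) by (apply Rabs_le; apply COS_bound). nra.
Qed.

Lemma cz1 x th : cz x th 1 = (exp x * cos th, exp x * sin th).
Proof. unfold cz. now rewrite !Rmult_1_l. Qed.

Lemma cz_diff x th x' th' :
  Cmod (Cminus (cz x' th' 1) (cz x th 1)) <= 2 * Rabs (exp x' - exp x) + 2 * exp x * Rabs (th' - th).
Proof.
  rewrite !cz1. eapply Rle_trans; [apply Cmod_le_abs|].
  unfold Cminus, Cplus, Copp, Re, Im; simpl.
  replace (exp x' * cos th' + - (exp x * cos th)) with ((exp x' - exp x) * cos th' + exp x * (cos th' - cos th)) by ring.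
  replace (exp x' * sin th' + - (exp x * sin th)) with ((exp x' - exp x) * sin th' + exp x * (sin th' - sin th)) by ring.
  assert (G : forall u v w : R, Rabs u <= 1 -> Rabs v <= w -> Rabs ((exp x' - exp x) * u + exp x * v) <= Rabs (exp x' - exp x) + exp x * w).
  { intros u v w Hu Hv. eapply Rle_trans; [apply Rabs_triang|]. rewrite !Rabs_mult, (Rabs_right (exp x)) by (left; apply exp_pos).
    pose proof (exp_pos x). pose proof (Rabs_pos (exp x' - exp x)). nra. }
  pose proof (G (cos th') _ _ (proj2 (Rabs_le_between _ _) (COS_bound th')) (cos_lip th' th)).
  pose proof (G (sin th') _ _ (proj2 (Rabs_le_between _ _) (SIN_bound th')) (sin_lip th' th)).
  lra.
Qed.

Lemma cz_neq_mod x th x' th' : x' <> x -> cz x' th' 1 <> cz x th 1.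
Proof.
  intros Hn E. apply Hn. apply exp_inv.
  assert (E' : Cmod (cz x' th' 1) = Cmod (cz x th 1)) by now rewrite E.
  rewrite !Cmod_cz, !Rmult_1_l in E'. exact E'.
Qed.

Lemma cz_neq_arg x th d : 0 < Rabs d < PI -> cz x (th + d) 1 <> cz x th 1.
Proof.
  intros Hd E. rewrite !cz1 in E. injection E as E1 E2.
  assert (cos (th + d) = cos th) by (apply (Rmult_eq_reg_l (exp x)); [assumption|pose proof (exp_pos x); lra]).
  assert (sin (th + d) = sin th) by (apply (Rmult_eq_reg_l (exp x)); [assumption|pose proof (exp_pos x); lra]).
  assert (Hs : sin d = 0).
  { replace d with ((th + d) - th) by ring. rewrite sin_minus, H, H0. ring. }
  unfold Rabs in Hd. destruct (Rcase_abs d).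
  - pose proof (sin_gt_0 (- d)). rewrite sin_neg in H1. lra.
  - pose proof (sin_gt_0 d). lra.
Qed.

(* Vanishing propagates along the circle by steps of a fixed length. *)
Lemma acc_zero_circle c A M mu x th0 : mu < M -> Rabs x <= mu -> (forall k, Cmod (c k) <= A * ew M k) ->
  acc_zero c mu x th0 -> forall th, laurent c x th = RtoC 0.
Proof.
  intros Hmu Hx Hc Hacc.
  pose proof (qcst_pos M mu Hmu) as Hq. pose proof (exp_pos x) as He.
  (* By [cz_diff] an angle tau moves the point by at most 2 e^x tau, which is below 1/[qcst]; the
     added 1 makes this strict and keeps tau below 1, hence below PI. *)
  set (tau := / (2 * qcst M mu * exp x + 1)).
  assert (Hden : 0 < 2 * qcst M mu * exp x) by (apply Rmult_lt_0_compat; [apply Rmult_lt_0_compat|]; lra).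
  assert (Ht : 0 < tau < 1).
  { unfold tau. split; [apply Rinv_0_lt_compat; lra|]. rewrite <- Rinv_1. apply Rinv_lt_contravar; lra. }
  assert (Hstep : forall t, acc_zero c mu x t -> forall t', Rabs (t' - t) <= tau -> laurent c x t' = RtoC 0).
  { intros t Ha t' Htt. apply (acc_zero_disc c A M mu x t Hmu Hx Hc Ha x t' Hx).
    pose proof (cz_diff x t x t') as D. rewrite Rminus_diag, Rabs_R0 in D by reflexivity.
    apply Rle_lt_trans with (2 * qcst M mu * exp x * tau).
    - assert (Cmod (Cminus (cz x t' 1) (cz x t 1)) <= 2 * exp x * tau) by nra. nra.
    - apply Rlt_le_trans with ((2 * qcst M mu * exp x + 1) * tau); [lra|]. unfold tau. right; field; lra. }
  assert (Hn : forall n t, Rabs t <= INR (S n) * tau -> laurent c x (th0 + t) = RtoC 0).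
  { induction n as [|n IH]; intros t Hb.
    - apply (Hstep th0 Hacc). simpl in Hb. replace (th0 + t - th0) with t by ring. lra.
    - rewrite S_INR in Hb.
      set (b := INR (S n) * tau) in *.
      assert (Hb' : Rabs t <= b + tau) by (unfold b; lra). clear Hb; rename Hb' into Hb.
      assert (Hb0 : tau <= b).
      { unfold b. rewrite S_INR. pose proof (pos_INR n). nra. }
      (* Here t0 is the point of the known arc nearest to t, and s the direction from t0 back into
         the arc, so that t0 is a limit of known zeros. *)
      assert (exists t0 s, Rabs t0 <= b /\ Rabs (t - t0) <= tau /\ (s = 1 \/ s = -1) /\ forall e, 0 <= e <= tau -> Rabs (t0 + s * e) <= b) as (t0 & s & H1 & H2 & Hs & H3).
      { destruct (Rle_dec 0 t).
        - rewrite Rabs_right in Hb by lra. exists (Rmin t b), (-1). unfold Rmin. destruct (Rle_dec t b);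
          (split; [apply Rabs_le; lra|split; [apply Rabs_le; lra|split; [lra|intros; apply Rabs_le; lra]]]).
        - rewrite Rabs_left in Hb by lra. exists (Rmax t (- b)), 1. unfold Rmax. destruct (Rle_dec t (- b));
          (split; [apply Rabs_le; lra|split; [apply Rabs_le; lra|split; [lra|intros; apply Rabs_le; lra]]]). }
      apply (Hstep (th0 + t0)); [|replace (th0 + t - (th0 + t0)) with (t - t0) by ring; assumption].
      intros d Hd. set (e := Rmin tau (d / (4 * exp x))).
      assert (0 < d / (4 * exp x)) by (apply Rdiv_lt_0_compat; lra).
      assert (He' : 0 < e <= tau /\ e <= d / (4 * exp x)).
      { unfold e. split; [split|]; [apply Rmin_glb_lt; lra|apply Rmin_l|apply Rmin_r]. }
      assert (Hse : Rabs (s * e) = e) by (destruct Hs as [-> | ->]; [rewrite Rabs_right|rewrite Rabs_left]; lra).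
      exists x, (th0 + (t0 + s * e)). split; [assumption|]. split; [|split].
      + rewrite <- Rplus_assoc. apply cz_neq_arg. rewrite Hse. pose proof PI2_1. lra.
      + eapply Rle_lt_trans; [apply cz_diff|]. rewrite Rminus_diag, Rabs_R0 by reflexivity.
        replace (th0 + (t0 + s * e) - (th0 + t0)) with (s * e) by ring. rewrite Hse.
        assert (2 * exp x * e <= 2 * exp x * (d / (4 * exp x))) by (apply Rmult_le_compat_l; lra).
        assert (2 * exp x * (d / (4 * exp x)) = d / 2) by (field; lra). lra.
      + apply IH. fold b. apply H3; lra. }
  intros th. destruct (nfloor_ex (Rabs (th - th0) / tau)) as (n & _ & Hf).
  { apply Rmult_le_pos; [apply Rabs_pos|left; apply Rinv_0_lt_compat; lra]. }
  replace th with (th0 + (th - th0)) by ring. apply (Hn n). rewrite S_INR.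
  apply Rlt_le. apply Rle_lt_trans with (Rabs (th - th0) / tau * tau); [right; field; lra|].
  apply Rmult_lt_compat_r; lra.
Qed.

(** * Inverses for convolution *)

Definition CI (f : R -> C) : C :=
  (RInt (fun t => Re (f t)) 0 (2 * PI), RInt (fun t => Im (f t)) 0 (2 * PI)).

Definition ccont (f : R -> C) : Prop :=
  forall t : R, 0 <= t <= 2 * PI -> continuous (fun t => Re (f t)) t /\ continuous (fun t => Im (f t)) t.

Lemma two_PI_pos : 0 < 2 * PI.
Proof. pose proof PI_RGT_0; lra. Qed.

Lemma ccont_int f : ccont f ->
  ex_RInt (fun t => Re (f t)) 0 (2 * PI) /\ ex_RInt (fun t => Im (f t)) 0 (2 * PI).
Proof.
  intros H. pose proof two_PI_pos.
  split; apply (ex_RInt_continuous (V := R_CompleteNormedModule)); intros z Hz; rewrite Rmin_left, Rmax_right in Hz by lra; now apply H.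
Qed.

Lemma CI_ext f g : (forall t, 0 <= t <= 2 * PI -> f t = g t) -> CI f = CI g.
Proof.
  intros H. unfold CI. pose proof two_PI_pos.
  f_equal; apply RInt_ext; intros t Ht; rewrite Rmin_left, Rmax_right in Ht by lra; rewrite H by lra; reflexivity.
Qed.

Lemma ccont_plus f g : ccont f -> ccont g -> ccont (fun t => Cplus (f t) (g t)).
Proof.
  intros Hf Hg t Ht. destruct (Hf t Ht), (Hg t Ht). unfold Cplus, Re, Im; simpl.
  split; now apply (continuous_plus (V := R_NormedModule)).
Qed.

Lemma ccont_mult f g : ccont f -> ccont g -> ccont (fun t => Cmult (f t) (g t)).
Proof.
  intros Hf Hg t Ht. destruct (Hf t Ht), (Hg t Ht). unfold Cmult, Re, Im in *; simpl.
  split.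
  - apply (continuous_minus (V := R_NormedModule)); now apply (continuous_mult (K := R_AbsRing)).
  - apply (continuous_plus (V := R_NormedModule)); now apply (continuous_mult (K := R_AbsRing)).
Qed.

Lemma ccont_const z : ccont (fun _ => z).
Proof. intros t _. split; apply continuous_const. Qed.

Lemma ccont_inv f : ccont f -> (forall t, 0 <= t <= 2 * PI -> f t <> RtoC 0) -> ccont (fun t => Cinv (f t)).
Proof.
  intros Hf H0 t Ht. destruct (Hf t Ht) as [H1 H2]. unfold Cinv, Re, Im in *; simpl.
  assert (Hn : fst (f t) * (fst (f t) * 1) + snd (f t) * (snd (f t) * 1) <> 0).
  { intros E. apply (H0 t Ht). destruct (f t) as [u v]; simpl in *. unfold RtoC. f_equal; nra. }
  assert (Hc : continuous (fun t => / (fst (f t) * (fst (f t) * 1) + snd (f t) * (snd (f t) * 1))) t).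
  { apply (continuous_Rinv_comp (fun t => fst (f t) * (fst (f t) * 1) + snd (f t) * (snd (f t) * 1))); [|exact Hn].
    apply (continuous_plus (V := R_NormedModule)); apply (continuous_mult (K := R_AbsRing)); try assumption; apply (continuous_mult (K := R_AbsRing)); try assumption; apply continuous_const. }
  split; apply (continuous_mult (K := R_AbsRing)); try assumption. apply (continuous_opp (V := R_NormedModule)); assumption.
Qed.

Lemma CI_plus f g : ccont f -> ccont g -> CI (fun t => Cplus (f t) (g t)) = Cplus (CI f) (CI g).
Proof.
  intros Hf Hg. destruct (ccont_int f Hf), (ccont_int g Hg). unfold CI, Cplus, Re, Im in *; simpl.
  f_equal; now apply (RInt_plus (V := R_CompleteNormedModule)).
Qed.

Lemma CI_scal z f : ccont f -> CI (fun t => Cmult z (f t)) = Cmult z (CI f).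
Proof.
  intros Hf. destruct (ccont_int f Hf) as [H1 H2]. destruct z as [u v].
  unfold CI, Cmult, Re, Im in *; simpl.
  assert (E : forall w (g : R -> R), ex_RInt g 0 (2 * PI) ->
    ex_RInt (fun t => w * g t) 0 (2 * PI) /\ RInt (fun t => w * g t) 0 (2 * PI) = w * RInt g 0 (2 * PI)).
  { intros w g Hg. split; [exact (ex_RInt_scal (V := R_NormedModule) g 0 (2 * PI) w Hg)|].
    exact (RInt_scal (V := R_CompleteNormedModule) g 0 (2 * PI) w Hg). }
  destruct (E u _ H1) as [A1 B1]. destruct (E v _ H1) as [A2 B2].
  destruct (E u _ H2) as [A3 B3]. destruct (E v _ H2) as [A4 B4].
  rewrite <- B1, <- B2, <- B3, <- B4. f_equal.
  - exact (RInt_minus (V := R_CompleteNormedModule) _ _ 0 (2 * PI) A1 A4).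
  - exact (RInt_plus (V := R_CompleteNormedModule) _ _ 0 (2 * PI) A3 A2).
Qed.

(** The constant is twice the length 2 PI because real and imaginary parts are estimated
    separately. *)
Lemma CI_bound f B : ccont f -> (forall t, 0 <= t <= 2 * PI -> Cmod (f t) <= B) -> Cmod (CI f) <= 4 * PI * B.
Proof.
  intros Hf HB. pose proof two_PI_pos. destruct (ccont_int f Hf) as [H1 H2].
  eapply Rle_trans; [apply Cmod_le_abs|]. unfold CI at 1 2, Re at 1, Im at 2; simpl.
  assert (Rabs (RInt (fun t => Re (f t)) 0 (2 * PI)) <= (2 * PI - 0) * B).
  { apply abs_RInt_le_const; [lra|assumption|]. intros t Ht. eapply Rle_trans; [apply Re_le_Cmod|now apply HB]. }
  assert (Rabs (RInt (fun t => Im (f t)) 0 (2 * PI)) <= (2 * PI - 0) * B).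
  { apply abs_RInt_le_const; [lra|assumption|]. intros t Ht. eapply Rle_trans; [apply Im_le_Cmod|now apply HB]. }
  lra.
Qed.

Lemma ccont_cz k : ccont (fun t => cz 0 t k).
Proof.
  intros t _. unfold cz, Re, Im; simpl.
  split; apply (ex_derive_continuous (K := R_AbsRing) (V := R_NormedModule)); auto_derive; trivial.
Qed.

Lemma CI_cz k : CI (fun t => cz 0 t k) = if Z.eqb k 0 then RtoC (2 * PI) else RtoC 0.
Proof.
  unfold CI, cz, Re, Im; simpl. destruct (Z.eqb_spec k 0) as [->|Hk].
  - unfold RtoC. f_equal.
    + rewrite (RInt_ext _ (fun _ => 1)).
      * rewrite RInt_const. change ((2 * PI - 0) * 1 = 2 * PI). ring.
      * intros t _. rewrite !Rmult_0_l, exp_0, cos_0. exact (Rmult_1_r 1).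
    + rewrite (RInt_ext _ (fun _ => 0)).
      * rewrite RInt_const. change ((2 * PI - 0) * 0 = 0). ring.
      * intros t _. rewrite !Rmult_0_l, exp_0, sin_0. exact (Rmult_0_r 1).
  - assert (Hk' : IZR k <> 0) by (now apply not_0_IZR).
    assert (Hs : sin (IZR k * PI) = 0) by (apply sin_eq_0_1; now exists k).
    unfold RtoC. f_equal.
    + rewrite (is_RInt_unique (V := R_CompleteNormedModule) _ 0 (2 * PI) (minus (sin (IZR k * (2 * PI)) / IZR k) (sin (IZR k * 0) / IZR k))).
      * replace (IZR k * (2 * PI)) with (2 * (IZR k * PI)) by ring.
        rewrite sin_2a, Hs, !Rmult_0_r, sin_0. unfold minus, plus, opp; simpl. field; assumption.
      * apply (is_RInt_derive (fun t => sin (IZR k * t) / IZR k)).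
        -- intros t _. auto_derive; trivial. rewrite Rmult_0_r, exp_0. field; assumption.
        -- intros t _. apply (ex_derive_continuous (K := R_AbsRing) (V := R_NormedModule)); auto_derive; trivial.
    + rewrite (is_RInt_unique (V := R_CompleteNormedModule) _ 0 (2 * PI) (minus (- cos (IZR k * (2 * PI)) / IZR k) (- cos (IZR k * 0) / IZR k))).
      * replace (IZR k * (2 * PI)) with (2 * (IZR k * PI)) by ring.
        rewrite cos_2a_sin, Hs, !Rmult_0_r, cos_0. unfold minus, plus, opp; simpl. field; assumption.
      * apply (is_RInt_derive (fun t => - cos (IZR k * t) / IZR k)).
        -- intros t _. auto_derive; trivial. rewrite Rmult_0_r, exp_0. field; assumption.
        -- intros t _. apply (ex_derive_continuous (K := R_AbsRing) (V := R_NormedModule)); auto_derive; trivial.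
Qed.

Lemma CI_csum {A} (F : A -> R -> C) l : (forall x, ccont (F x)) ->
  ccont (fun t => csum (map (fun x => F x t) l)) /\
  CI (fun t => csum (map (fun x => F x t) l)) = csum (map (fun x => CI (F x)) l).
Proof.
  intros H. induction l as [|x l [IH1 IH2]]; simpl map.
  - split; [apply (ccont_const (RtoC 0))|].
    rewrite (CI_ext _ (fun t => Cmult (RtoC 0) (cz 0 t 0))) by (intros; unfold csum; simpl; ring).
    rewrite CI_scal by apply ccont_cz. unfold csum; simpl; ring.
  - split.
    + apply (ccont_plus (F x) (fun t => csum (map (fun x => F x t) l))); auto.
    + rewrite csum_cons, <- IH2, <- CI_plus; auto.
Qed.

Lemma ccont_laurent b A nu : 0 < nu -> (forall k, Cmod (b k) <= A * ew nu k) -> ccont (laurent b 0).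
Proof.
  intros Hn Hb. destruct (laurent_lip b A nu 0 Hn (Rle_refl 0) Hb) as (K & HK & HL).
  assert (G : forall p : C -> R, (forall z, Rabs (p z) <= Cmod z) -> (forall x y, p (Cminus x y) = p x - p y) ->
     forall t, continuous (fun t => p (laurent b 0 t)) t).
  { intros p H1 H2 t. apply filterlim_locally. intros eps.
    assert (Hd : 0 < eps / (2 * K + 1)) by (apply Rdiv_lt_0_compat; [apply cond_pos|lra]).
    exists (mkposreal _ Hd). intros y Hy. unfold ball in *; simpl in *; unfold AbsRing_ball, abs, minus, plus, opp in *; simpl in *.
    change (Rabs (p (laurent b 0 y) - p (laurent b 0 t)) < eps). rewrite <- H2.
    eapply Rle_lt_trans; [apply H1|].
    eapply Rle_lt_trans; [apply HL; rewrite Rabs_R0; lra|].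
    pose proof (cz_diff 0 t 0 y) as D. rewrite Rminus_diag, Rabs_R0, exp_0 in D.
    change (Rabs (y - t) < eps / (2 * K + 1)) in Hy.
    apply Rle_lt_trans with (2 * K * Rabs (y - t)).
    - apply Rle_trans with (K * (2 * Rabs (y - t))); [apply Rmult_le_compat_l; lra|right; ring].
    - apply Rle_lt_trans with ((2 * K + 1) * Rabs (y - t)); [pose proof (Rabs_pos (y - t)); lra|].
      apply Rlt_le_trans with ((2 * K + 1) * (eps / (2 * K + 1))); [apply Rmult_lt_compat_l; lra|].
      right; field; lra. }
  intros t _. split; apply G.
  - apply Re_le_Cmod.
  - intros [] []; unfold Cminus, Cplus, Copp, Re; simpl; ring.
  - apply Im_le_Cmod.
  - intros [] []; unfold Cminus, Cplus, Copp, Im; simpl; ring.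
Qed.

(** Term-by-term integration: on the unit circle the partial sums converge uniformly in the angle,
    with the tail of the weight [ew nu] as error. *)
Lemma CI_laurent b A nu X B : 0 < nu -> (forall k, Cmod (b k) <= A * ew nu k) -> ccont X ->
  (forall t, 0 <= t <= 2 * PI -> Cmod (X t) <= B) ->
  zsum (fun k => Cmult (b k) (CI (fun t => Cmult (cz 0 t k) (X t)))) = CI (fun t => Cmult (laurent b 0 t) (X t)).
Proof.
  intros Hn Hb HX HB. pose proof two_PI_pos as Hpi.
  assert (HB0 : 0 <= B) by (eapply Rle_trans; [apply Cmod_ge_0|apply (HB 0); lra]).
  assert (HA : 0 <= A) by (apply (dom_ge0 (Cmod (b 0%Z)) A (ew nu 0)); [apply Cmod_ge_0|apply ew_pos|apply Hb]).
  assert (Hcz : forall t k, Cmod (cz 0 t k) = 1) by (intros; rewrite Cmod_cz, Rmult_0_r; apply exp_0).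
  assert (HcX : forall k, ccont (fun t => Cmult (cz 0 t k) (X t))) by (intros; apply ccont_mult; auto using ccont_cz).
  assert (Hedom : edom b) by (exists A, nu; auto).
  apply zsum_unique.
  2:{ apply edom_asum. apply (edom_bmul b _ (4 * PI * B) Hedom). intros k. apply CI_bound; [apply HcX|].
      intros t Ht. rewrite Cmod_mult, Hcz. specialize (HB t Ht). lra. }
  intros eps He. pose proof (rtot_lim _ (ew_asum nu Hn)) as HL. apply is_lim_seq_spec in HL.
  set (Q := A * (4 * PI * B)). assert (HQ : 0 <= Q) by (unfold Q; pose proof PI_RGT_0; apply Rmult_le_pos; [lra|]; apply Rmult_le_pos; lra).
  assert (Hd : 0 < eps / (Q + 1)) by (apply Rdiv_lt_0_compat; lra).
  destruct (HL (mkposreal _ Hd)) as [N0 HN0]. simpl in HN0.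
  exists N0. intros N HN. specialize (HN0 N HN).
  set (r := rtot (fun k => RtoC (ew nu k)) - rpart (fun k => RtoC (ew nu k)) N).
  assert (Hr : 0 <= r) by (unfold r; pose proof (rpart_le_rtot _ N (ew_asum nu Hn)); lra).
  assert (Hr' : r < eps / (Q + 1)) by (unfold r in *; rewrite Rabs_left1 in HN0 by lra; lra).
  assert (E : zpartial (fun k => Cmult (b k) (CI (fun t => Cmult (cz 0 t k) (X t)))) N =
     CI (fun t => Cmult (zpartial (fun k => Cmult (b k) (cz 0 t k)) N) (X t)) /\
     ccont (fun t => Cmult (zpartial (fun k => Cmult (b k) (cz 0 t k)) N) (X t))).
  { unfold zpartial.
    set (kk := fun k : nat => (Z.of_nat k - Z.of_nat N)%Z).
    destruct (CI_csum (fun k t => Cmult (b (kk k)) (Cmult (cz 0 t (kk k)) (X t))) (seq 0 (2 * N + 1))) as [E1 E2].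
    { intros k. apply ccont_mult; [apply ccont_const|apply HcX]. }
    assert (E3 : forall t, Cmult (csum (map (fun k => Cmult (b (kk k)) (cz 0 t (kk k))) (seq 0 (2 * N + 1)))) (X t)
       = csum (map (fun k => Cmult (b (kk k)) (Cmult (cz 0 t (kk k)) (X t))) (seq 0 (2 * N + 1)))).
    { intros t. rewrite Cmult_comm, <- csum_scal. apply csum_ext. intros; ring. }
    split.
    - symmetry. etransitivity; [exact (CI_ext _ _ (fun t _ => E3 t))|]. rewrite E2.
      apply csum_ext. intros k _. unfold kk. rewrite CI_scal; auto.
    - intros t Ht. destruct (E1 t Ht) as [F1 F2]. split.
      + refine (continuous_ext _ _ _ _ F1). intros s; simpl. now rewrite <- E3.
      + refine (continuous_ext _ _ _ _ F2). intros s; simpl. now rewrite <- E3. }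
  destruct E as [E1 E2]. rewrite E1.
  assert (HLX : ccont (fun t => Cmult (laurent b 0 t) (X t))).
  { apply ccont_mult; [now apply (ccont_laurent b A nu)|assumption]. }
  replace (Cminus (CI (fun t => Cmult (zpartial (fun k => Cmult (b k) (cz 0 t k)) N) (X t))) (CI (fun t => Cmult (laurent b 0 t) (X t))))
    with (CI (fun t => Cplus (Cmult (zpartial (fun k => Cmult (b k) (cz 0 t k)) N) (X t)) (Cmult (Copp (RtoC 1)) (Cmult (laurent b 0 t) (X t))))).
  2:{ rewrite CI_plus, CI_scal; auto; [ring|]. apply ccont_mult; auto using ccont_const. }
  apply Rle_lt_trans with (4 * PI * (A * r * B)).
  - apply CI_bound.
    + apply ccont_plus; [assumption|apply ccont_mult; auto using ccont_const].
    + intros t Ht.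
      replace (Cplus _ _) with (Cmult (Copp (Cminus (laurent b 0 t) (zpartial (fun k => Cmult (b k) (cz 0 t k)) N))) (X t)) by ring.
      rewrite Cmod_mult, Cmod_opp. apply Rmult_le_compat; try apply Cmod_ge_0; [|now apply HB].
      unfold laurent, r. apply zsum_tail; [assumption| |now apply ew_asum].
      intros k. rewrite Cmod_mult, Hcz, Cmod_ew, Rmult_1_r. apply Hb.
  - replace (4 * PI * (A * r * B)) with (Q * r) by (unfold Q; ring).
    apply Rle_lt_trans with ((Q + 1) * r); [lra|].
    apply Rlt_le_trans with ((Q + 1) * (eps / (Q + 1))); [apply Rmult_lt_compat_l; lra|right; field; lra].
Qed.

(** Uniqueness of Fourier coefficients: integration against e^(-i k t) isolates the k-th one. *)
Lemma laurent_coef_0 b A nu : 0 < nu -> (forall k, Cmod (b k) <= A * ew nu k) ->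
  (forall t, laurent b 0 t = RtoC 0) -> forall k, b k = RtoC 0.
Proof.
  intros Hn Hb H0 k. pose proof two_PI_pos as Hpi.
  pose proof (CI_laurent b A nu (fun t => cz 0 t (- k)) 1 Hn Hb (ccont_cz (- k))) as E.
  rewrite (CI_ext (fun t => Cmult (laurent b 0 t) _) (fun t => Cmult (RtoC 0) (cz 0 t 0))), CI_scal in E by
    (apply ccont_cz || (intros t _; rewrite H0; ring)).
  rewrite (zsum_ext _ (fun j => if Z.eqb j k then Cmult (b j) (RtoC (2 * PI)) else RtoC 0)) in E.
  - rewrite (zsum_delta (fun j => Cmult (b j) (RtoC (2 * PI)))) in E.
    assert (E' : Cmult (b k) (RtoC (2 * PI)) = RtoC 0).
    { rewrite E; [ring|]. intros t _. rewrite Cmod_cz, Rmult_0_r, exp_0; lra. }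
    apply Cmult_integral in E'. destruct E' as [|E']; [assumption|]. injection E'; lra.
  - intros j. rewrite (CI_ext _ (fun t => cz 0 t (j - k))) by (intros; symmetry; apply (cz_add 0 t j (- k))).
    rewrite CI_cz. destruct (Z.eqb_spec (j - k) 0), (Z.eqb_spec j k); try lia; [reflexivity|ring].
Qed.

(** Rescaling carries the circle of radius e^x to the unit circle, at the cost of |x| in the rate of
    decay. *)
Definition tilt (c : Z -> C) (x : R) (k : Z) : C := Cmult (c k) (RtoC (exp (IZR k * x))).

Lemma tilt_bound c A M mu x k : Rabs x <= mu -> Cmod (c k) <= A * ew M k -> Cmod (tilt c x k) <= A * ew (M - mu) k.
Proof.
  intros Hx H. pose proof (cz_dom c A M mu x 0 k Hx H) as T. unfold tilt. rewrite Cmod_mult in *.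
  rewrite Cmod_cz in T. rewrite Cmod_R, Rabs_right; [exact T|left; apply exp_pos].
Qed.

Lemma laurent_tilt c x th : laurent c x th = laurent (tilt c x) 0 th.
Proof.
  apply zsum_ext. intros k. unfold tilt, cz. rewrite <- Cmult_assoc. f_equal.
  unfold Cmult, RtoC; simpl. rewrite Rmult_0_r, exp_0. f_equal; ring.
Qed.

(** If every circle in the range carried a zero, a sequence of them would accumulate by compactness
    of the angles; then the series vanishes on the whole limit circle, and Fourier uniqueness makes
    all coefficients 0. *)
Lemma zero_free_circle c A M eps : 0 < M -> (forall k, Cmod (c k) <= A * ew M k) -> (exists k, c k <> RtoC 0) ->
  0 < eps < M -> exists x, 0 < x < eps /\ forall th, 0 <= th <= 2 * PI -> laurent c x th <> RtoC 0.
Proof.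
  intros HM Hc [k0 Hk0] He. apply NNPP. intros Hn. apply Hk0.
  assert (Hbad : forall x, 0 < x < eps -> exists th, 0 <= th <= 2 * PI /\ laurent c x th = RtoC 0).
  { intros x Hx. apply NNPP. intros Hm. apply Hn. exists x. split; [assumption|]. intros th Hth E. apply Hm. now exists th. }
  (* The radii stay strictly above that of the limit circle, so the zeros differ from their limit
     already in modulus. *)
  set (xs := fun n : nat => eps / 2 + eps / 4 * / (INR n + 1)).
  assert (Hinv : forall n, 0 < / (INR n + 1) <= 1).
  { intros n. pose proof (pos_INR n). split; [apply Rinv_0_lt_compat; lra|]. rewrite <- Rinv_1 at 2. apply Rinv_le_contravar; lra. }
  assert (Hxs : forall n, eps / 2 < xs n < eps).
  { intros n. unfold xs. specialize (Hinv n). split; nra. }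
  assert (Hth : forall n, exists th, 0 <= th <= 2 * PI /\ laurent c (xs n) th = RtoC 0).
  { intros n. apply Hbad. specialize (Hxs n). lra. }
  set (ths := fun n => proj1_sig (constructive_indefinite_description _ (Hth n))).
  assert (Hths : forall n, 0 <= ths n <= 2 * PI /\ laurent c (xs n) (ths n) = RtoC 0).
  { intros n. exact (proj2_sig (constructive_indefinite_description _ (Hth n))). }
  destruct (Bolzano_Weierstrass ths (fun t => 0 <= t <= 2 * PI) (compact_P3 _ _) (fun n => proj1 (Hths n))) as [t0 Ht0].
  assert (Hx0 : Rabs (eps / 2) <= eps) by (rewrite Rabs_right; lra).
  assert (Hacc : acc_zero c eps (eps / 2) t0).
  { intros d Hd.
    assert (Hce : continuity_pt exp (eps / 2)) by (apply derivable_continuous_pt, derivable_pt_exp).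
    destruct (Hce (d / 8)) as (al & Hal & Hexp); [lra|]. simpl in Hexp. unfold R_dist in Hexp.
    destruct (archimed_cor1 (al / eps)) as (N & HN & HN0); [apply Rdiv_lt_0_compat; lra|].
    pose proof (exp_pos (eps / 2)) as Hep.
    assert (Hd2 : 0 < d / (8 * exp (eps / 2))) by (apply Rdiv_lt_0_compat; lra).
    destruct (Ht0 (disc t0 (mkposreal _ Hd2)) N) as (p & Hp & Hdisc).
    { exists (mkposreal _ Hd2). now intros. }
    unfold disc in Hdisc; simpl in Hdisc.
    exists (xs p), (ths p). pose proof (Hxs p) as Hxp. split; [rewrite Rabs_right; lra|].
    split; [apply cz_neq_mod; lra|]. split; [|apply Hths].
    eapply Rle_lt_trans; [apply cz_diff|].
    assert (Rabs (exp (xs p) - exp (eps / 2)) < d / 8).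
    { apply Hexp. split; [split; [exact I|lra]|]. rewrite Rabs_right by lra.
      unfold xs. assert (/ (INR p + 1) <= / INR N).
      { apply Rinv_le_contravar; [apply lt_0_INR; lia|]. apply le_INR in Hp. lra. }
      assert (eps * / INR N < eps * (al / eps)) by (apply Rmult_lt_compat_l; lra).
      replace (eps * (al / eps)) with al in H0 by (field; lra).
      specialize (Hinv p). nra. }
    assert (exp (eps / 2) * Rabs (ths p - t0) <= d / 8).
    { apply Rle_trans with (exp (eps / 2) * (d / (8 * exp (eps / 2)))); [apply Rmult_le_compat_l; lra|right; field; lra]. }
    lra. }
  pose proof (acc_zero_circle c A M eps (eps / 2) t0 ltac:(lra) Hx0 Hc Hacc) as Hall.
  assert (Ht : tilt c (eps / 2) k0 = RtoC 0).
  { apply (laurent_coef_0 _ A (M - eps)); [lra| |].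
    - intros k. now apply tilt_bound.
    - intros t. rewrite <- laurent_tilt. apply Hall. }
  unfold tilt in Ht. apply Cmult_integral in Ht. destruct Ht as [|E]; [assumption|].
  injection E. pose proof (exp_pos (IZR k0 * (eps / 2))). lra.
Qed.

(** The sequence d consists of the Laurent coefficients of 1/c on one zero-free circle of radius
    e^x. Boundedness of 1/c on this circle alone gives the one-sided estimate: decay to the right,
    growth at rate at most x to the left. *)
Lemma convolution_inverse c A M eps : 0 < M -> (forall k, Cmod (c k) <= A * ew M k) -> (exists k, c k <> RtoC 0) ->
  0 < eps -> exists x d B, 0 < x < eps /\ (forall k, Cmod (d k) <= B * exp (- x * IZR k)) /\
    forall k, zsum (fun j => Cmult (c j) (d (k - j)%Z)) = if Z.eqb k 0 then RtoC 1 else RtoC 0.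
Proof.
  intros HM Hc Hnz He. pose proof two_PI_pos as Hpi.
  (* The minimum with M/2 keeps the circle inside the annulus of convergence. *)
  assert (He' : 0 < Rmin eps (M / 2) < M).
  { split; [apply Rmin_glb_lt; lra|]. eapply Rle_lt_trans; [apply Rmin_r|lra]. }
  destruct (zero_free_circle c A M _ HM Hc Hnz He') as (x & Hx & Hfree).
  assert (Hxe : x < eps) by (pose proof (Rmin_l eps (M / 2)); lra).
  assert (HxM : x < M) by lra.
  set (b := tilt c x).
  assert (Hb : forall k, Cmod (b k) <= A * ew (M - x) k).
  { intros k. apply tilt_bound; [rewrite Rabs_right; lra|apply Hc]. }
  assert (Hn : 0 < M - x) by lra.
  pose proof (ccont_laurent b A (M - x) Hn Hb) as HG.
  assert (HG0 : forall t, 0 <= t <= 2 * PI -> laurent b 0 t <> RtoC 0).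
  { intros t Ht. unfold b. rewrite <- laurent_tilt. now apply Hfree. }
  set (Y := fun t => Cinv (laurent b 0 t)).
  assert (HY : ccont Y) by (now apply ccont_inv).
  assert (HYB : exists B, forall t, 0 <= t <= 2 * PI -> Cmod (Y t) <= B).
  { destruct (continuity_ab_maj (fun t => Rabs (Re (Y t))) 0 (2 * PI)) as (m1 & Hm1 & _); [lra| |].
    { intros t Ht. apply continuity_pt_filterlim. apply continuous_Rabs_comp. now apply HY. }
    destruct (continuity_ab_maj (fun t => Rabs (Im (Y t))) 0 (2 * PI)) as (m2 & Hm2 & _); [lra| |].
    { intros t Ht. apply continuity_pt_filterlim. apply continuous_Rabs_comp. now apply HY. }
    exists (Rabs (Re (Y m1)) + Rabs (Im (Y m2))). intros t Ht. eapply Rle_trans; [apply Cmod_le_abs|].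
    specialize (Hm1 t Ht). specialize (Hm2 t Ht). simpl in *. lra. }
  destruct HYB as [B HB].
  (* Up to 2 PI, the Fourier coefficients of the reciprocal on the rescaled circle; the factor e^(-x
     k) in the witness undoes the rescaling. *)
  set (e := fun k => CI (fun t => Cmult (cz 0 t (- k)) (Y t))).
  assert (Hcz : forall t k, Cmod (cz 0 t k) = 1) by (intros; rewrite Cmod_cz, Rmult_0_r; apply exp_0).
  assert (HcY : forall k, ccont (fun t => Cmult (cz 0 t k) (Y t))) by (intros; apply ccont_mult; auto using ccont_cz).
  assert (HcYB : forall k t, 0 <= t <= 2 * PI -> Cmod (Cmult (cz 0 t k) (Y t)) <= B).
  { intros k t Ht. rewrite Cmod_mult, Hcz, Rmult_1_l. now apply HB. }
  exists x, (fun k => Cmult (RtoC (/ (2 * PI) * exp (- x * IZR k))) (e k)), (/ (2 * PI) * (4 * PI * B)).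
  split; [lra|]. split.
  - intros k. assert (0 < / (2 * PI)) by (apply Rinv_0_lt_compat; lra).
    pose proof (exp_pos (- x * IZR k)).
    rewrite Cmod_mult, Cmod_R, Rabs_right by (apply Rle_ge, Rmult_le_pos; lra).
    assert (Cmod (e k) <= 4 * PI * B) by (apply CI_bound; auto).
    replace (/ (2 * PI) * (4 * PI * B) * exp (- x * IZR k)) with (/ (2 * PI) * exp (- x * IZR k) * (4 * PI * B)) by ring.
    apply Rmult_le_compat_l; [apply Rmult_le_pos; lra|assumption].
  - intros k.
    rewrite (zsum_ext _ (fun j => Cmult (RtoC (/ (2 * PI) * exp (- x * IZR k)))
       (Cmult (b j) (CI (fun t => Cmult (cz 0 t j) (Cmult (cz 0 t (- k)) (Y t))))))).
    + rewrite zsum_scal.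
      * rewrite (CI_laurent b A (M - x) (fun t => Cmult (cz 0 t (- k)) (Y t)) B); auto.
        rewrite (CI_ext _ (fun t => cz 0 t (- k))).
        -- rewrite CI_cz. destruct (Z.eqb_spec (- k) 0), (Z.eqb_spec k 0); try lia; [|ring].
           subst k. rewrite Rmult_0_r, exp_0. rewrite <- RtoC_mult. f_equal. field. lra.
        -- intros t Ht. unfold Y. field. now apply HG0.
      * apply edom_asum. apply (edom_bmul b _ (4 * PI * B)); [exists A, (M - x); auto|].
        intros j. apply CI_bound; [apply ccont_mult; auto using ccont_cz|].
        intros t Ht. rewrite Cmod_mult, Hcz, Rmult_1_l. now apply HcYB.
    + intros j. unfold e, b, tilt.
      rewrite (CI_ext (fun t => Cmult (cz 0 t (- (k - j))) (Y t)) (fun t => Cmult (cz 0 t j) (Cmult (cz 0 t (- k)) (Y t)))).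
      * replace (exp (- x * IZR (k - j))) with (exp (- x * IZR k) * exp (IZR j * x)).
        -- rewrite !RtoC_mult. ring.
        -- rewrite <- exp_plus, minus_IZR. f_equal; ring.
      * intros t _. replace (- (k - j))%Z with (j + - k)%Z by lia. rewrite cz_add. ring.
Qed.

(** * Graded symmetrization of functions on words *)

Definition sgn (b : bool) : C := if b then RtoC (-1) else RtoC 1.
(** The sign acquired by an odd operator when it passes the letter u. *)
Definition eps (u : lvar) : C := sgn (odd_var u).
Definition swap_sign (u v : lvar) : C := sgn (odd_var u && odd_var v).

Lemma sgn_m1 : RtoC (-1) = Copp (RtoC 1).
Proof. unfold RtoC, Copp; simpl. f_equal; ring. Qed.

Lemma swap_sign_sym u v : swap_sign u v = swap_sign v u.
Proof. unfold swap_sign. now rewrite andb_comm. Qed.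
Lemma swap_sign_sq u v : Cmult (swap_sign u v) (swap_sign u v) = RtoC 1.
Proof. unfold swap_sign, sgn. destruct (_ && _); rewrite ?sgn_m1; ring. Qed.
Lemma eps_sq u : Cmult (eps u) (eps u) = RtoC 1.
Proof. unfold eps, sgn. destruct (odd_var u); rewrite ?sgn_m1; ring. Qed.
(** An odd derivation reverses the parity of the letter it replaces; the exchange sign with v then
    changes by exactly the sign of passing an odd operator over v. All sign bookkeeping rests on
    this. *)
Lemma swap_sign_flip u v t : odd_var t = negb (odd_var u) ->
  swap_sign v t = Cmult (swap_sign v u) (eps v).
Proof. intros E. unfold swap_sign, eps, sgn. rewrite E. destruct (odd_var u), (odd_var v); simpl; rewrite ?sgn_m1; ring. Qed.
Lemma Cmod_sgn b : Cmod (sgn b) = 1.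
Proof. destruct b; simpl; rewrite Cmod_R; [rewrite Rabs_left|rewrite Rabs_right]; lra. Qed.

(* [tr u F] evaluates F with u put back behind the first letter. *)
Definition tr (u : lvar) (F : list lvar -> C) (w : list lvar) : C :=
  match w with v :: w' => Cmult (swap_sign v u) (F (v :: u :: w')) | [] => RtoC 0 end.

(* Sum over the letters of w of F evaluated after moving that letter to the front. *)
Fixpoint msum (w : list lvar) (F : list lvar -> C) : C :=
  match w with [] => RtoC 0 | u :: w' => Cplus (F (u :: w')) (msum w' (tr u F)) end.

Lemma msum_ext w F G : (forall v w', Permutation w (v :: w') -> F (v :: w') = G (v :: w')) -> msum w F = msum w G.
Proof.
  revert F G. induction w as [|u w IH]; intros F G H; [reflexivity|]. simpl. rewrite (H u w) by reflexivity. f_equal.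
  apply IH. intros v w' Hp. simpl. rewrite H; [reflexivity|]. rewrite Hp. apply perm_swap.
Qed.

Lemma msum_plus w F G : msum w (fun x => Cplus (F x) (G x)) = Cplus (msum w F) (msum w G).
Proof.
  revert F G. induction w as [|u w IH]; intros F G; [simpl; ring|]. simpl.
  rewrite (msum_ext w _ (fun x => Cplus (tr u F x) (tr u G x))).
  - rewrite IH. ring.
  - intros v w' _. simpl. ring.
Qed.

Lemma msum_scal w c F : msum w (fun x => Cmult c (F x)) = Cmult c (msum w F).
Proof.
  revert F. induction w as [|u w IH]; intros F; [simpl; ring|]. simpl.
  rewrite (msum_ext w _ (fun x => Cmult c (tr u F x))).
  - rewrite IH. ring.
  - intros v w' _. simpl. ring.
Qed.

Lemma msum_0 w : msum w (fun _ => RtoC 0) = RtoC 0.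
Proof.
  rewrite (msum_ext w _ (fun x => Cmult (RtoC 0) (RtoC 0))) by (intros; ring).
  rewrite (msum_scal w (RtoC 0) (fun _ => RtoC 0)). ring.
Qed.

Lemma msum_csum {A} w (F : A -> list lvar -> C) l :
  msum w (fun x => csum (map (fun a => F a x) l)) = csum (map (fun a => msum w (F a)) l).
Proof.
  induction l as [|a l IH]; simpl map.
  - apply msum_0.
  - rewrite csum_cons, <- IH, <- msum_plus. reflexivity.
Qed.

Lemma msum_bound w F B : (forall w', Permutation w w' -> Cmod (F w') <= B) -> Cmod (msum w F) <= INR (length w) * B.
Proof.
  revert F. induction w as [|u w IH]; intros F H; [simpl; rewrite Cmod_0; lra|].
  simpl msum. simpl length. rewrite S_INR. eapply Rle_trans; [apply Cmod_triangle|].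
  assert (Cmod (F (u :: w)) <= B) by (apply H; reflexivity).
  assert (Cmod (msum w (tr u F)) <= INR (length w) * B); [|lra].
  apply IH. intros [|v w'] Hp; simpl.
  - rewrite Cmod_0. eapply Rle_trans; [apply Cmod_ge_0|exact H0].
  - unfold swap_sign. rewrite Cmod_mult, Cmod_sgn, Rmult_1_l. apply H. rewrite Hp. apply perm_swap.
Qed.

Definition lift (S : (list lvar -> C) -> list lvar -> C) (F : list lvar -> C) (w : list lvar) : C :=
  match w with v :: w' => S (fun x => F (v :: x)) w' | [] => RtoC 0 end.

(* Sum over all permutations of the n letters of w, with Koszul signs. *)
Fixpoint gsum (n : nat) (F : list lvar -> C) (w : list lvar) : C :=
  match n with
  | O => match w with [] => F [] | _ => RtoC 0 end
  | S m => msum w (lift (gsum m) F)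
  end.

Lemma gsum_ext n F G w : (forall w', Permutation w w' -> F w' = G w') -> gsum n F w = gsum n G w.
Proof.
  revert F G w. induction n as [|n IH]; intros F G w H; simpl.
  - destruct w; [now apply H|reflexivity].
  - apply msum_ext. intros v w' Hp. simpl. apply IH. intros w'' Hp'. apply H. rewrite Hp. now constructor.
Qed.

Lemma gsum_plus n F G w : gsum n (fun x => Cplus (F x) (G x)) w = Cplus (gsum n F w) (gsum n G w).
Proof.
  revert F G w. induction n as [|n IH]; intros F G w; simpl.
  - destruct w; [reflexivity|ring].
  - rewrite <- msum_plus. apply msum_ext. intros v w' _. simpl. apply (IH (fun x => F (v :: x)) (fun x => G (v :: x))).
Qed.

Lemma gsum_scal n c F w : gsum n (fun x => Cmult c (F x)) w = Cmult c (gsum n F w).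
Proof.
  revert F w. induction n as [|n IH]; intros F w; simpl.
  - destruct w; [reflexivity|ring].
  - rewrite <- msum_scal. apply msum_ext. intros v w' _. simpl. apply (IH (fun x => F (v :: x))).
Qed.

Lemma gsum_0 n w : gsum n (fun _ => RtoC 0) w = RtoC 0.
Proof.
  rewrite (gsum_ext n _ (fun x => Cmult (RtoC 0) (RtoC 0))) by (intros; ring).
  rewrite (gsum_scal n (RtoC 0) (fun _ => RtoC 0)). ring.
Qed.

Lemma gsum_csum {A} n (F : A -> list lvar -> C) l w :
  gsum n (fun x => csum (map (fun a => F a x) l)) w = csum (map (fun a => gsum n (F a) w) l).
Proof.
  induction l as [|a l IH]; simpl map.
  - apply gsum_0.
  - rewrite csum_cons, <- IH, <- gsum_plus. reflexivity.
Qed.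

Lemma gsum_bound n F w B : length w = n -> (forall w', Permutation w w' -> Cmod (F w') <= B) ->
  Cmod (gsum n F w) <= INR (fact n) * B.
Proof.
  revert F w. induction n as [|n IH]; intros F w Hl H.
  - destruct w; [|discriminate]. simpl. rewrite Rmult_1_l. apply H; reflexivity.
  - simpl gsum. rewrite fact_simpl, mult_INR, Rmult_assoc, <- Hl. apply msum_bound.
    intros [|v w'] Hp.
    + apply Permutation_length in Hp. rewrite Hl in Hp. discriminate.
    + simpl. apply IH.
      * apply Permutation_length in Hp. simpl in Hp. lia.
      * intros w'' Hp'. apply H. rewrite Hp. now constructor.
Qed.

(** The Koszul sign of the j-th letter is the product of its exchange signs with the letters before
    it, which is what the nested [tr] accumulate. This replaces positions by a recursion on
    words. *)
Lemma csum_msum (G : lvar -> list lvar -> C) w :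
  csum (map (fun j => Cmult (ksign w j) (G (nth j w dflt_var) (remove_nth j w))) (seq 0 (length w))) =
  msum w (fun w' => match w' with v :: w'' => G v w'' | [] => RtoC 0 end).
Proof.
  revert G. induction w as [|u w IH]; intros G; [reflexivity|].
  simpl length. rewrite <- cons_seq, map_cons, csum_cons, <- seq_shift, map_map.
  simpl msum. f_equal.
  - unfold ksign, remove_nth; simpl. rewrite andb_false_r. ring.
  - rewrite (csum_ext _ (fun j => Cmult (ksign w j) (Cmult (swap_sign (nth j w dflt_var) u) (G (nth j w dflt_var) (u :: remove_nth j w))))).
    + rewrite (IH (fun v w' => Cmult (swap_sign v u) (G v (u :: w')))).
      apply msum_ext. reflexivity.
    + intros j _. change (nth (S j) (u :: w) dflt_var) with (nth j w dflt_var).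
      change (remove_nth (S j) (u :: w)) with (u :: remove_nth j w).
      rewrite Cmult_assoc. f_equal. unfold ksign, swap_sign.
      change (nth (S j) (u :: w) dflt_var) with (nth j w dflt_var).
      change (firstn (S j) (u :: w)) with (u :: firstn j w). simpl filter.
      destruct (odd_var u), (odd_var (nth j w dflt_var)); simpl length; simpl andb;
        rewrite ?Nat.odd_succ, <- ?Nat.negb_odd; try destruct (Nat.odd _); simpl; rewrite ?sgn_m1; ring.
Qed.

(** Adjacent transpositions generate all permutations, so a condition on the first two letters,
    repeated behind every prefix, is enough. Only words of length n are constrained. *)
Fixpoint graded_sym (n : nat) (F : list lvar -> C) : Prop :=
  match n with
  | O => True
  | S m => (forall u v w, (length w + 1 = m)%nat -> F (u :: v :: w) = Cmult (swap_sign u v) (F (v :: u :: w)))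
           /\ forall u, graded_sym m (fun w => F (u :: w))
  end.

Lemma graded_sym_plus n F G : graded_sym n F -> graded_sym n G -> graded_sym n (fun w => Cplus (F w) (G w)).
Proof.
  revert F G. induction n as [|n IH]; intros F G HF HG; [exact I|]. destruct HF as [F1 F2], HG as [G1 G2]. split.
  - intros u v w Hl. rewrite (F1 u v w Hl), (G1 u v w Hl). ring.
  - intros u. now apply (IH (fun w => F (u :: w)) (fun w => G (u :: w))).
Qed.

Lemma graded_sym_scal n c F : graded_sym n F -> graded_sym n (fun w => Cmult c (F w)).
Proof.
  revert F. induction n as [|n IH]; intros F HF; [exact I|]. destruct HF as [F1 F2]. split.
  - intros u v w Hl. rewrite (F1 u v w Hl). ring.
  - intros u. now apply (IH (fun w => F (u :: w))).
Qed.

Lemma graded_sym_ext n F G : (forall w, length w = n -> F w = G w) -> graded_sym n F -> graded_sym n G.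
Proof.
  revert F G. induction n as [|n IH]; intros F G E HF; [exact I|]. destruct HF as [F1 F2]. split.
  - intros u v w Hl. rewrite <- !E by (simpl; lia). now apply F1.
  - intros u. apply (IH (fun w => F (u :: w))); [|auto]. intros w Hw. apply E. simpl; lia.
Qed.

(** Exchanging the first two letters exchanges the terms in which one of them leads; in the
    remaining terms both stand in the tail, where F is already symmetric. *)
Lemma graded_sym_msum n F : (forall u, graded_sym n (fun w => F (u :: w))) -> graded_sym (S n) (fun w => msum w F).
Proof.
  revert F. induction n as [|n IH]; intros F H.
  - split; [intros; lia|intros; exact I].
  - split.
    + intros u v w Hl. simpl.
      rewrite (msum_ext w (tr v (tr u F)) (fun x => Cmult (swap_sign u v) (tr u (tr v F) x))).
      * rewrite msum_scal, (swap_sign_sym v u).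
        transitivity (Cplus (Cmult (Cmult (swap_sign u v) (swap_sign u v)) (F (u :: v :: w)))
          (Cplus (Cmult (swap_sign u v) (F (v :: u :: w))) (Cmult (swap_sign u v) (msum w (tr u (tr v F)))))).
        -- rewrite swap_sign_sq. ring.
        -- ring.
      * intros x w' Hp. apply Permutation_length in Hp. simpl in Hp.
        simpl. destruct (H x) as [Hx _]. rewrite (Hx u v w') by lia. ring.
    + intros u. simpl. apply (graded_sym_plus (S n) (fun w => F (u :: w)) (fun w => msum w (tr u F))); [apply H|].
      apply IH. intros v. simpl. apply (graded_sym_scal n _ (fun w => F (v :: u :: w))). apply (H v).
Qed.

Lemma graded_sym_gsum n F : graded_sym n (gsum n F).
Proof.
  revert F. induction n as [|n IH]; intros F; [exact I|].
  apply (graded_sym_msum n (lift (gsum n) F)). intros u. simpl. apply IH.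
Qed.

Lemma msum_graded_sym n F w : graded_sym n F -> length w = n -> msum w F = Cmult (RtoC (INR n)) (F w).
Proof.
  revert n F. induction w as [|u w IH]; intros n F HF Hl; simpl in Hl; subst n; [simpl; ring|].
  destruct HF as [F1 F2]. simpl msum.
  rewrite (msum_ext w (tr u F) (fun x => F (u :: x))).
  - rewrite (IH (length w) (fun x => F (u :: x)) (F2 u) eq_refl). rewrite S_INR, RtoC_plus. ring.
  - intros v w' Hp. apply Permutation_length in Hp. simpl in Hp. simpl.
    rewrite (F1 u v w') by lia. now rewrite swap_sign_sym.
Qed.

Lemma gsum_graded_sym n F w : graded_sym n F -> length w = n -> gsum n F w = Cmult (RtoC (INR (fact n))) (F w).
Proof.
  revert F w. induction n as [|n IH]; intros F w HF Hl.
  - destruct w; [|discriminate]. simpl. ring.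
  - simpl gsum. rewrite (msum_ext w _ (fun x => Cmult (RtoC (INR (fact n))) (F x))).
    + rewrite msum_scal, (msum_graded_sym (S n) F w HF Hl).
      rewrite fact_simpl, mult_INR, RtoC_mult. ring.
    + intros v w' Hp. apply Permutation_length in Hp. simpl in *. apply (IH (fun x => F (v :: x))); [apply HF|lia].
Qed.

Fixpoint types_match (ks : list vtype) (w : list lvar) : bool :=
  match ks, w with
  | [], [] => true
  | k :: ks', v :: w' => vtype_eqb (vt v) k && types_match ks' w'
  | _, _ => false
  end.

Definition mono (ks : list vtype) (Cf : list Z -> C) (w : list lvar) : C :=
  if types_match ks w then Cf (map site w) else RtoC 0.

Lemma symc_gsum ks Cf w : symc ks Cf w = gsum (length w) (mono ks Cf) w.
Proof.
  revert Cf w. induction ks as [|k ks IH]; intros Cf w.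
  - destruct w as [|v w]; [reflexivity|]. symmetry.
    rewrite (gsum_ext _ _ (fun _ => RtoC 0)); [apply gsum_0|].
    intros [|v' w'] Hp; [|reflexivity]. apply Permutation_length in Hp; discriminate.
  - destruct w as [|v0 w0]; [reflexivity|]. set (w := v0 :: w0).
    cbn [symc].
    transitivity (msum w (fun w' => match w' with v :: w'' => if vtype_eqb (vt v) k then symc ks (fun l => Cf (site v :: l)) w'' else RtoC 0 | [] => RtoC 0 end)).
    + rewrite <- (csum_msum (fun v w'' => if vtype_eqb (vt v) k then symc ks (fun l => Cf (site v :: l)) w'' else RtoC 0) w).
      apply csum_ext. intros j _. destruct (vtype_eqb _ _); [reflexivity|ring].
    + change (gsum (length w) (mono (k :: ks) Cf) w) with (msum w (lift (gsum (length w0)) (mono (k :: ks) Cf))). apply (msum_ext w).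
      intros v w' Hp. apply Permutation_length in Hp. simpl in Hp. injection Hp as Hp.
      simpl. destruct (vtype_eqb (vt v) k) eqn:E.
      * rewrite IH, Hp. apply gsum_ext. intros x _. unfold mono. simpl. now rewrite E.
      * symmetry. rewrite (gsum_ext _ _ (fun _ => RtoC 0)); [apply gsum_0|].
        intros x _. unfold mono. simpl. now rewrite E.
Qed.

Definition raw (P : list lterm) (w : list lvar) : C := csum (map (fun t => mono (fst t) (snd t) w) P).

Lemma coef_gsum P w : coef P w = gsum (length w) (raw P) w.
Proof.
  unfold coef, raw. rewrite gsum_csum. apply csum_ext. intros t _. apply symc_gsum.
Qed.

Lemma graded_sym_coef P n : graded_sym n (coef P).
Proof.
  apply (graded_sym_ext n (gsum n (raw P))); [|apply graded_sym_gsum].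
  intros w <-. symmetry. apply coef_gsum.
Qed.

(** * Odd derivations and their compatibility with symmetrization *)

Section Derivation.
Variable q : lvar -> lvar -> C.
Hypothesis q_odd : forall v u, odd_var v = odd_var u -> q v u = RtoC 0.

Definition qsum (n : Z) (u : lvar) (G : lvar -> C) : C :=
  csum (map (fun st => Cmult (q (fst st, snd st, n) u) (G (fst st, snd st, n))) all_vtypes).

Lemma qsum_ext n u G H : (forall t, odd_var t = negb (odd_var u) -> G t = H t) -> qsum n u G = qsum n u H.
Proof.
  intros E. apply csum_ext. intros st _. destruct (bool_dec (odd_var (fst st, snd st, n)) (odd_var u)) as [e|e].
  - rewrite q_odd by assumption. ring.
  - rewrite E; [reflexivity|]. now destruct (odd_var (fst st, snd st, n)), (odd_var u).
Qed.

Lemma qsum_plus n u G H : qsum n u (fun t => Cplus (G t) (H t)) = Cplus (qsum n u G) (qsum n u H).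
Proof. unfold qsum. rewrite <- csum_plus. apply csum_ext. intros; ring. Qed.

Lemma qsum_scal n u c G : qsum n u (fun t => Cmult c (G t)) = Cmult c (qsum n u G).
Proof. unfold qsum. rewrite <- csum_scal. apply csum_ext. intros; ring. Qed.

(* The contribution of the letters at site n to the derivation, on words without symmetry. *)
Fixpoint deriv_at (n : Z) (w : list lvar) (F : list lvar -> C) : C :=
  match w with
  | [] => RtoC 0
  | u :: w' => Cplus (qsum n u (fun t => F (t :: w'))) (Cmult (eps u) (deriv_at n w' (fun x => F (u :: x))))
  end.

Lemma dsite_ext n w F G : (forall w', length w' = length w -> F w' = G w') -> deriv_at n w F = deriv_at n w G.
Proof.
  revert F G. induction w as [|u w IH]; intros F G H; [reflexivity|]. simpl. f_equal; [|f_equal].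
  - apply csum_ext. intros st _. f_equal. now apply H.
  - apply IH. intros w' Hw. apply H. simpl; lia.
Qed.

Lemma dsite_plus n w F G : deriv_at n w (fun x => Cplus (F x) (G x)) = Cplus (deriv_at n w F) (deriv_at n w G).
Proof.
  revert F G. induction w as [|u w IH]; intros F G; simpl; [ring|].
  rewrite qsum_plus, (IH (fun x => F (u :: x)) (fun x => G (u :: x))). ring.
Qed.

Lemma dsite_scal n w c F : deriv_at n w (fun x => Cmult c (F x)) = Cmult c (deriv_at n w F).
Proof.
  revert F. induction w as [|u w IH]; intros F; simpl; [ring|].
  rewrite qsum_scal, (IH (fun x => F (u :: x))). ring.
Qed.

Lemma qsum_msum n u w (G : lvar -> list lvar -> C) :
  qsum n u (fun t => msum w (G t)) = msum w (fun x => qsum n u (fun t => G t x)).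
Proof.
  unfold qsum. rewrite msum_csum. apply csum_ext. intros; now rewrite msum_scal.
Qed.

Lemma qsum_gsum n u m w (G : lvar -> list lvar -> C) :
  qsum n u (fun t => gsum m (G t) w) = gsum m (fun x => qsum n u (fun t => G t x)) w.
Proof.
  unfold qsum. rewrite gsum_csum. apply csum_ext. intros; now rewrite gsum_scal.
Qed.

(** In the cross terms one letter is moved to the front and another is replaced. The change of
    parity of the replaced letter alters the exchange sign, and the derivation, standing on the
    other side of the moved letter, supplies the same sign. *)
Lemma dsite_msum n w F : deriv_at n w (fun x => msum x F) = msum w (fun x => deriv_at n x F).
Proof.
  revert F. induction w as [|u w IH]; intros F; [reflexivity|]. simpl.
  rewrite qsum_plus, qsum_msum, (dsite_plus n w (fun x => F (u :: x)) (fun x => msum x (tr u F))), IH.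
  transitivity (Cplus (Cplus (qsum n u (fun t => F (t :: w))) (Cmult (eps u) (deriv_at n w (fun x => F (u :: x)))))
    (msum w (fun x => Cplus (qsum n u (fun t => tr t F x)) (Cmult (eps u) (deriv_at n x (tr u F)))))).
  - rewrite msum_plus, msum_scal. ring.
  - f_equal. apply msum_ext. intros v w' _. simpl.
    rewrite (qsum_ext n u (fun t => Cmult (swap_sign v t) (F (v :: t :: w'))) (fun t => Cmult (Cmult (swap_sign v u) (eps v)) (F (v :: t :: w')))).
    2:{ intros t Ht. now rewrite (swap_sign_flip u v t Ht). }
    rewrite (qsum_ext n v (fun t => Cmult (swap_sign t u) (F (t :: u :: w'))) (fun t => Cmult (Cmult (swap_sign v u) (eps u)) (F (t :: u :: w')))).
    2:{ intros t Ht. now rewrite swap_sign_sym, (swap_sign_flip v u t Ht), (swap_sign_sym u v). }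
    rewrite !qsum_scal, dsite_scal.
    set (X := qsum n v _). set (Y := qsum n u _). set (Z := deriv_at n w' _).
    transitivity (Cplus (Cmult (swap_sign v u) (Cmult (Cmult (eps u) (eps u)) X))
      (Cmult (swap_sign v u) (Cmult (eps v) (Cplus Y (Cmult (eps u) Z))))).
    + ring.
    + rewrite eps_sq. ring.
Qed.

Lemma dsite_gsum n m w F : length w = m -> deriv_at n w (gsum m F) = gsum m (fun x => deriv_at n x F) w.
Proof.
  revert w F. induction m as [|m IH]; intros w F Hl.
  - destruct w; [reflexivity|discriminate].
  - simpl gsum. rewrite dsite_msum. apply msum_ext. intros v w' Hp.
    apply Permutation_length in Hp. rewrite Hl in Hp. simpl in Hp. injection Hp as Hp.
    simpl. rewrite qsum_gsum, IH by (now symmetry). rewrite <- gsum_scal, <- gsum_plus. reflexivity.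
Qed.

(** Moving the affected letter to the front and, by symmetry of F, the new letter back produces two
    exchange signs that differ by [eps], the sign of a derivation acting in place. *)
Lemma dsite_graded_sym n w F : graded_sym (length w) F ->
  msum w (fun x => match x with v :: x' => qsum n v (fun t => F (t :: x')) | [] => RtoC 0 end) = deriv_at n w F.
Proof.
  revert F. induction w as [|u w IH]; intros F HF; [reflexivity|]. simpl. f_equal.
  destruct HF as [F1 F2].
  rewrite <- (IH (fun x => F (u :: x)) (F2 u)), <- msum_scal. apply msum_ext.
  intros v w' Hp. apply Permutation_length in Hp. simpl in Hp. simpl.
  rewrite <- !qsum_scal. apply qsum_ext. intros t Ht.
  rewrite (F1 t u w') by lia. rewrite (swap_sign_sym t u), (swap_sign_flip v u t Ht), (swap_sign_sym u v).
  transitivity (Cmult (Cmult (swap_sign v u) (swap_sign v u)) (Cmult (eps u) (F (u :: t :: w')))); [ring|].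
  rewrite swap_sign_sq. ring.
Qed.

(** Replaces the defining formula, in which letters are moved to the front, by the derivation in
    place, which is also meaningful for functions without symmetry. *)
Lemma Q_image_dsite F h : (forall n, graded_sym n F) ->
  (Q_image q F h <-> forall w, zsum_to (fun n => deriv_at n w F) (h w)).
Proof.
  intros HF.
  assert (E : forall w n, csum (map (fun j => Cmult (ksign w j) (csum (map (fun st =>
             Cmult (q (fst st, snd st, n) (nth j w dflt_var)) (F ((fst st, snd st, n) :: remove_nth j w))) all_vtypes)))
        (seq 0 (length w))) = deriv_at n w F).
  { intros w n. rewrite <- (dsite_graded_sym n w F (HF _)).
    exact (csum_msum (fun v w' => qsum n v (fun t => F (t :: w'))) w). }
  split; intros H w; specialize (H w); (eapply zsum_to_ext; [|exact H]); intros n; [apply E|symmetry; apply E].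
Qed.
End Derivation.

(** * The Koszul homotopy *)

Ltac pos := match goal with |- 0 <= _ * _ => apply Rmult_le_pos; pos | _ => lra end.

Definition exc (u : lvar) : bool := match u with (_, Chi, _) | (_, Fld, _) => true | _ => false end.

Definition excite (u : lvar) (k : Z) : lvar :=
  match u with (s, Phi, _) => (s, Chi, k) | (s, Chib, _) => (s, Fld, k) | (s, t, _) => (s, t, k) end.
Definition lower (u : lvar) (k : Z) : lvar :=
  match u with (s, Chi, _) => (s, Phi, k) | (s, Fld, _) => (s, Chib, k) | (s, t, _) => (s, t, k) end.
Definition sh (u : lvar) : lvar := (fst u, (snd u + 1)%Z).

Lemma site_excite u k : site (excite u k) = k. Proof. now destruct u as [[s []] x]. Qed.
Lemma site_lower u k : site (lower u k) = k. Proof. now destruct u as [[s []] x]. Qed.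
Lemma exc_excite u k : exc (excite u k) = true. Proof. now destruct u as [[s []] x]. Qed.
Lemma exc_lower u k : exc (lower u k) = false. Proof. now destruct u as [[s []] x]. Qed.
Lemma eps_excite u k : exc u = false -> eps (excite u k) = Copp (eps u).
Proof. destruct u as [[s []] x]; simpl; try discriminate; intros _; unfold eps, sgn; simpl; rewrite sgn_m1; ring. Qed.
Lemma eps_lower u k : exc u = true -> eps (lower u k) = Copp (eps u).
Proof. destruct u as [[s []] x]; simpl; try discriminate; intros _; unfold eps, sgn; simpl; rewrite sgn_m1; ring. Qed.
Lemma excite_sh u k : excite (sh u) (k + 1) = sh (excite u k). Proof. now destruct u as [[s []] x]. Qed.
Lemma lower_sh u k : lower (sh u) (k + 1) = sh (lower u k). Proof. now destruct u as [[s []] x]. Qed.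
Lemma excite_lower u k l : excite (lower u k) l = excite u l.
Proof. now destruct u as [[s []] x]. Qed.
Lemma exc_sh u : exc (sh u) = exc u. Proof. now destruct u as [[s []] x]. Qed.
Lemma eps_sh u : eps (sh u) = eps u. Proof. now destruct u as [[s []] x]. Qed.
Lemma site_sh u : site (sh u) = (site u + 1)%Z. Proof. now destruct u as [[s []] x]. Qed.
Lemma Cmod_eps u : Cmod (eps u) = 1. Proof. apply Cmod_sgn. Qed.

(** Joint decay of all letters about one site. The product form lets the letters be treated one at a
    time. *)
Fixpoint spread (z : Z) (M : R) (w : list lvar) : R :=
  match w with [] => 1 | v :: w' => ew M (site v - z) * spread z M w' end.

Lemma spread_pos z M w : 0 < spread z M w.
Proof. induction w; simpl; [lra|]. apply Rmult_lt_0_compat; [apply ew_pos|assumption]. Qed.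
Lemma spread_le1 z M w : 0 <= M -> spread z M w <= 1.
Proof.
  intros H. induction w; simpl; [lra|]. pose proof (ew_le1 M (site a - z) H). pose proof (ew_pos M (site a - z)).
  pose proof (spread_pos z M w). nra.
Qed.
Lemma spread_mono z M M' w : M' <= M -> spread z M w <= spread z M' w.
Proof.
  intros H. induction w; simpl; [lra|].
  apply Rmult_le_compat; auto using ew_mono; left; [apply ew_pos|apply spread_pos].
Qed.
(** By the triangle inequality each letter pays once for the displacement of the reference site,
    hence the number of letters in the rate. *)
Lemma spread_move k z M w : 0 <= M -> spread k M w * ew (M * INR (length w)) (k - z) <= spread z M w.
Proof.
  intros H. induction w as [|v w IH]; simpl length; simpl spread.
  - simpl. rewrite Rmult_0_r. unfold ew. rewrite Ropp_0, Rmult_0_l, exp_0. lra.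
  - rewrite S_INR, Rmult_plus_distr_l, Rmult_1_r, Rplus_comm, <- ew_mul.
    pose proof (ew_tri M (site v - k) (k - z) H) as T. replace (site v - k + (k - z))%Z with (site v - z)%Z in T by lia.
    pose proof (ew_pos M (site v - k)). pose proof (ew_pos M (k - z)). pose proof (spread_pos k M w).
    pose proof (ew_pos (M * INR (length w)) (k - z)).
    replace (ew M (site v - k) * spread k M w * (ew M (k - z) * ew (M * INR (length w)) (k - z)))
      with ((ew M (site v - k) * ew M (k - z)) * (spread k M w * ew (M * INR (length w)) (k - z))) by ring.
    apply Rmult_le_compat; auto; left; apply Rmult_lt_0_compat; assumption.
Qed.

(** * The differential on bounded functions of words *)

Section Complex.
Variables (nabla : Z -> C) (a1 a2 : C) (A0 M0 : R).
Hypotheses (Ha1 : a1 <> RtoC 0) (Ha2 : a2 <> RtoC 0) (HM0 : 0 < M0).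
Hypothesis Hnabla : forall k, Cmod (nabla k) <= A0 * ew M0 k.

(** The scalars [a1] and [a2] stand for the factors i and -i in the supercharges, so that one
    argument serves both sectors. *)
Definition ckern (u : lvar) (k : Z) : C :=
  match u with
  | (_, Phi, x) => Cmult a1 (nabla (k - x)%Z)
  | (_, Chib, x) => Cmult a2 (nabla (k - x)%Z)
  | _ => RtoC 0
  end.

Definition conv_op (G : lvar -> C) (u : lvar) : C := zsum (fun k => Cmult (ckern u k) (G (excite u k))).

Let Ac := (Cmod a1 + Cmod a2) * A0.

Lemma A0_ge0 : 0 <= A0.
Proof. apply (dom_ge0 (Cmod (nabla 0%Z)) A0 (ew M0 0)); [apply Cmod_ge_0|apply ew_pos|apply Hnabla]. Qed.

Lemma Ac_ge0 : 0 <= Ac.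
Proof. pose proof A0_ge0. pose proof (Cmod_ge_0 a1). pose proof (Cmod_ge_0 a2). unfold Ac; nra. Qed.

Lemma ckern_bound u k : Cmod (ckern u k) <= Ac * ew M0 (k - site u).
Proof.
  pose proof (Cmod_ge_0 a1). pose proof (Cmod_ge_0 a2). pose proof A0_ge0.
  destruct u as [[s []] x]; simpl; rewrite ?Cmod_mult, ?Cmod_0;
    try (pose proof Ac_ge0; pose proof (ew_pos M0 (k - x)); unfold site; simpl; nra);
    unfold site; simpl; unfold Ac; pose proof (Hnabla (k - x)); pose proof (Cmod_ge_0 (nabla (k - x)));
    rewrite Rmult_assoc; apply Rmult_le_compat; try assumption; lra.
Qed.

Lemma ckern_exc u k : exc u = true -> ckern u k = RtoC 0.
Proof. destruct u as [[s []] x]; simpl; try discriminate; reflexivity. Qed.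

Lemma ckern_sh u k : ckern (sh u) (k + 1) = ckern u k.
Proof. destruct u as [[s []] x]; unfold sh; simpl; try reflexivity; do 2 f_equal; lia. Qed.

Lemma cop_exc G u : exc u = true -> conv_op G u = RtoC 0.
Proof. intros H. apply zsum_0. intros k. rewrite ckern_exc by assumption. ring. Qed.

Lemma cop_ext G H u : (forall k, G (excite u k) = H (excite u k)) -> conv_op G u = conv_op H u.
Proof. intros E. apply zsum_ext. intros k. now rewrite E. Qed.

Lemma cop_term_bound G u B k : Cmod (G (excite u k)) <= B -> Cmod (Cmult (ckern u k) (G (excite u k))) <= Ac * B * ew M0 (k - site u).
Proof.
  intros H. rewrite Cmod_mult. replace (Ac * B * ew M0 (k - site u)) with (Ac * ew M0 (k - site u) * B) by ring.
  apply Rmult_le_compat; auto using Cmod_ge_0, ckern_bound.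
Qed.

Lemma cop_edom G u B : (forall k, Cmod (G (excite u k)) <= B) -> edom (fun k => Cmult (ckern u k) (G (excite u k))).
Proof. intros H. apply (edom_at _ (Ac * B) M0 (site u) HM0). intros k. now apply cop_term_bound. Qed.

Lemma cop_bound G u B : (forall k, Cmod (G (excite u k)) <= B) -> Cmod (conv_op G u) <= Ac * B * SS M0.
Proof. intros H. apply (zsum_le_at _ _ M0 (site u) HM0). intros k. now apply cop_term_bound. Qed.

(** Of the rate [M0] of the kernel, mu carries the decay of G over to the site of u, and the surplus
    [M0 - mu] makes the sum converge. *)
Lemma cop_decay G u z B mu : 0 <= mu < M0 -> 0 <= B -> (forall k, Cmod (G (excite u k)) <= B * ew mu (k - z)) ->
  Cmod (conv_op G u) <= Ac * SS (M0 - mu) * B * ew mu (site u - z).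
Proof.
  intros Hmu HB H. replace (Ac * SS (M0 - mu) * B * ew mu (site u - z)) with (Ac * B * ew mu (site u - z) * SS (M0 - mu)) by ring.
  apply (zsum_le_at _ _ (M0 - mu) (site u)); [lra|]. intros k. rewrite Cmod_mult.
  apply Rle_trans with ((Ac * ew M0 (k - site u)) * (B * ew mu (k - z))).
  - apply Rmult_le_compat; auto using Cmod_ge_0, ckern_bound.
  - replace M0 with ((M0 - mu) + mu) at 1 by ring. rewrite <- ew_mul.
    pose proof (ew_tri mu (site u - k) (k - z) (proj1 Hmu)) as T.
    replace (site u - k + (k - z))%Z with (site u - z)%Z in T by lia.
    replace (site u - k)%Z with (- (k - site u))%Z in T by lia. rewrite ew_opp in T.
    pose proof (ew_pos (M0 - mu) (k - site u)). pose proof Ac_ge0.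
    replace (Ac * (ew (M0 - mu) (k - site u) * ew mu (k - site u)) * (B * ew mu (k - z)))
      with (Ac * B * ew (M0 - mu) (k - site u) * (ew mu (k - site u) * ew mu (k - z))) by ring.
    replace (Ac * B * ew mu (site u - z) * ew (M0 - mu) (k - site u))
      with (Ac * B * ew (M0 - mu) (k - site u) * ew mu (site u - z)) by ring.
    apply Rmult_le_compat_l; [|assumption]. pos.
Qed.

Lemma cop_plus G H u B : (forall k, Cmod (G (excite u k)) <= B) -> (forall k, Cmod (H (excite u k)) <= B) ->
  conv_op (fun t => Cplus (G t) (H t)) u = Cplus (conv_op G u) (conv_op H u).
Proof.
  intros HG HH. unfold conv_op. rewrite <- zsum_plus.
  - apply zsum_ext. intros; ring.
  - apply edom_asum. now apply (cop_edom G u B).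
  - apply edom_asum. now apply (cop_edom H u B).
Qed.

Lemma cop_scal c G u B : (forall k, Cmod (G (excite u k)) <= B) -> conv_op (fun t => Cmult c (G t)) u = Cmult c (conv_op G u).
Proof.
  intros HG. unfold conv_op. rewrite <- zsum_scal.
  - apply zsum_ext. intros; ring.
  - apply edom_asum. now apply (cop_edom G u B).
Qed.

Lemma cop_sh G u B : (forall k, Cmod (G (sh (excite u k))) <= B) -> conv_op G (sh u) = conv_op (fun t => G (sh t)) u.
Proof.
  intros H. unfold conv_op.
  set (a := fun k => Cmult (ckern (sh u) k) (G (excite (sh u) k))).
  assert (Ha : edom a).
  { apply (cop_edom G (sh u) B). intros k. replace k with (k - 1 + 1)%Z by lia. rewrite excite_sh. apply H. }
  rewrite <- (zsum_shift a 1 Ha). apply zsum_ext. intros k. unfold a. now rewrite ckern_sh, excite_sh.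
Qed.

(** The derivation already summed over the sites. On bounded functions every sum in it converges
    absolutely, so it is linear there and commutes with dominated sums. *)
Fixpoint deriv (w : list lvar) (F : list lvar -> C) : C :=
  match w with
  | [] => RtoC 0
  | u :: w' => Cplus (conv_op (fun t => F (t :: w')) u) (Cmult (eps u) (deriv w' (fun x => F (u :: x))))
  end.

Definition bdd (m : nat) (B : R) (F : list lvar -> C) : Prop := forall w, length w = m -> Cmod (F w) <= B.

Lemma bdd_cons m B F u : bdd (S m) B F -> bdd m B (fun x => F (u :: x)).
Proof. intros H w Hw. apply H. simpl; lia. Qed.

Lemma diff_ext w F G : (forall w', length w' = length w -> F w' = G w') -> deriv w F = deriv w G.
Proof.
  revert F G. induction w as [|u w IH]; intros F G H; [reflexivity|]. simpl. f_equal; [|f_equal].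
  - apply cop_ext. intros k. now apply H.
  - apply IH. intros w' Hw. apply H. simpl; lia.
Qed.

Lemma diff_plus w F G B : bdd (length w) B F -> bdd (length w) B G ->
  deriv w (fun x => Cplus (F x) (G x)) = Cplus (deriv w F) (deriv w G).
Proof.
  revert F G. induction w as [|u w IH]; intros F G HF HG; simpl; [ring|].
  rewrite (cop_plus (fun t => F (t :: w)) (fun t => G (t :: w)) u B) by (intros; (apply HF || apply HG); reflexivity).
  rewrite (IH (fun x => F (u :: x)) (fun x => G (u :: x))) by (apply bdd_cons; assumption). ring.
Qed.

Lemma diff_scal w c F B : bdd (length w) B F -> deriv w (fun x => Cmult c (F x)) = Cmult c (deriv w F).
Proof.
  revert F. induction w as [|u w IH]; intros F HF; simpl; [ring|].
  rewrite (cop_scal c (fun t => F (t :: w)) u B) by (intros; apply HF; reflexivity).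
  rewrite (IH (fun x => F (u :: x))) by (now apply bdd_cons). ring.
Qed.

Lemma diff_0 w F : (forall w', length w' = length w -> F w' = RtoC 0) -> deriv w F = RtoC 0.
Proof.
  intros H. rewrite (diff_ext w F (fun x => Cmult (RtoC 0) (RtoC 0))) by (intros; rewrite H; [ring|assumption]).
  rewrite (diff_scal w (RtoC 0) (fun _ => RtoC 0) 0); [ring|]. intros x _. rewrite Cmod_0; lra.
Qed.

Lemma diff_bound w F B : bdd (length w) B F -> Cmod (deriv w F) <= INR (length w) * (Ac * SS M0) * B.
Proof.
  revert F. induction w as [|u w IH]; intros F HF; simpl deriv.
  - rewrite Cmod_0. simpl; lra.
  - eapply Rle_trans; [apply Cmod_triangle|]. rewrite Cmod_mult, Cmod_eps, Rmult_1_l.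
    simpl length. rewrite S_INR.
    assert (Cmod (conv_op (fun t => F (t :: w)) u) <= Ac * B * SS M0) by (apply cop_bound; intros; apply HF; reflexivity).
    specialize (IH (fun x => F (u :: x)) (bdd_cons _ _ _ u HF)). lra.
Qed.

Lemma diff_zsum w (F : Z -> list lvar -> C) D nu z : 0 < nu ->
  (forall k, bdd (length w) (D * ew nu (k - z)) (F k)) ->
  deriv w (fun x => zsum (fun k => F k x)) = zsum (fun k => deriv w (F k)).
Proof.
  intros Hnu. revert F. induction w as [|u w IH]; intros F HF; simpl.
  - symmetry. now apply zsum_0.
  - assert (HD : 0 <= D).
    { apply (dom_ge0 (Cmod (F 0%Z (u :: w))) D (ew nu (0 - z))); [apply Cmod_ge_0|apply ew_pos|apply HF; reflexivity]. }
    rewrite zsum_plus.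
    + f_equal.
      * unfold conv_op.
        rewrite (zsum_ext (fun l => Cmult (ckern u l) (zsum (fun k => F k (excite u l :: w))))
                 (fun l => zsum (fun k => Cmult (ckern u l) (F k (excite u l :: w))))).
        -- apply (zsum_swap_at _ (Ac * D) (Rmin M0 nu) (site u) z); [apply Rmin_glb_lt; lra|].
           intros l k. rewrite Cmod_mult.
           replace (Ac * D * (ew (Rmin M0 nu) (l - site u) * ew (Rmin M0 nu) (k - z)))
             with ((Ac * ew (Rmin M0 nu) (l - site u)) * (D * ew (Rmin M0 nu) (k - z))) by ring.
           apply Rmult_le_compat; try apply Cmod_ge_0.
           ++ eapply Rle_trans; [apply ckern_bound|]. apply Rmult_le_compat_l; [apply Ac_ge0|apply ew_mono, Rmin_l].
           ++ eapply Rle_trans; [apply HF; reflexivity|]. apply Rmult_le_compat_l; [assumption|apply ew_mono, Rmin_r].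
        -- intros l. symmetry. apply zsum_scal. apply edom_asum. apply (edom_at _ D nu z Hnu). intros k. apply HF; reflexivity.
      * rewrite (IH (fun k x => F k (u :: x))) by (intros k; apply bdd_cons; apply HF).
        symmetry. apply zsum_scal. apply edom_asum.
        apply (edom_at _ (INR (length w) * (Ac * SS M0) * D) nu z Hnu). intros k.
        rewrite Rmult_assoc. apply diff_bound. apply bdd_cons. apply HF.
    + apply edom_asum. apply (edom_at _ (Ac * SS M0 * D) nu z Hnu). intros k.
      replace (Ac * SS M0 * D * ew nu (k - z)) with (Ac * (D * ew nu (k - z)) * SS M0) by ring.
      apply cop_bound. intros; apply HF; reflexivity.
    + apply asum_scal. apply edom_asum.
      apply (edom_at _ (INR (length w) * (Ac * SS M0) * D) nu z Hnu). intros k.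
      rewrite Rmult_assoc. apply diff_bound. apply bdd_cons. apply HF.
Qed.

Lemma diff_op w (kap : Z -> C) (p : Z -> lvar) F D nu z B : 0 < nu -> bdd (S (length w)) B F ->
  (forall k, bdd (length w) (D * ew nu (k - z)) (fun x => Cmult (kap k) (F (p k :: x)))) ->
  deriv w (fun x => zsum (fun k => Cmult (kap k) (F (p k :: x)))) = zsum (fun k => Cmult (kap k) (deriv w (fun x => F (p k :: x)))).
Proof.
  intros Hnu HB H. rewrite (diff_zsum w (fun k x => Cmult (kap k) (F (p k :: x))) D nu z Hnu H).
  apply zsum_ext. intros k. apply (diff_scal w _ (fun x => F (p k :: x)) B). now apply bdd_cons.
Qed.

Lemma diff_cop w F u B : bdd (S (length w)) B F ->
  deriv w (fun x => conv_op (fun t => F (t :: x)) u) = conv_op (fun t => deriv w (fun x => F (t :: x))) u.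
Proof.
  intros HB. apply (diff_op w (ckern u) (excite u) F (Ac * B) M0 (site u) B HM0 HB).
  intros k x Hx. apply (cop_term_bound (fun t => F (t :: x))). apply HB. simpl; lia.
Qed.

(** * The contracting homotopy about a reference site *)

Section Homotopy.
Variables (dp dm : Z -> C) (mu mu' Bh : R).
Hypotheses (Hmu : 0 < mu <= mu') (Hmu' : mu' < M0).
Hypothesis Hdp : forall z x k, (z <= x)%Z -> Cmod (dp (k - x)%Z) <= Bh * ew mu (x - z) * / ew mu' (k - z).
Hypothesis Hdm : forall z x k, (x <= z)%Z -> Cmod (dm (k - x)%Z) <= Bh * ew mu (x - z) * / ew mu' (k - z).
Hypothesis Hdp1 : forall x l, zsum (fun k => Cmult (dp (k - x)%Z) (nabla (l - k)%Z)) = if Z.eqb l x then RtoC 1 else RtoC 0.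
Hypothesis Hdm1 : forall x l, zsum (fun k => Cmult (dm (k - x)%Z) (nabla (l - k)%Z)) = if Z.eqb l x then RtoC 1 else RtoC 0.

(** Of the two left inverses the one that decays in x on the side of z where x lies is taken. The
    price, growth in k at rate [mu'], is paid by functions decaying about z at a rate [M] above
    [mu']. *)
Definition inv_kern (z x k : Z) : C := if Z.leb z x then dp (k - x)%Z else dm (k - x)%Z.

Definition hkern (z : Z) (u : lvar) (k : Z) : C :=
  match u with
  | (_, Chi, x) => Cmult (Cinv a1) (inv_kern z x k)
  | (_, Fld, x) => Cmult (Cinv a2) (inv_kern z x k)
  | _ => RtoC 0
  end.

Definition hop (z : Z) (G : lvar -> C) (u : lvar) : C := zsum (fun k => Cmult (hkern z u k) (G (lower u k))).

Let Bk := (Cmod (Cinv a1) + Cmod (Cinv a2)) * Bh.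

Lemma inv_kern_bound z x k : Cmod (inv_kern z x k) <= Bh * ew mu (x - z) * / ew mu' (k - z).
Proof. unfold inv_kern. destruct (Z.leb_spec z x); [apply Hdp|apply Hdm]; lia. Qed.

Lemma Bh_ge0 : 0 <= Bh.
Proof.
  pose proof (inv_kern_bound 0 0 0) as H. simpl Z.sub in H. rewrite !ew_0 in H. pose proof (Cmod_ge_0 (inv_kern 0 0 0)).
  replace (/ 1) with 1 in H by field. lra.
Qed.

Lemma Bk_ge0 : 0 <= Bk.
Proof. pose proof Bh_ge0. pose proof (Cmod_ge_0 (Cinv a1)). pose proof (Cmod_ge_0 (Cinv a2)). unfold Bk; nra. Qed.

Lemma hkern_bound z u k : Cmod (hkern z u k) <= Bk * ew mu (site u - z) * / ew mu' (k - z).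
Proof.
  pose proof (Cmod_ge_0 (Cinv a1)). pose proof (Cmod_ge_0 (Cinv a2)). pose proof Bh_ge0. pose proof Bk_ge0.
  pose proof (ew_pos mu (site u - z)). pose proof (Rinv_0_lt_compat _ (ew_pos mu' (k - z))).
  assert (0 <= Bk * ew mu (site u - z) * / ew mu' (k - z)) by (pos).
  destruct u as [[s []] x]; simpl; rewrite ?Cmod_mult, ?Cmod_0; try assumption;
    unfold site, Bk in *; simpl in *; pose proof (inv_kern_bound z x k); pose proof (Cmod_ge_0 (inv_kern z x k));
    rewrite 2!Rmult_assoc; apply Rmult_le_compat; try assumption; try lra; rewrite <- Rmult_assoc; assumption.
Qed.

Lemma hkern_sh z u k : hkern (z + 1) (sh u) (k + 1) = hkern z u k.
Proof.
  destruct u as [[s []] x]; unfold sh; simpl; try reflexivity; f_equal; unfold inv_kern;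
  destruct (Z.leb_spec (z + 1) (x + 1)), (Z.leb_spec z x); try lia; f_equal; lia.
Qed.

Lemma hop_ext z G H u : (forall k, G (lower u k) = H (lower u k)) -> hop z G u = hop z H u.
Proof. intros E. apply zsum_ext. intros k. now rewrite E. Qed.

Variable M : R.
Hypothesis HM : mu' < M.

Lemma hop_term_bound z G u A k : 0 <= A -> Cmod (G (lower u k)) <= A * ew M (k - z) ->
  Cmod (Cmult (hkern z u k) (G (lower u k))) <= Bk * A * ew mu (site u - z) * ew (M - mu') (k - z).
Proof.
  intros HA H. rewrite Cmod_mult. pose proof (ew_pos mu' (k - z)).
  apply Rle_trans with ((Bk * ew mu (site u - z) * / ew mu' (k - z)) * (A * ew M (k - z))).
  - apply Rmult_le_compat; auto using Cmod_ge_0, hkern_bound.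
  - replace M with ((M - mu') + mu') at 1 by ring. rewrite <- ew_mul. right; field. lra.
Qed.

Lemma hop_edom z G u A : 0 <= A -> (forall k, Cmod (G (lower u k)) <= A * ew M (k - z)) ->
  edom (fun k => Cmult (hkern z u k) (G (lower u k))).
Proof.
  intros HA H. apply (edom_at _ (Bk * A * ew mu (site u - z)) (M - mu') z); [lra|]. intros k. now apply hop_term_bound.
Qed.

Lemma hop_bound z G u A : 0 <= A -> (forall k, Cmod (G (lower u k)) <= A * ew M (k - z)) ->
  Cmod (hop z G u) <= Bk * SS (M - mu') * A * ew mu (site u - z).
Proof.
  intros HA H. replace (Bk * SS (M - mu') * A * ew mu (site u - z)) with (Bk * A * ew mu (site u - z) * SS (M - mu')) by ring.
  apply (zsum_le_at _ _ (M - mu') z); [lra|]. intros k. now apply hop_term_bound.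
Qed.

Lemma hop_scal z c G u A : 0 <= A -> (forall k, Cmod (G (lower u k)) <= A * ew M (k - z)) ->
  hop z (fun t => Cmult c (G t)) u = Cmult c (hop z G u).
Proof.
  intros HA HG. unfold hop. rewrite <- zsum_scal.
  - apply zsum_ext. intros; ring.
  - apply edom_asum. now apply (hop_edom z G u A).
Qed.

Lemma hop_sh z G u A : 0 <= A -> (forall k, Cmod (G (sh (lower u k))) <= A * ew M (k - z)) ->
  hop (z + 1) G (sh u) = hop z (fun t => G (sh t)) u.
Proof.
  intros HA H. unfold hop.
  set (a := fun k => Cmult (hkern (z + 1) (sh u) k) (G (lower (sh u) k))).
  assert (Ha : edom a).
  { apply (hop_edom (z + 1) G (sh u) A HA). intros k. replace k with (k - 1 + 1)%Z by lia. rewrite lower_sh.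
    replace (k - 1 + 1 - (z + 1))%Z with (k - 1 - z)%Z by lia. apply H. }
  rewrite <- (zsum_shift a 1 Ha). apply zsum_ext. intros k. unfold a. now rewrite hkern_sh, lower_sh.
Qed.

(** The kernel is chosen by z and x, before the sum over k is taken, so either choice inverts the
    convolution exactly; the work lies in the exchange of the two sums. *)
Lemma hop_cop z G u A : exc u = true -> 0 <= A -> (forall k, Cmod (G (excite u k)) <= A * ew M (k - z)) ->
  hop z (conv_op G) u = G u.
Proof.
  intros Hu HA H.
  (* Both [M] and [M0] exceed [mu'] by at least 2 nu: the part [mu'] cancels the growth of the
     kernel, one nu gives summability in k, and another, taken from [M], summability in l. *)
  set (nu := (Rmin M M0 - mu') / 2).
  assert (Hnu : 0 < nu).
  { unfold nu. assert (mu' < Rmin M M0) by (apply Rmin_glb_lt; lra). lra. }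
  assert (E : forall k l, Cmult (hkern z u k) (ckern (lower u k) l) = Cmult (inv_kern z (site u) k) (nabla (l - k))).
  { intros k l. destruct u as [[s []] x]; try discriminate; unfold site; simpl; field; assumption. }
  unfold hop at 1, conv_op at 1.
  rewrite (zsum_ext _ (fun k => zsum (fun l => Cmult (Cmult (hkern z u k) (ckern (lower u k) l)) (G (excite u l))))).
  - rewrite (zsum_swap_at _ (Bk * Ac * A) nu z z Hnu).
    + rewrite (zsum_ext _ (fun l => if Z.eqb l (site u) then G (excite u l) else RtoC 0)).
      * rewrite (zsum_delta (fun l => G (excite u l)) (site u)). f_equal. now destruct u as [[s []] x].
      * intros l.
        assert (Hd : zsum (fun k => Cmult (inv_kern z (site u) k) (nabla (l - k)%Z)) = if Z.eqb l (site u) then RtoC 1 else RtoC 0).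
        { unfold inv_kern. destruct (Z.leb z (site u)); [apply Hdp1|apply Hdm1]. }
        rewrite (zsum_ext _ (fun k => Cmult (G (excite u l)) (Cmult (inv_kern z (site u) k) (nabla (l - k)%Z)))).
        -- rewrite zsum_scal.
           ++ rewrite Hd. destruct (Z.eqb l (site u)); ring.
           ++ apply edom_asum. apply (edom_at _ (Bh * ew mu (site u - z) * A0 * / ew M0 (l - z)) (M0 - mu') z); [lra|].
              intros k. rewrite Cmod_mult.
              eapply Rle_trans; [apply Rmult_le_compat; [apply Cmod_ge_0|apply Cmod_ge_0|apply inv_kern_bound|apply Hnabla]|].
              pose proof (ew_tri M0 (- (l - k)) (l - z) ltac:(lra)) as T. rewrite ew_opp in T.
              replace (- (l - k) + (l - z))%Z with (k - z)%Z in T by lia.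
              pose proof (ew_pos M0 (l - z)). pose proof (ew_pos mu' (k - z)). pose proof (ew_pos (M0 - mu') (k - z)).
              pose proof (ew_pos mu (site u - z)). pose proof Bh_ge0. pose proof A0_ge0.
              apply Rle_trans with (Bh * ew mu (site u - z) * A0 * / ew mu' (k - z) * (ew M0 (k - z) * / ew M0 (l - z))).
              ** replace (Bh * ew mu (site u - z) * / ew mu' (k - z) * (A0 * ew M0 (l - k)))
                   with (Bh * ew mu (site u - z) * A0 * / ew mu' (k - z) * ew M0 (l - k)) by ring.
                 pose proof (Rinv_0_lt_compat _ (ew_pos mu' (k - z))).
                 apply Rmult_le_compat_l; [pos|]. apply (Rmult_le_reg_r (ew M0 (l - z))); [assumption|].
                 rewrite Rmult_assoc, Rinv_l, Rmult_1_r by lra. exact T.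
              ** replace (ew M0 (k - z)) with (ew (M0 - mu') (k - z) * ew mu' (k - z)) by (rewrite ew_mul; f_equal; ring).
                 right. field. split; lra.
        -- intros k. rewrite E. ring.
    + intros k l. rewrite !Cmod_mult.
      eapply Rle_trans.
      { apply Rmult_le_compat; [|apply Cmod_ge_0| |apply H].
        - apply Rmult_le_pos; apply Cmod_ge_0.
        - apply Rmult_le_compat; [apply Cmod_ge_0|apply Cmod_ge_0|apply hkern_bound|apply ckern_bound]. }
      rewrite site_lower.
      set (m := Rmin M M0) in *.
      assert (Hm : m = mu' + nu + nu) by (unfold nu; lra).
      pose proof (ew_mono M0 m (l - k) (Rmin_r _ _)) as I1. pose proof (ew_mono M m (l - z) (Rmin_l _ _)) as I2.
      rewrite Hm, <- !ew_mul in I1, I2.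
      pose proof (ew_tri mu' (- (l - k)) (l - z) ltac:(lra)) as T1. rewrite ew_opp in T1.
      replace (- (l - k) + (l - z))%Z with (k - z)%Z in T1 by lia.
      pose proof (ew_tri nu (- (l - k)) (l - z) ltac:(lra)) as T2. rewrite ew_opp in T2.
      replace (- (l - k) + (l - z))%Z with (k - z)%Z in T2 by lia.
      pose proof (ew_le1 nu (l - k) ltac:(lra)). pose proof (ew_pos nu (l - k)).
      pose proof (ew_pos nu (l - z)). pose proof (ew_pos nu (k - z)).
      pose proof (ew_pos mu' (l - k)). pose proof (ew_pos mu' (l - z)). pose proof (ew_pos mu' (k - z)).
      pose proof Bk_ge0. pose proof Ac_ge0.
      pose proof (ew_le1 mu (site u - z) ltac:(lra)). pose proof (ew_pos mu (site u - z)).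
      pose proof (ew_pos M0 (l - k)). pose proof (ew_pos M (l - z)).
      assert (J : ew M0 (l - k) * ew M (l - z) <= ew mu' (k - z) * (ew nu (k - z) * ew nu (l - z))).
      { apply Rle_trans with ((ew mu' (l - k) * ew nu (l - k) * ew nu (l - k)) * (ew mu' (l - z) * ew nu (l - z) * ew nu (l - z))).
        - apply Rmult_le_compat; try lra; assumption.
        - replace ((ew mu' (l - k) * ew nu (l - k) * ew nu (l - k)) * (ew mu' (l - z) * ew nu (l - z) * ew nu (l - z)))
            with ((ew mu' (l - k) * ew mu' (l - z)) * (((ew nu (l - k) * ew nu (l - z)) * ew nu (l - z)) * ew nu (l - k))) by ring.
          apply Rmult_le_compat; [left; apply Rmult_lt_0_compat; lra| |assumption|].
          + pos.
          + rewrite <- (Rmult_1_r (ew nu (k - z) * ew nu (l - z))).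
            apply Rmult_le_compat; try lra; [pos|].
            apply Rmult_le_compat_r; lra. }
      apply Rle_trans with (Bk * Ac * A * (/ ew mu' (k - z) * (ew M0 (l - k) * ew M (l - z)))).
      * replace (Bk * ew mu (site u - z) * / ew mu' (k - z) * (Ac * ew M0 (l - k)) * (A * ew M (l - z)))
          with (ew mu (site u - z) * (Bk * Ac * A * (/ ew mu' (k - z) * (ew M0 (l - k) * ew M (l - z))))) by ring.
        rewrite <- (Rmult_1_l (Bk * Ac * A * (/ ew mu' (k - z) * (ew M0 (l - k) * ew M (l - z))))) at 2.
        apply Rmult_le_compat_r; [|assumption].
        pose proof (Rinv_0_lt_compat _ (ew_pos mu' (k - z))). pos.
      * apply Rmult_le_compat_l; [pos|].
        apply (Rmult_le_reg_l (ew mu' (k - z))); [assumption|]. rewrite <- Rmult_assoc, Rinv_r, Rmult_1_l by lra. exact J.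
  - intros k. rewrite <- zsum_scal.
    + apply zsum_ext. intros l. rewrite excite_lower. ring.
    + apply edom_asum. apply (cop_edom G (lower u k) A). intros l. rewrite excite_lower.
      eapply Rle_trans; [apply H|]. pose proof (ew_le1 M (l - z) ltac:(lra)). nra.
Qed.

Definition rbd (z : Z) (A : R) (m : nat) (F : list lvar -> C) : Prop :=
  forall w, length w = m -> Cmod (F w) <= A * spread z M w.

Lemma rbd_bdd z A m F : 0 <= A -> rbd z A m F -> bdd m A F.
Proof.
  intros HA H w Hw. eapply Rle_trans; [now apply H|].
  pose proof (spread_le1 z M w ltac:(lra)). pose proof (spread_pos z M w). nra.
Qed.

Lemma rbd_head z A m F w : rbd z A (S m) F -> length w = m ->
  forall t, Cmod (F (t :: w)) <= (A * spread z M w) * ew M (site t - z).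
Proof. intros H Hw t. eapply Rle_trans; [apply H; simpl; lia|]. simpl. right; ring. Qed.

(** The defect 1 - d h of the one-letter homotopy on a ground letter. On an excited letter h d is
    the identity and the defect is 0, which is why [homot] continues only past ground letters. *)
Definition proj (z : Z) (F : list lvar -> C) (u : lvar) (x : list lvar) : C :=
  Cminus (F (u :: x)) (conv_op (hop z (fun t => F (t :: x))) u).

Definition pcst := 1 + Ac * SS (M0 - mu) * (Bk * SS (M - mu')).

Lemma pcst_pos : 0 <= pcst.
Proof.
  unfold pcst. pose proof Ac_ge0. pose proof Bk_ge0. pose proof (SS_ge1 (M0 - mu) ltac:(lra)).
  pose proof (SS_ge1 (M - mu') ltac:(lra)).
  assert (0 <= Ac * SS (M0 - mu) * (Bk * SS (M - mu'))) by (apply Rmult_le_pos; apply Rmult_le_pos; lra). lra.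
Qed.

(** Only the head drops to the rate [mu]; the other letters keep [M]. Each letter thus loses decay
    once, and the losses do not accumulate along the word. *)
Lemma rbd_proj z A m F u : 0 <= A -> rbd z A (S m) F -> rbd z (A * pcst * ew mu (site u - z)) m (proj z F u).
Proof.
  intros HA H w Hw. unfold proj.
  pose proof (spread_pos z M w). pose proof (SS_ge1 (M - mu') ltac:(lra)). pose proof Bk_ge0.
  assert (HAw : 0 <= A * spread z M w) by (apply Rmult_le_pos; lra).
  pose proof (rbd_head z A m F w H Hw) as Hh.
  unfold Cminus. eapply Rle_trans; [apply Cmod_triangle|]. rewrite Cmod_opp. unfold pcst.
  assert (Cmod (F (u :: w)) <= (A * spread z M w) * ew mu (site u - z)).
  { eapply Rle_trans; [apply Hh|]. apply Rmult_le_compat_l; [assumption|apply ew_mono; lra]. }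
  assert (Cmod (conv_op (hop z (fun t => F (t :: w))) u) <= Ac * SS (M0 - mu) * (Bk * SS (M - mu') * (A * spread z M w)) * ew mu (site u - z)).
  { apply cop_decay; [lra|pos|].
    intros k. eapply Rle_trans; [apply (hop_bound z _ _ (A * spread z M w) HAw)|].
    - intros l. rewrite <- (site_lower (excite u k) l) at 2. apply Hh.
    - rewrite site_excite. lra. }
  lra.
Qed.

(* Contracting homotopy: the reference site z stays fixed while the letters of w are treated one after the other. *)
Fixpoint homot (z : Z) (w : list lvar) (F : list lvar -> C) : C :=
  match w with
  | [] => RtoC 0
  | u :: w' => if exc u then hop z (fun t => F (t :: w')) u
               else Cmult (eps u) (homot z w' (proj z F u))
  end.

Lemma homot_ext z w F G : (forall w', length w' = length w -> F w' = G w') -> homot z w F = homot z w G.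
Proof.
  revert F G. induction w as [|u w IH]; intros F G H; [reflexivity|]. simpl. destruct (exc u).
  - apply hop_ext. intros k. now apply H.
  - f_equal. apply IH. intros w' Hw. unfold proj. f_equal; [apply H; simpl; lia|].
    apply cop_ext. intros k. apply hop_ext. intros l. apply H. simpl; lia.
Qed.

Lemma homot_ground z w F : forallb (fun u => negb (exc u)) w = true -> homot z w F = RtoC 0.
Proof.
  revert F. induction w as [|u w IH]; intros F H; [reflexivity|]. simpl in *.
  apply andb_prop in H. destruct H as [H1 H2]. apply negb_true_iff in H1. rewrite H1, IH by assumption. ring.
Qed.

Lemma homot_bound m : exists D, 0 <= D /\ forall z A F, 0 <= A -> rbd z A m F ->
  forall w, length w = m -> Cmod (homot z w F) <= D * A * spread z mu w.
Proof.
  induction m as [|m (D & HD & IH)].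
  - exists 0. split; [lra|]. intros z A F HA H w Hw. destruct w; [|discriminate]. simpl. rewrite Cmod_0; lra.
  - pose proof Bk_ge0. pose proof pcst_pos. pose proof (SS_ge1 (M - mu') ltac:(lra)).
    assert (0 <= Bk * SS (M - mu')) by (apply Rmult_le_pos; lra).
    assert (0 <= D * pcst) by (apply Rmult_le_pos; lra).
    exists (Bk * SS (M - mu') + D * pcst). split; [lra|].
    intros z A F HA HF w Hw. destruct w as [|u w]; [discriminate|]. simpl in Hw. injection Hw as Hw.
    pose proof (spread_pos z M w). pose proof (ew_pos mu (site u - z)). pose proof (spread_pos z mu w).
    assert (spread z M w <= spread z mu w) by (apply spread_mono; lra).
    assert (0 <= A * (ew mu (site u - z) * spread z mu w)) by (apply Rmult_le_pos; [lra|]; apply Rmult_le_pos; lra).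
    simpl homot. simpl spread. destruct (exc u) eqn:Eu.
    + apply Rle_trans with (Bk * SS (M - mu') * (A * spread z M w) * ew mu (site u - z)).
      * apply hop_bound; [apply Rmult_le_pos; lra|]. intros k.
        rewrite <- (site_lower u k) at 2. apply (rbd_head z A m F w HF Hw).
      * apply Rle_trans with ((Bk * SS (M - mu')) * (A * (ew mu (site u - z) * spread z mu w))).
        -- replace (Bk * SS (M - mu') * (A * spread z M w) * ew mu (site u - z))
            with ((Bk * SS (M - mu')) * (A * (ew mu (site u - z) * spread z M w))) by ring.
           apply Rmult_le_compat_l; [assumption|]. apply Rmult_le_compat_l; [assumption|]. apply Rmult_le_compat_l; lra.
        -- nra.
    + rewrite Cmod_mult, Cmod_eps, Rmult_1_l.
      eapply Rle_trans; [apply (IH z (A * pcst * ew mu (site u - z)))|].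
      * pos.
      * now apply rbd_proj.
      * assumption.
      * replace (D * (A * pcst * ew mu (site u - z)) * spread z mu w) with (D * pcst * (A * (ew mu (site u - z) * spread z mu w))) by ring.
        nra.
Qed.

(** The kernel depends on differences of sites and its choice on the sign of x - z, so a common
    shift of z and of the word has no effect. *)
Lemma homot_sh z m A F : 0 <= A -> rbd z A m (fun x => F (map sh x)) ->
  forall w, length w = m -> homot (z + 1) (map sh w) F = homot z w (fun x => F (map sh x)).
Proof.
  revert A F. induction m as [|m IH]; intros A F HA HF w Hw.
  - destruct w; [reflexivity|discriminate].
  - destruct w as [|u w]; [discriminate|]. simpl in Hw. injection Hw as Hw.
    assert (Hh : forall x, length x = m -> forall v, hop (z + 1) (fun t => F (t :: map sh x)) (sh v) = hop z (fun t => F (sh t :: map sh x)) v).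
    { intros x Hx v. apply (hop_sh z (fun t => F (t :: map sh x)) v (A * spread z M x)).
      - pose proof (spread_pos z M x). apply Rmult_le_pos; lra.
      - intros k. rewrite <- (site_lower v k) at 2. apply (rbd_head z A m (fun x => F (map sh x)) x HF Hx). }
    cbn [map homot]. rewrite exc_sh. destruct (exc u).
    + now apply Hh.
    + rewrite eps_sh. f_equal.
      assert (HP : forall x, length x = m -> proj (z + 1) F (sh u) (map sh x) = proj z (fun x => F (map sh x)) u x).
      { intros x Hx. unfold proj. cbn [map]. f_equal.
        rewrite (cop_sh _ u (Bk * SS (M - mu') * (A * spread z M x))).
        - apply cop_ext. intros k. now apply Hh.
        - intros k. rewrite Hh by assumption. pose proof (spread_pos z M x). pose proof Bk_ge0.
          pose proof (SS_ge1 (M - mu') ltac:(lra)).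
          eapply Rle_trans; [apply (hop_bound z _ _ (A * spread z M x))|].
          + apply Rmult_le_pos; lra.
          + intros l. rewrite <- (site_lower (excite u k) l) at 2. apply (rbd_head z A m (fun x => F (map sh x)) x HF Hx).
          + assert (0 <= Bk * SS (M - mu') * (A * spread z M x)) by (pos).
            pose proof (ew_le1 mu (site (excite u k) - z) ltac:(lra)). pose proof (ew_pos mu (site (excite u k) - z)). nra. }
      rewrite (IH (A * pcst * ew mu (site u - z)) (proj (z + 1) F (sh u))).
      * apply homot_ext. intros x Hx. apply HP. lia.
      * pose proof pcst_pos. pose proof (ew_pos mu (site u - z)). pos.
      * intros x Hx. rewrite HP by assumption. now apply (rbd_proj z A m (fun x => F (map sh x)) u HA HF).
      * assumption.
Qed.

Lemma diff_hop z A w F u : 0 <= A -> rbd z A (S (length w)) F ->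
  deriv w (fun x => hop z (fun t => F (t :: x)) u) = hop z (fun t => deriv w (fun x => F (t :: x))) u.
Proof.
  intros HA HF.
  apply (diff_op w (hkern z u) (lower u) F (Bk * A * ew mu (site u - z)) (M - mu') z A); [lra|now apply (rbd_bdd z)|].
  intros k x Hx. apply (hop_term_bound z (fun t => F (t :: x)) u A k HA).
  rewrite <- (site_lower u k) at 2.
  eapply Rle_trans; [apply (rbd_head z A (length w) F x HF Hx)|].
  pose proof (spread_le1 z M x ltac:(lra)). pose proof (spread_pos z M x). pose proof (ew_pos M (site (lower u k) - z)).
  apply Rmult_le_compat_r; [lra|]. nra.
Qed.

(** The homotopy of a tensor product, h on the first letter plus (1 - d h) times the homotopy of the
    tail. Words of ground letters only are where no one-letter homotopy can help, so F is assumed to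
    vanish on them. *)
Lemma diff_homot m z A F : 0 <= A -> rbd z A m F -> (forall w, length w = m -> deriv w F = RtoC 0) ->
  (forall w, length w = m -> forallb (fun u => negb (exc u)) w = true -> F w = RtoC 0) ->
  forall w, length w = m -> deriv w (fun x => homot z x F) = F w.
Proof.
  revert A F. induction m as [|m IH]; intros A F HA HF HD H0 w Hw.
  - destruct w; [|discriminate]. simpl. symmetry. now apply H0.
  - destruct w as [|u w]; [discriminate|]. simpl in Hw. injection Hw as Hw.
    pose proof (rbd_bdd z A _ F HA HF) as HB.
    assert (HDc : forall x, length x = m -> forall v, deriv x (fun y => F (v :: y)) = Cmult (Copp (eps v)) (conv_op (fun t => F (t :: x)) v)).
    { intros x Hx v. pose proof (HD (v :: x) ltac:(simpl; lia)) as E. simpl in E.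
      replace (deriv x (fun y => F (v :: y))) with (Cmult (Cmult (eps v) (eps v)) (deriv x (fun y => F (v :: y)))) by (rewrite eps_sq; ring).
      set (P := conv_op _ v) in *. set (Q := deriv x _) in *.
      replace (Cmult (Cmult (eps v) (eps v)) Q) with (Cmult (eps v) (Cminus (Cplus P (Cmult (eps v) Q)) P)) by ring.
      rewrite E. ring. }
    assert (Hw0 : forall x, length x = m -> 0 <= A * spread z M x).
    { intros x Hx. pose proof (spread_pos z M x). apply Rmult_le_pos; lra. }
    (* The tail differential passes through [hop]; closedness turns it into the convolution in the
       first letter, and the left inverse returns F. The letter inside [hop] is lowered, so its sign
       cancels the minus sign of closedness. *)
    assert (Hhd : forall x, length x = m -> forall v, exc v = true ->
       deriv x (fun y => hop z (fun t => F (t :: y)) v) = Cmult (eps v) (F (v :: x))).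
    { intros x Hx v Hv. rewrite (diff_hop z A x F v HA) by (now rewrite Hx).
      rewrite (hop_ext z _ (fun t => Cmult (eps v) (conv_op (fun t => F (t :: x)) t))).
      - assert (Hc : hop z (fun t => Cmult (eps v) (conv_op (fun t => F (t :: x)) t)) v = hop z (conv_op (fun t => Cmult (eps v) (F (t :: x)))) v).
        { apply hop_ext. intros k. symmetry. apply (cop_scal (eps v) (fun t => F (t :: x)) _ A).
          intros l. apply HB. simpl; lia. }
        rewrite Hc. apply (hop_cop z (fun t => Cmult (eps v) (F (t :: x))) v (A * spread z M x) Hv (Hw0 x Hx)).
        intros k. rewrite Cmod_mult, Cmod_eps, Rmult_1_l. rewrite <- (site_excite v k) at 2. apply (rbd_head z A m F x HF Hx).
      - intros k. rewrite (HDc x Hx), eps_lower by assumption. ring. }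
    simpl. destruct (exc u) eqn:Eu.
    + rewrite cop_exc by assumption.

      rewrite (Hhd w Hw u Eu). transitivity (Cmult (Cmult (eps u) (eps u)) (F (u :: w))); [ring|]. rewrite eps_sq; ring.
    + rewrite (cop_ext _ (hop z (fun t => F (t :: w)))) by (intros k; now rewrite exc_excite).
      destruct (homot_bound m) as (D & HDp & HDb).
      pose proof pcst_pos as Hp. pose proof (ew_pos mu (site u - z)) as He.
      assert (HA' : 0 <= A * pcst * ew mu (site u - z)) by (pos).
      pose proof (rbd_proj z A m F u HA HF) as HP.
      assert (Hhb : forall x, length x = m -> forall v, Cmod (hop z (fun t => F (t :: x)) v) <= Bk * SS (M - mu') * A).
      { intros x Hx v. pose proof (spread_pos z M x). pose proof Bk_ge0. pose proof (SS_ge1 (M - mu') ltac:(lra)).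
        pose proof (spread_le1 z M x ltac:(lra)).
        eapply Rle_trans; [apply (hop_bound z _ v A HA)|].
        - intros l. rewrite <- (site_lower v l) at 2. eapply Rle_trans; [apply (rbd_head z A m F x HF Hx)|].
          pose proof (ew_pos M (site (lower v l) - z)). apply Rmult_le_compat_r; [lra|]. nra.
        - assert (0 <= Bk * SS (M - mu') * A) by (pos).
          pose proof (ew_le1 mu (site v - z) ltac:(lra)). pose proof (ew_pos mu (site v - z)). nra. }
      set (Bhop := Bk * SS (M - mu') * A) in *.
      rewrite (diff_scal w (eps u) (fun x => homot z x (proj z F u)) (D * (A * pcst * ew mu (site u - z)))).
      2:{ intros x Hx. rewrite Hw in Hx. eapply Rle_trans; [apply (HDb z _ _ HA' HP x Hx)|].
          pose proof (spread_le1 z mu x ltac:(lra)). pose proof (spread_pos z mu x).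
          assert (0 <= D * (A * pcst * ew mu (site u - z))) by (apply Rmult_le_pos; lra). nra. }
      rewrite (IH (A * pcst * ew mu (site u - z)) (proj z F u) HA' HP); [|clear w Hw|clear w Hw|assumption].
      * unfold proj. transitivity (Cplus (conv_op (hop z (fun t => F (t :: w))) u) (Cmult (Cmult (eps u) (eps u)) (Cminus (F (u :: w)) (conv_op (hop z (fun t => F (t :: w))) u)))).
        -- ring.
        -- rewrite eps_sq. ring.
      (* The projected function is again closed: by [Hhd], read at excited letters, whose sign is
         opposite to that of u, both of its terms have the same tail differential. *)
      * intros w Hw. unfold proj, Cminus.
        rewrite (diff_ext w _ (fun x => Cplus (F (u :: x)) (Cmult (Copp (RtoC 1)) (conv_op (hop z (fun t => F (t :: x))) u)))) by (intros; ring).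
        assert (Hcb : bdd (length w) (Ac * Bhop * SS M0) (fun x => conv_op (hop z (fun t => F (t :: x))) u)).
        { intros x Hx. apply cop_bound. intros k. apply Hhb. lia. }
        rewrite (diff_plus w (fun x => F (u :: x)) _ (A + Ac * Bhop * SS M0)).
        -- rewrite (diff_scal w _ _ _ Hcb).
           assert (Hdc : deriv w (fun x => conv_op (hop z (fun t => F (t :: x))) u) = conv_op (fun t => deriv w (fun x => hop z (fun s => F (s :: x)) t)) u).
           { apply (diff_cop w (fun x => match x with t :: y => hop z (fun s => F (s :: y)) t | [] => RtoC 0 end) u Bhop).
             intros [|t y] Hy; [discriminate|]. apply Hhb. simpl in Hy. lia. }
           rewrite Hdc, (HDc w Hw u).
           rewrite (cop_ext (fun t => deriv w (fun x => hop z (fun s => F (s :: x)) t)) (fun t => Cmult (Copp (eps u)) (F (t :: w)))).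
           ++ rewrite (cop_scal _ (fun t => F (t :: w)) u A) by (intros; apply HB; simpl; lia). ring.
           ++ intros k. rewrite (Hhd w Hw (excite u k) (exc_excite u k)), eps_excite by assumption. reflexivity.
        -- intros x Hx. pose proof (Hcb x Hx). pose proof (Cmod_ge_0 (conv_op (hop z (fun t => F (t :: x))) u)).
           assert (Cmod (F (u :: x)) <= A) by (apply HB; simpl; lia). lra.
        -- intros x Hx. rewrite Cmod_mult, Cmod_opp, Cmod_1, Rmult_1_l. pose proof (Hcb x Hx). lra.
      (* Lowering the first letter leaves a word of ground letters, so the correction term vanishes
         together with F. *)
      * intros w Hw Hg. unfold proj. rewrite H0 by (simpl; rewrite ?Eu; auto).
        rewrite (cop_ext _ (fun t => Cmult (RtoC 0) (RtoC 0))).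
        -- rewrite (cop_scal (RtoC 0) (fun _ => RtoC 0) u 0) by (intros; rewrite Cmod_0; lra). ring.
        -- intros k. transitivity (hop z (fun t => Cmult (RtoC 0) (RtoC 0)) (excite u k)).
           ++ apply hop_ext. intros l. rewrite H0; [ring|simpl; lia|]. simpl. now rewrite exc_lower.
           ++ rewrite (hop_scal z (RtoC 0) (fun _ => RtoC 0) _ 0); [ring|lra|]. intros; rewrite Cmod_0; lra.
Qed.
End Homotopy.
End Complex.

(** * The pair of one-sided inverse kernels *)

Lemma edom_conv c A M d B x t : 0 <= x < M -> 0 <= B -> (forall k, Cmod (c k) <= A * ew M k) ->
  (forall k, Cmod (d k) <= B * exp (- x * IZR k)) -> edom (fun j => Cmult (c j) (d (t - j)%Z)).
Proof.
  intros Hx HB Hc Hd. apply (edom_at _ (A * B * exp (- x * IZR t)) (M - x) 0); [lra|]. intros j. rewrite Z.sub_0_r.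
  assert (HA : 0 <= A) by (apply (dom_ge0 (Cmod (c 0%Z)) A (ew M 0)); [apply Cmod_ge_0|apply ew_pos|apply Hc]).
  rewrite Cmod_mult.
  eapply Rle_trans; [apply Rmult_le_compat; [apply Cmod_ge_0|apply Cmod_ge_0|apply Hc|apply Hd]|].
  replace (exp (- x * IZR (t - j))) with (exp (- x * IZR t) * exp (IZR j * x)) by (rewrite <- exp_plus, minus_IZR; f_equal; ring).
  replace (A * ew M j * (B * (exp (- x * IZR t) * exp (IZR j * x)))) with (A * B * exp (- x * IZR t) * (ew M j * exp (IZR j * x))) by ring.
  pose proof (exp_pos (- x * IZR t)).
  apply Rmult_le_compat_l; [pos|]. replace M with ((M - x) + x) at 1 by ring. rewrite <- ew_mul, Rmult_assoc.
  rewrite <- (Rmult_1_r (ew (M - x) j)) at 2. apply Rmult_le_compat_l; [left; apply ew_pos|].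
  rewrite Rmult_comm. apply exp_ew. rewrite Rabs_right; lra.
Qed.

(** A bound e^(x1 (k - x)) factors as e^(x1 (k - z)) e^(-x1 (x - z)); for x right of z the last
    factor is decay and the first grows at most at rate x1. The other kernel is the mirror image. *)
Lemma inverse_kernels nabla A0 M0 e : 0 < M0 -> (forall k, Cmod (nabla k) <= A0 * ew M0 k) ->
  (exists k, nabla k <> RtoC 0) -> 0 < e ->
  exists dp dm mu mu' Bh, 0 < mu <= mu' /\ mu' < e /\
   (forall z x k, (z <= x)%Z -> Cmod (dp (k - x)%Z) <= Bh * ew mu (x - z) * / ew mu' (k - z)) /\
   (forall z x k, (x <= z)%Z -> Cmod (dm (k - x)%Z) <= Bh * ew mu (x - z) * / ew mu' (k - z)) /\
   (forall x l, zsum (fun k => Cmult (dp (k - x)%Z) (nabla (l - k)%Z)) = if Z.eqb l x then RtoC 1 else RtoC 0) /\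
   (forall x l, zsum (fun k => Cmult (dm (k - x)%Z) (nabla (l - k)%Z)) = if Z.eqb l x then RtoC 1 else RtoC 0).
Proof.
  intros HM0 Hn [k0 Hk0] He.
  assert (Hem : 0 < Rmin e M0) by (apply Rmin_glb_lt; lra).
  pose proof (Rmin_l e M0) as Hel. pose proof (Rmin_r e M0) as Her.
  (* Reflection of the sequence exchanges the circles of radius e^x and e^(-x), so one statement
     about radii above 1 yields both kernels. *)
  destruct (convolution_inverse (fun k => nabla (- k)%Z) A0 M0 (Rmin e M0) HM0) as (x1 & d1 & B1 & Hx1 & Hd1 & Hc1); auto.
  { intros k. rewrite <- (ew_opp M0 k). apply Hn. }
  { exists (- k0)%Z. now rewrite Z.opp_involutive. }
  destruct (convolution_inverse nabla A0 M0 (Rmin e M0) HM0) as (x2 & d2 & B2 & Hx2 & Hd2 & Hc2); auto.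
  { now exists k0. }
  assert (HB1 : 0 <= B1) by (apply (dom_ge0 (Cmod (d1 0%Z)) B1 (exp (- x1 * IZR 0))); [apply Cmod_ge_0|apply exp_pos|apply Hd1]).
  assert (HB2 : 0 <= B2) by (apply (dom_ge0 (Cmod (d2 0%Z)) B2 (exp (- x2 * IZR 0))); [apply Cmod_ge_0|apply exp_pos|apply Hd2]).
  assert (G : forall B x t s, 0 <= B <= Rmax B1 B2 -> 0 < x -> Rmin x1 x2 <= x -> forall x', Rabs x' <= Rmax x1 x2 ->
     B * (ew x t * exp (IZR s * x')) <= Rmax B1 B2 * ew (Rmin x1 x2) t * / ew (Rmax x1 x2) s).
  { intros B x t s HB Hx Hx0 x' Hx'. rewrite Rmult_assoc.
    pose proof (ew_pos x t). pose proof (exp_pos (IZR s * x')).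
    apply Rmult_le_compat; [lra|left; apply Rmult_lt_0_compat; assumption|lra|].
    apply Rmult_le_compat; [lra|lra|now apply ew_mono|now apply exp_le_ew]. }
  (* The smaller of the two rates is common to both decays in x - z, the larger one covers both
     growths in k - z. *)
  exists (fun t => d1 (- t)%Z), d2, (Rmin x1 x2), (Rmax x1 x2), (Rmax B1 B2).
  split; [split; [apply Rmin_glb_lt; lra|eapply Rle_trans; [apply Rmin_l|apply Rmax_l]]|].
  split; [apply Rmax_lub_lt; lra|]. split; [|split; [|split]].
  - intros z x k Hz. eapply Rle_trans; [apply Hd1|].
    replace (exp (- x1 * IZR (- (k - x)))) with (ew x1 (x - z) * exp (IZR (k - z) * x1)).
    + apply G; [split; [assumption|apply Rmax_l]|lra|apply Rmin_l|]. rewrite Rabs_right by lra. apply Rmax_l.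
    + unfold ew. rewrite <- exp_plus, Z.abs_eq by lia. f_equal. rewrite opp_IZR, !minus_IZR. ring.
  - intros z x k Hz. eapply Rle_trans; [apply Hd2|].
    replace (exp (- x2 * IZR (k - x))) with (ew x2 (x - z) * exp (IZR (k - z) * - x2)).
    + apply G; [split; [assumption|apply Rmax_r]|lra|apply Rmin_r|]. rewrite Rabs_left by lra. rewrite Ropp_involutive. apply Rmax_r.
    + unfold ew. rewrite <- exp_plus, Z.abs_neq by lia. f_equal. rewrite opp_IZR, !minus_IZR. ring.
  - intros x l.
    assert (Ea : edom (fun j => Cmult (nabla (- j)%Z) (d1 (x - l - j)%Z))).
    { apply (edom_conv _ A0 M0 _ B1 x1); [lra|lra| |assumption]. intros k. rewrite <- (ew_opp M0 k). apply Hn. }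
    specialize (Hc1 (x - l)%Z). rewrite <- (zsum_shift _ (- l) Ea) in Hc1.
    rewrite (zsum_ext _ (fun k => Cmult (nabla (- (k + - l))%Z) (d1 (x - l - (k + - l))%Z))).
    + rewrite Hc1. destruct (Z.eqb_spec (x - l) 0), (Z.eqb_spec l x); try lia; reflexivity.
    + intros k. rewrite Cmult_comm. f_equal; f_equal; lia.
  - intros x l.
    assert (Ea : edom (fun j => Cmult (nabla j) (d2 (l - x - j)%Z))).
    { apply (edom_conv _ A0 M0 _ B2 x2); [lra|lra|assumption|assumption]. }
    specialize (Hc2 (l - x)%Z). rewrite <- zsum_neg in Hc2. apply edom_neg in Ea.
    rewrite <- (zsum_shift _ (- l) Ea) in Hc2.
    rewrite (zsum_ext _ (fun k => Cmult (nabla (- (k + - l))%Z) (d2 (l - x - - (k + - l))%Z))).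
    + rewrite Hc2. destruct (Z.eqb_spec (l - x) 0), (Z.eqb_spec l x); try lia; reflexivity.
    + intros k. rewrite Cmult_comm. f_equal; f_equal; lia.
Qed.

(** * Exactness on words with at least two excited letters *)

Fixpoint exc_count (w : list lvar) : nat :=
  match w with [] => 0 | u :: w' => (if exc u then 1 else 0) + exc_count w' end.

Lemma exc_count_ground w : forallb (fun u => negb (exc u)) w = true -> exc_count w = 0%nat.
Proof.
  induction w as [|u w IH]; [reflexivity|]. simpl. intros H. apply andb_prop in H. destruct H as [H1 H2].
  rewrite IH by assumption. now destruct (exc u).
Qed.

Definition on_head (b : bool) (f : lvar -> list lvar -> C) (w : list lvar) : C :=
  match w with u :: w' => if Bool.eqb (exc u) b then f u w' else RtoC 0 | [] => RtoC 0 end.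

(** Decay about the site of the first letter, a reference that shifts with the word. *)
Definition head_bdd (A M : R) (m : nat) (f : list lvar -> C) : Prop :=
  forall u w, length w = m -> Cmod (f (u :: w)) <= A * spread (site u) M w.

Definition sh_inv (n : nat) (f : list lvar -> C) : Prop := forall w, length w = n -> f (map sh w) = f w.

Lemma head_bdd_bdd A M m f : 0 <= A -> 0 <= M -> head_bdd A M m f -> bdd (S m) A f.
Proof.
  intros HA HM H [|u w] Hw; [discriminate|]. injection Hw as Hw. eapply Rle_trans; [now apply H|].
  pose proof (spread_le1 (site u) M w HM). pose proof (spread_pos (site u) M w). nra.
Qed.

Section Exact.
Variables (nabla : Z -> C) (a1 a2 : C) (A0 M0 : R).
Hypotheses (Ha1 : a1 <> RtoC 0) (Ha2 : a2 <> RtoC 0) (HM0 : 0 < M0).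
Hypothesis Hnabla : forall k, Cmod (nabla k) <= A0 * ew M0 k.
Hypothesis Hnz : exists k, nabla k <> RtoC 0.

Notation cop := (conv_op nabla a1 a2).
Notation diff := (deriv nabla a1 a2).

(** The homotopy acts on the tail with the site of the head as z, which restores translation
    invariance. The factor [eps u] anticipates the sign with which the differential reaches the
    tail. The vanishing of g on ground tails is recorded for the second round in [diff_exact]. *)
Lemma tail_exact b m f A M : 0 <= A -> 0 < M -> head_bdd A M m f -> sh_inv (S m) f ->
  (forall u w, exc u = b -> length w = m -> diff w (fun x => f (u :: x)) = RtoC 0) ->
  (forall u w, exc u = b -> length w = m -> forallb (fun v => negb (exc v)) w = true -> f (u :: w) = RtoC 0) ->
  exists g B mu, 0 <= B /\ 0 < mu < M /\ head_bdd B mu m (on_head b g) /\ sh_inv (S m) (on_head b g) /\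
    (forall u w, exc u = b -> length w = m -> diff w (g u) = Cmult (eps u) (f (u :: w))) /\
    (forall u w, forallb (fun v => negb (exc v)) w = true -> g u w = RtoC 0).
Proof.
  intros HA HM Hf Hs Hd Hg.
  assert (He : 0 < Rmin M M0) by (apply Rmin_glb_lt; assumption).
  destruct (inverse_kernels nabla A0 M0 (Rmin M M0) HM0 Hnabla Hnz He) as (dp & dm & mu & mu' & Bh & Hmu & Hmu' & Hdp & Hdm & Hdp1 & Hdm1).
  pose proof (Rmin_l M M0). pose proof (Rmin_r M M0).
  assert (HM0' : mu' < M0) by lra. assert (HM' : mu' < M) by lra.
  destruct (homot_bound nabla a1 a2 A0 M0 Hnabla dp dm mu mu' Bh Hmu HM0' Hdp Hdm M HM' m) as (D & HD & Hb).
  pose proof (homot_sh nabla a1 a2 A0 M0 HM0 Hnabla dp dm mu mu' Bh Hmu HM0' Hdp Hdm M HM') as Hsh.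
  pose proof (diff_homot nabla a1 a2 A0 M0 Ha1 Ha2 HM0 Hnabla dp dm mu mu' Bh Hmu HM0' Hdp Hdm Hdp1 Hdm1 M HM') as Hh.
  set (K := homot nabla a1 a2 dp dm) in *.
  assert (Hr : forall u, rbd M (site u) A m (fun x => f (u :: x))) by (intros u w Hw; now apply Hf).
  assert (HB : bdd (S m) A f) by (apply (head_bdd_bdd A M); [assumption|lra|assumption]).
  exists (fun u w => Cmult (eps u) (K (site u) w (fun x => f (u :: x)))), (D * A), mu.
  split; [apply Rmult_le_pos; assumption|]. split; [lra|]. split; [|split; [|split]].
  - intros u w Hw. simpl. destruct (Bool.eqb (exc u) b).
    + rewrite Cmod_mult, Cmod_eps, Rmult_1_l. now apply Hb.
    + rewrite Cmod_0. pose proof (spread_pos (site u) mu w). apply Rmult_le_pos; [apply Rmult_le_pos; assumption|lra].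
  - intros [|u w] Hw; [reflexivity|]. injection Hw as Hw. cbn [map on_head]. rewrite exc_sh.
    destruct (Bool.eqb (exc u) b); [|reflexivity]. rewrite eps_sh, site_sh. f_equal.
    assert (E : forall x, length x = m -> f (sh u :: map sh x) = f (u :: x)).
    { intros x Hx. apply (Hs (u :: x)). simpl; lia. }
    rewrite (Hsh (site u) m A (fun x => f (sh u :: x)) HA).
    + apply homot_ext. intros x Hx. apply E. lia.
    + intros x Hx. rewrite E by assumption. now apply Hr.
    + assumption.
  - intros u w Hu Hw.
    rewrite (diff_scal nabla a1 a2 A0 M0 HM0 Hnabla w (eps u) (fun x => K (site u) x (fun x => f (u :: x))) (D * A)).
    + f_equal. apply (Hh m (site u) A (fun x => f (u :: x)) HA (Hr u)); auto.
    + intros x Hx. rewrite Hw in Hx. eapply Rle_trans; [apply (Hb (site u) A _ HA (Hr u) x Hx)|].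
      pose proof (spread_le1 (site u) mu x ltac:(lra)). pose proof (spread_pos (site u) mu x).
      assert (0 <= D * A) by (apply Rmult_le_pos; assumption). nra.
  - intros u w Hw. unfold K. rewrite homot_ground by assumption. ring.
Qed.

(** Convolution in the head moves the reference site, which by [spread_move] costs mu for each of
    the m tail letters; this must stay below the rate [M0] of [nabla]. *)
Lemma cop_head_bdd B mu m g u w : 0 <= B -> 0 <= mu -> mu * INR m < M0 -> head_bdd B mu m g -> length w = m ->
  Cmod (cop (fun t => g (t :: w)) u) <= (Cmod a1 + Cmod a2) * A0 * B * SS (M0 - mu * INR m) * spread (site u) mu w.
Proof.
  intros HB Hmu Hm Hg Hw.
  set (Ac := (Cmod a1 + Cmod a2) * A0).
  assert (HAc : 0 <= Ac) by (apply (Ac_ge0 nabla a1 a2 A0 M0 Hnabla)).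
  replace (Ac * B * SS (M0 - mu * INR m) * spread (site u) mu w) with (Ac * B * spread (site u) mu w * SS (M0 - mu * INR m)) by ring.
  apply (zsum_le_at _ _ (M0 - mu * INR m) (site u)); [lra|]. intros k. rewrite Cmod_mult.
  eapply Rle_trans; [apply Rmult_le_compat; [apply Cmod_ge_0|apply Cmod_ge_0|apply (ckern_bound nabla a1 a2 A0 M0 Hnabla)|apply Hg, Hw]|].
  fold Ac. rewrite site_excite.
  pose proof (spread_move k (site u) mu w Hmu) as T. rewrite Hw in T.
  replace M0 with ((M0 - mu * INR m) + mu * INR m) at 1 by ring. rewrite <- ew_mul.
  pose proof (ew_pos (M0 - mu * INR m) (k - site u)).
  replace (Ac * (ew (M0 - mu * INR m) (k - site u) * ew (mu * INR m) (k - site u)) * (B * spread k mu w))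
    with (Ac * B * ew (M0 - mu * INR m) (k - site u) * (spread k mu w * ew (mu * INR m) (k - site u))) by ring.
  replace (Ac * B * spread (site u) mu w * ew (M0 - mu * INR m) (k - site u))
    with (Ac * B * ew (M0 - mu * INR m) (k - site u) * spread (site u) mu w) by ring.
  apply Rmult_le_compat_l; [|assumption]. pos.
Qed.

(** An excited head is untouched by the differential, so there closedness concerns the tail alone
    and [tail_exact] gives [G1]. On ground heads [G1] enters through the convolution in the head;
    the remainder [f2] is closed in the tail, and [tail_exact] gives [G2]. As [G2] vanishes on
    excited heads, it does not disturb the first round. *)
Lemma diff_exact n f A M : 0 <= A -> 0 < M -> (forall m, n = S m -> head_bdd A M m f) -> sh_inv n f ->
  (forall w, length w = n -> diff w f = RtoC 0) -> (forall w, length w = n -> (exc_count w < 2)%nat -> f w = RtoC 0) ->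
  exists g B mu, 0 <= B /\ 0 < mu /\ (forall m, n = S m -> head_bdd B mu m g) /\ sh_inv n g /\
    forall w, length w = n -> diff w g = f w.
Proof.
  intros HA HM Hf Hs Hd H0. destruct n as [|m].
  { exists (fun _ => RtoC 0), 0, 1. split; [lra|]. split; [lra|]. split; [discriminate|]. split; [intros w _; reflexivity|].
    intros [|u w] Hw; [|discriminate]. symmetry. now apply H0; [|simpl; lia]. }
  specialize (Hf m eq_refl).
  assert (HB : bdd (S m) A f) by (apply (head_bdd_bdd A M); [assumption|lra|assumption]).
  destruct (tail_exact true m f A M HA HM Hf Hs) as (g1 & B1 & mu1 & HB1 & Hmu1 & Hb1 & Hs1 & Hd1 & Hg1).
  { intros u w Hu Hw. pose proof (Hd (u :: w) ltac:(simpl; lia)) as E. simpl in E. rewrite cop_exc in E by assumption.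
    replace (diff w (fun x => f (u :: x))) with (Cmult (Cmult (eps u) (eps u)) (diff w (fun x => f (u :: x)))) by (rewrite eps_sq; ring).
    replace (Cmult (Cmult (eps u) (eps u)) (diff w (fun x => f (u :: x)))) with (Cmult (eps u) (Cplus (RtoC 0) (Cmult (eps u) (diff w (fun x => f (u :: x)))))) by ring.
    rewrite E. ring. }
  { intros u w Hu Hw Hgr. apply H0; [simpl; lia|]. simpl. rewrite Hu, exc_count_ground by assumption. lia. }
  set (G1 := on_head true g1) in *.
  (* Small enough for [cop_head_bdd]: m times this rate is below [M0]. *)
  set (mu2 := Rmin mu1 (M0 / (INR m + 1))).
  assert (Hm : 0 <= INR m) by apply pos_INR.
  assert (Hmu2 : 0 < mu2 <= mu1).
  { split; [apply Rmin_glb_lt; [lra|apply Rdiv_lt_0_compat; lra]|apply Rmin_l]. }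
  assert (Hmu2m : mu2 * INR m < M0).
  { apply Rle_lt_trans with (M0 / (INR m + 1) * INR m); [apply Rmult_le_compat_r; [lra|apply Rmin_r]|].
    apply (Rmult_lt_reg_r (INR m + 1)); [lra|]. replace (M0 / (INR m + 1) * INR m * (INR m + 1)) with (M0 * INR m) by (field; lra). nra. }
  assert (Hb1' : head_bdd B1 mu2 m G1).
  { intros u w Hw. eapply Rle_trans; [now apply Hb1|]. apply Rmult_le_compat_l; [assumption|apply spread_mono; lra]. }
  assert (HG1 : bdd (S m) B1 G1) by (apply (head_bdd_bdd B1 mu2); [assumption|lra|assumption]).
  (* What remains on ground heads after the contribution of [G1] through the head letter is
     removed. *)
  set (f2 := on_head false (fun u w => Cminus (f (u :: w)) (cop (fun t => G1 (t :: w)) u))).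
  set (A2 := A + (Cmod a1 + Cmod a2) * A0 * B1 * SS (M0 - mu2 * INR m)).
  pose proof (Ac_ge0 nabla a1 a2 A0 M0 Hnabla) as HAc. pose proof (SS_ge1 (M0 - mu2 * INR m) ltac:(lra)) as HSS.
  assert (HA2 : 0 <= A2).
  { unfold A2. assert (0 <= (Cmod a1 + Cmod a2) * A0 * B1 * SS (M0 - mu2 * INR m)); [|lra].
    apply Rmult_le_pos; [apply Rmult_le_pos|]; lra. }
  assert (Hb2 : head_bdd A2 mu2 m f2).
  { intros u w Hw. unfold f2; cbn [on_head]. pose proof (spread_pos (site u) mu2 w). destruct (Bool.eqb (exc u) false).
    - unfold Cminus. eapply Rle_trans; [apply Cmod_triangle|]. rewrite Cmod_opp. unfold A2. rewrite Rmult_plus_distr_r.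
      apply Rplus_le_compat.
      + eapply Rle_trans; [now apply Hf|]. apply Rmult_le_compat_l; [assumption|apply spread_mono; lra].
      + apply (cop_head_bdd B1 mu2 m G1 u w); auto; lra.
    - rewrite Cmod_0. apply Rmult_le_pos; lra. }
  assert (Hs2 : sh_inv (S m) f2).
  { intros [|u w] Hw; [reflexivity|]. unfold f2. cbn [map on_head]. rewrite exc_sh.
    destruct (Bool.eqb (exc u) false); [|reflexivity]. f_equal; [apply (Hs (u :: w) Hw)|].
    injection Hw as Hw.
    assert (E : forall v, G1 (sh v :: map sh w) = G1 (v :: w)) by (intros v; apply (Hs1 (v :: w)); simpl; lia).
    rewrite (cop_sh nabla a1 a2 A0 M0 HM0 Hnabla (fun t => G1 (t :: map sh w)) u B1).
    - apply cop_ext. intros k. apply E.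
    - intros k. rewrite E. apply HG1. simpl; lia. }
  destruct (tail_exact false m f2 A2 mu2 HA2 (proj1 Hmu2) Hb2 Hs2) as (g2 & B2 & mu3 & HB2 & Hmu3 & Hb3 & Hs3 & Hd3 & Hg3).
  (* By construction of [g1] the tail differential of the subtracted term is the convolution of f in
     the head, with the sign of an excited head, opposite to that of u; the sum is then a multiple
     of the full differential of f. *)
  { intros u w Hu Hw.
    assert (Hcb : forall t, (forall x, length x = length w -> Cmod (G1 (t :: x)) <= B1)) by (intros; apply HG1; simpl; lia).
    rewrite (diff_ext nabla a1 a2 w _ (fun x => Cplus (f (u :: x)) (Cmult (Copp (RtoC 1)) (cop (fun t => G1 (t :: x)) u))))
      by (intros; unfold f2; cbn [on_head]; rewrite Hu; cbn [Bool.eqb]; ring).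
    assert (Hcop : bdd (length w) ((Cmod a1 + Cmod a2) * A0 * B1 * SS M0) (fun x => cop (fun t => G1 (t :: x)) u)).
    { intros x Hx. apply (cop_bound nabla a1 a2 A0 M0 HM0 Hnabla). intros k. now apply Hcb. }
    rewrite (diff_plus nabla a1 a2 A0 M0 HM0 Hnabla w (fun x => f (u :: x)) _ (A + (Cmod a1 + Cmod a2) * A0 * B1 * SS M0)).
    - rewrite (diff_scal nabla a1 a2 A0 M0 HM0 Hnabla w _ _ _ Hcop).
      rewrite (diff_cop nabla a1 a2 A0 M0 HM0 Hnabla w G1 u B1) by (now rewrite Hw).
      rewrite (cop_ext nabla a1 a2 (fun t => diff w (fun x => G1 (t :: x))) (fun t => Cmult (Copp (eps u)) (f (t :: w)))).
      + rewrite (cop_scal nabla a1 a2 A0 M0 HM0 Hnabla _ (fun t => f (t :: w)) u A) by (intros; apply HB; simpl; lia).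
        pose proof (Hd (u :: w) ltac:(simpl; lia)) as E. simpl in E.
        set (P := cop (fun t => f (t :: w)) u) in *. set (Q := diff w (fun x => f (u :: x))) in *.
        replace Q with (Cmult (Cmult (eps u) (eps u)) Q) by (rewrite eps_sq; ring).
        replace (Cplus (Cmult (Cmult (eps u) (eps u)) Q) (Cmult (Copp (RtoC 1)) (Cmult (Copp (eps u)) P)))
          with (Cmult (eps u) (Cplus P (Cmult (eps u) Q))) by ring.
        rewrite E. ring.
      + intros k. unfold G1. simpl. rewrite exc_excite. simpl.
        rewrite (diff_ext nabla a1 a2 w _ (g1 (excite u k))) by reflexivity.
        rewrite Hd1 by auto using exc_excite. now rewrite eps_excite by assumption.
    - intros x Hx. assert (Cmod (f (u :: x)) <= A) by (apply HB; simpl; lia).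
      assert (0 <= (Cmod a1 + Cmod a2) * A0 * B1 * SS M0); [|lra].
      pose proof (SS_ge1 M0 HM0). apply Rmult_le_pos; [apply Rmult_le_pos|]; lra.
    - intros x Hx. rewrite Cmod_mult, Cmod_opp, Cmod_1, Rmult_1_l. pose proof (Hcop x Hx) as Q. cbv beta in Q. lra. }
  (* No letter of the word is excited, so f vanishes; the convolution excites only the head, and
     [g1] vanishes on ground tails. *)
  { intros u w Hu Hw Hgr. unfold f2; cbn [on_head]. rewrite Hu; cbn [Bool.eqb].
    rewrite H0; [|simpl; lia|simpl; rewrite Hu, exc_count_ground by assumption; simpl; lia].
    assert (E : cop (fun t => G1 (t :: w)) u = RtoC 0).
    { apply zsum_0. intros k. unfold G1; simpl. rewrite exc_excite; simpl. rewrite Hg1 by assumption. ring. }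
    rewrite E. ring. }
  set (G2 := on_head false g2) in *.
  assert (HG2 : bdd (S m) B2 G2) by (apply (head_bdd_bdd B2 mu3); [assumption|lra|assumption]).
  exists (fun w => Cplus (G1 w) (G2 w)), (B1 + B2), mu3.
  split; [lra|]. split; [lra|]. split; [|split].
  - intros m' Hm'. injection Hm' as <-. intros u w Hw. eapply Rle_trans; [apply Cmod_triangle|].
    rewrite Rmult_plus_distr_r. apply Rplus_le_compat; [|now apply Hb3].
    eapply Rle_trans; [now apply Hb1'|]. apply Rmult_le_compat_l; [assumption|apply spread_mono; lra].
  - intros w Hw. now rewrite Hs1, Hs3.
  - intros w Hw.
    rewrite (diff_plus nabla a1 a2 A0 M0 HM0 Hnabla w G1 G2 (B1 + B2)).
    2:{ intros x Hx. rewrite Hw in Hx. pose proof (HG1 x Hx). lra. }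
    2:{ intros x Hx. rewrite Hw in Hx. pose proof (HG2 x Hx). lra. }
    destruct w as [|u w]; [discriminate|]. injection Hw as Hw.
    assert (HS : forall F, diff (u :: w) F = Cplus (cop (fun t => F (t :: w)) u) (Cmult (eps u) (diff w (fun x => F (u :: x))))) by reflexivity.
    rewrite !HS.
    assert (E2 : cop (fun t => G2 (t :: w)) u = RtoC 0).
    { apply zsum_0. intros k. unfold G2; simpl. rewrite exc_excite; simpl. ring. }
    rewrite E2. destruct (exc u) eqn:Eu.
    + rewrite cop_exc by assumption.
      rewrite (diff_ext nabla a1 a2 w (fun x => G1 (u :: x)) (g1 u)) by (intros; unfold G1; cbn [on_head]; now rewrite Eu).
      rewrite (diff_0 nabla a1 a2 A0 M0 HM0 Hnabla w (fun x => G2 (u :: x))) by (intros; unfold G2; cbn [on_head]; now rewrite Eu).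
      rewrite (Hd1 u w Eu Hw).
      transitivity (Cmult (Cmult (eps u) (eps u)) (f (u :: w))); [ring|]. rewrite eps_sq; ring.
    + rewrite (diff_ext nabla a1 a2 w (fun x => G2 (u :: x)) (g2 u)) by (intros; unfold G2; cbn [on_head]; now rewrite Eu).
      rewrite (diff_0 nabla a1 a2 A0 M0 HM0 Hnabla w (fun x => G1 (u :: x))) by (intros; unfold G1; cbn [on_head]; now rewrite Eu).
      rewrite (Hd3 u w Eu Hw).
      unfold f2; cbn [on_head]. rewrite Eu; cbn [Bool.eqb].
      transitivity (Cplus (cop (fun t => G1 (t :: w)) u) (Cmult (Cmult (eps u) (eps u)) (Cminus (f (u :: w)) (cop (fun t => G1 (t :: w)) u)))); [ring|].
      rewrite eps_sq; ring.
Qed.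
End Exact.

(** * Local coefficients as decaying functions on words *)

(** Locality restricts coefficients only at large separations; at small ones, after a translation,
    finitely many values remain. *)
Lemma bounded_box n (K : Z) (G : list Z -> C) :
  exists A, forall l, length l = n -> List.Forall (fun x => (Z.abs x <= K)%Z) l -> Cmod (G l) <= A.
Proof.
  revert G. induction n as [|n IH]; intros G.
  - exists (Cmod (G [])). intros [|] Hl _; [lra|discriminate].
  - assert (Hx : forall x, exists A, forall l, length l = n -> List.Forall (fun x => (Z.abs x <= K)%Z) l -> Cmod (G (x :: l)) <= A).
    { intros x. apply (IH (fun l => G (x :: l))). }
    assert (Hm : forall m, exists A, forall x l, (- K <= x < - K + Z.of_nat m)%Z -> length l = n ->
      List.Forall (fun x => (Z.abs x <= K)%Z) l -> Cmod (G (x :: l)) <= A).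
    { induction m as [|m [A HA]].
      - exists 0. intros; lia.
      - destruct (Hx (- K + Z.of_nat m)%Z) as [A' HA']. exists (Rmax A A'). intros x l Hr Hl Hf.
        destruct (Z.eq_dec x (- K + Z.of_nat m)) as [->|].
        + eapply Rle_trans; [now apply HA'|apply Rmax_r].
        + eapply Rle_trans; [apply HA; auto; lia|apply Rmax_l]. }
    destruct (Hm (Z.to_nat (2 * K + 1))) as [A HA]. exists A. intros [|x l] Hl Hf; [discriminate|].
    inversion Hf; subst. apply HA; auto; lia.
Qed.

Lemma tilc_shift n Cf : TILC n Cf -> forall t l, length l = n -> Cf (map (Z.add t) l) = Cf l.
Proof.
  intros [H _].
  assert (Hp : forall m l, length l = n -> Cf (map (Z.add (Z.of_nat m)) l) = Cf l).
  { induction m as [|m IH]; intros l Hl.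
    - simpl. f_equal. rewrite <- (map_id l) at 2. apply map_ext. intros; lia.
    - rewrite <- (IH l Hl), <- (H (map (Z.add (Z.of_nat m)) l)) by now rewrite length_map.
      f_equal. rewrite map_map. apply map_ext. intros; lia. }
  intros t l Hl. destruct (Z_le_gt_dec 0 t).
  - rewrite <- (Hp (Z.to_nat t) l Hl). f_equal. apply map_ext. intros; lia.
  - rewrite <- (Hp (Z.to_nat (- t)) (map (Z.add t) l)) by now rewrite length_map.
    f_equal. rewrite map_map. rewrite <- (map_id l) at 2. apply map_ext. intros; lia.
Qed.

Lemma tilc_bound n Cf : TILC n Cf -> exists A M, 0 <= A /\ 0 < M /\
  forall l, length l = n -> forall x, In x l -> Cmod (Cf l) <= A * ew M (hd 0%Z l - x).
Proof.
  intros HT. pose proof (tilc_shift n Cf HT) as Hs. destruct HT as [_ (L & M & K & HL & HM & HK)].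
  set (Kz := Z.max 0 (up K)).
  assert (HKz : forall t, K < IZR (Z.abs t) \/ (Z.abs t <= Kz)%Z).
  { intros t. destruct (Rlt_dec K (IZR (Z.abs t))) as [|Hn]; [now left|right].
    pose proof (archimed K) as [Hu _]. assert (IZR (Z.abs t) < IZR (up K)) by lra. apply lt_IZR in H. unfold Kz; lia. }
  destruct (bounded_box n Kz Cf) as [A HA].
  set (B := Rmax L A).
  assert (HB : 0 < B) by (eapply Rlt_le_trans; [exact HL|apply Rmax_l]).
  assert (Hall : forall l, length l = n -> Cmod (Cf l) <= B).
  { intros l Hl. destruct (classic (exists i, (1 <= i < n)%nat /\ K < IZR (Z.abs (nth 0 l 0%Z - nth i l 0%Z)))) as [(i & Hi & HKi)|Hn].
    - eapply Rle_trans; [left; now apply (HK l Hl i)|].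
      eapply Rle_trans; [|apply Rmax_l]. rewrite <- (Rmult_1_r L) at 2. apply Rmult_le_compat_l; [lra|].
      apply (ew_le1 M (nth 0 l 0%Z - nth i l 0%Z)). lra.
    - rewrite <- (Hs (- nth 0 l 0)%Z l Hl). eapply Rle_trans; [apply HA|apply Rmax_r].
      + now rewrite length_map.
      + apply List.Forall_forall. intros y Hy. apply in_map_iff in Hy. destruct Hy as (x & <- & Hx).
        destruct (In_nth l x 0%Z Hx) as (i & Hi & <-).
        destruct i as [|i].
        * replace (- nth 0 l 0 + nth 0 l 0)%Z with 0%Z by lia. unfold Kz; lia.
        * destruct (HKz (nth 0 l 0 - nth (S i) l 0)%Z) as [Hk|Hk]; [|lia].
          exfalso. apply Hn. exists (S i). split; [lia|assumption]. }
  (* The exponential compensates the weight at distances up to [Kz], where only the plain bound [B]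
     is at hand. *)
  exists (B * exp (M * IZR Kz)), M.
  assert (HE : 1 <= exp (M * IZR Kz)).
  { rewrite <- exp_0. apply exp_le. apply Rmult_le_pos; [lra|]. apply IZR_le. unfold Kz; lia. }
  split; [apply Rmult_le_pos; lra|]. split; [assumption|].
  intros l Hl x Hx. destruct (In_nth l x 0%Z Hx) as (i & Hi & <-).
  replace (hd 0%Z l) with (nth 0 l 0%Z) by now destruct l.
  destruct (HKz (nth 0 l 0 - nth i l 0)%Z) as [Hk|Hk].
  - destruct i as [|i].
    + rewrite Z.sub_diag, ew_0. specialize (Hall l Hl). nra.
    + eapply Rle_trans; [left; apply (HK l Hl (S i)); [lia|assumption]|].
      apply Rmult_le_compat_r; [left; apply exp_pos|]. pose proof (Rmax_l L A). fold B in H. nra.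
  - eapply Rle_trans; [now apply Hall|]. rewrite Rmult_assoc. rewrite <- (Rmult_1_r B) at 1.
    apply Rmult_le_compat_l; [lra|]. unfold ew. rewrite <- exp_plus, <- exp_0 at 1. apply exp_le.
    apply IZR_le in Hk. nra.
Qed.

Lemma tilc_intro n Cf A M : 0 < M -> (forall l, length l = n -> Cf (map (Z.add 1) l) = Cf l) ->
  (forall l, length l = n -> forall x, In x l -> Cmod (Cf l) <= A * ew M (hd 0%Z l - x)) -> TILC n Cf.
Proof.
  intros HM H1 H2. split; [assumption|]. exists (Rabs A + 1), M, 0.
  pose proof (Rabs_pos A). split; [lra|]. split; [assumption|].
  intros l Hl i Hi _. replace (nth 0 l 0%Z) with (hd 0%Z l) by now destruct l.
  eapply Rle_lt_trans; [apply (H2 l Hl (nth i l 0%Z)); apply nth_In; lia|].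
  unfold ew. apply Rmult_lt_compat_r; [apply exp_pos|]. pose proof (Rle_abs A). lra.
Qed.

Lemma nabla_bound nabla : TILC 2 (fun l => nabla (nth 0 l 0%Z - nth 1 l 0%Z)%Z) ->
  exists A M, 0 < M /\ forall k, Cmod (nabla k) <= A * ew M k.
Proof.
  intros H. destruct (tilc_bound _ _ H) as (A & M & HA & HM & HB). exists A, M. split; [assumption|].
  intros k. specialize (HB [k; 0%Z] eq_refl 0%Z ltac:(simpl; auto)). simpl in HB. now rewrite Z.sub_0_r in HB.
Qed.

(** Decay in every pairwise distance prefers no letter, so it survives permutations and hence
    symmetrization. Taking both letters equal gives plain boundedness on nonempty words. *)
Definition pair_bdd (A M : R) (n : nat) (f : list lvar -> C) : Prop :=
  forall w, length w = n -> forall u v, In u w -> In v w -> Cmod (f w) <= A * ew M (site u - site v).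

Lemma types_match_eq ks w : types_match ks w = true <-> map vt w = ks.
Proof.
  revert w. induction ks as [|k ks IH]; intros [|v w]; simpl; try (split; discriminate || reflexivity).
  rewrite andb_true_iff, IH.
  assert (E : vtype_eqb (vt v) k = true <-> vt v = k).
  { destruct (vt v) as [b1 k1], k as [b2 k2]. unfold vtype_eqb; simpl. rewrite andb_true_iff, eqb_true_iff.
    split; [intros [-> E]; destruct k1, k2; try discriminate; reflexivity|intros E; injection E as -> ->; split; [reflexivity|now destruct k2]]. }
  rewrite E. split; [intros [<- <-]; reflexivity|intros H; injection H as <- <-; auto].
Qed.

(** One of the distances from h to x and to y is at least half the distance between x and y. *)
Lemma ew_half_pair M (h x y : Z) (X A : R) : 0 < M -> 0 <= A ->
  X <= A * ew M (h - x) -> X <= A * ew M (h - y) -> X <= A * ew (M / 2) (x - y).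
Proof.
  intros HM HA Hx Hy.
  assert (Hd : IZR (Z.abs (x - y)) <= 2 * IZR (Z.abs (h - x)) \/ IZR (Z.abs (x - y)) <= 2 * IZR (Z.abs (h - y))).
  { rewrite <- !mult_IZR. destruct (Z_le_gt_dec (Z.abs (x - y)) (2 * Z.abs (h - x))); [left|right]; apply IZR_le; lia. }
  destruct Hd; [eapply Rle_trans; [exact Hx|]|eapply Rle_trans; [exact Hy|]];
    (apply Rmult_le_compat_l; [assumption|]; unfold ew; apply exp_le; nra).
Qed.

Lemma mono_pair_bdd ks Cf n : TILC (length ks) Cf -> exists A M, 0 <= A /\ 0 < M /\ pair_bdd A M n (mono ks Cf).
Proof.
  intros HT. destruct (tilc_bound _ _ HT) as (A & M & HA & HM & HB).
  exists A, (M / 2). split; [assumption|]. split; [lra|]. intros w Hw u v Hu Hv. unfold mono.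
  destruct (types_match ks w) eqn:E.
  - apply types_match_eq in E.
    assert (Hl : length (map site w) = length ks) by (rewrite <- E, !length_map; reflexivity).
    apply (ew_half_pair M (hd 0%Z (map site w))); auto; apply HB; auto; now apply in_map.
  - rewrite Cmod_0. apply Rmult_le_pos; [assumption|left; apply ew_pos].
Qed.

Lemma raw_pair_bdd P n : local_functional P -> exists A M, 0 <= A /\ 0 < M /\ pair_bdd A M n (raw P).
Proof.
  intros HP. induction HP as [|[ks Cf] P Ht HP IH].
  - exists 0, 1. split; [lra|]. split; [lra|]. intros w Hw u v Hu Hv. unfold raw, csum; simpl. rewrite Cmod_0; lra.
  - destruct IH as (A & M & HA & HM & HB). destruct (mono_pair_bdd ks Cf n Ht) as (A' & M' & HA' & HM' & HB').
    exists (A' + A), (Rmin M' M). split; [lra|]. split; [apply Rmin_glb_lt; assumption|].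
    intros w Hw u v Hu Hv. unfold raw. simpl map. rewrite csum_cons.
    eapply Rle_trans; [apply Cmod_triangle|]. rewrite Rmult_plus_distr_r. apply Rplus_le_compat.
    + eapply Rle_trans; [apply (HB' w Hw u v Hu Hv)|]. apply Rmult_le_compat_l; [assumption|apply ew_mono, Rmin_l].
    + eapply Rle_trans; [apply (HB w Hw u v Hu Hv)|]. apply Rmult_le_compat_l; [assumption|apply ew_mono, Rmin_r].
Qed.

Lemma coef_pair_bdd P n : local_functional P -> exists A M, 0 <= A /\ 0 < M /\ pair_bdd A M n (coef P).
Proof.
  intros HP. destruct (raw_pair_bdd P n HP) as (A & M & HA & HM & HB).
  exists (INR (fact n) * A), M. split; [apply Rmult_le_pos; [apply pos_INR|assumption]|]. split; [assumption|].
  intros w Hw u v Hu Hv. rewrite coef_gsum, Hw, Rmult_assoc. apply gsum_bound; [assumption|].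
  intros w' Hp. apply HB.
  - now rewrite <- (Permutation_length Hp).
  - now apply (Permutation_in u Hp).
  - now apply (Permutation_in v Hp).
Qed.

Lemma msum_sh w F : msum (map sh w) F = msum w (fun x => F (map sh x)).
Proof.
  revert F. induction w as [|u w IH]; intros F; [reflexivity|]. simpl. f_equal. rewrite IH.
  apply msum_ext. intros v w' _. reflexivity.
Qed.

Lemma gsum_sh n w F : gsum n F (map sh w) = gsum n (fun x => F (map sh x)) w.
Proof.
  revert w F. induction n as [|n IH]; intros w F.
  - destruct w; reflexivity.
  - simpl. rewrite msum_sh. apply msum_ext. intros v w' _. simpl. apply (IH w' (fun x => F (sh v :: x))).
Qed.

Lemma map_vt_sh w : map vt (map sh w) = map vt w.
Proof. rewrite map_map. reflexivity. Qed.

Lemma map_site_sh w : map site (map sh w) = map (Z.add 1) (map site w).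
Proof. rewrite !map_map. apply map_ext. intros u. rewrite site_sh. lia. Qed.

Lemma raw_sh P w : local_functional P -> raw P (map sh w) = raw P w.
Proof.
  intros HP. unfold raw. apply csum_ext. intros [ks Cf] Ht.
  apply (proj1 (List.Forall_forall _ _) HP) in Ht. simpl in *. unfold mono.
  destruct (types_match ks w) eqn:E.
  - assert (E' : types_match ks (map sh w) = true) by (apply types_match_eq; rewrite map_vt_sh; now apply types_match_eq).
    rewrite E', map_site_sh. apply (proj1 Ht). apply types_match_eq in E. now rewrite <- E, !length_map.
  - destruct (types_match ks (map sh w)) eqn:E'; [|reflexivity].
    apply types_match_eq in E'. rewrite map_vt_sh in E'. apply types_match_eq in E'. congruence.
Qed.

Lemma coef_sh P w : local_functional P -> coef P (map sh w) = coef P w.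
Proof.
  intros HP. rewrite !coef_gsum, length_map, gsum_sh. apply gsum_ext. intros. now apply raw_sh.
Qed.

Lemma spread_lower z nu D w : 0 <= nu -> (forall v, In v w -> IZR (Z.abs (site v - z)) <= D) ->
  exp (- (nu * D * INR (length w))) <= spread z nu w.
Proof.
  intros Hn. induction w as [|v w IH]; intros H.
  - simpl. rewrite Rmult_0_r, Ropp_0, exp_0. lra.
  - simpl length. rewrite S_INR. simpl spread.
    replace (- (nu * D * (INR (length w) + 1))) with (- nu * D + - (nu * D * INR (length w))) by ring. rewrite exp_plus.
    apply Rmult_le_compat; try (left; apply exp_pos).
    + apply exp_le. assert (IZR (Z.abs (site v - z)) <= D) by (apply H; now left). nra.
    + apply IH. intros; apply H; now right.
Qed.

Lemma farthest (z : Z) (u : lvar) w : exists v, In v (u :: w) /\ forall v', In v' (u :: w) -> (Z.abs (site v' - z) <= Z.abs (site v - z))%Z.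
Proof.
  revert u. induction w as [|a w IH]; intros u.
  - exists u. split; [now left|]. intros v' [<-|[]]; lia.
  - destruct (IH a) as (v & Hv & Hm). destruct (Z_le_gt_dec (Z.abs (site u - z)) (Z.abs (site v - z))).
    + exists v. split; [now right|]. intros v' [<-|Hv']; [lia|auto].
    + exists u. split; [now left|]. intros v' [<-|Hv']; [lia|]. specialize (Hm v' Hv'). lia.
Qed.

(** Let t be the largest distance from the head. All m tail letters lie within t, so at rate M/(m+1)
    the product weight is at least e^(-M t m/(m+1)), which exceeds the pairwise bound e^(-M t). *)
Lemma pair_head_bdd A M m f : 0 <= A -> 0 < M -> pair_bdd A M (S m) f -> head_bdd A (M / (INR m + 1)) m f.
Proof.
  intros HA HM H u w Hw. pose proof (pos_INR m) as Hm.
  destruct (farthest (site u) u w) as (v & Hv & Hmax).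
  eapply Rle_trans; [apply (H (u :: w) ltac:(simpl; lia) v u Hv); now left|].
  apply Rmult_le_compat_l; [assumption|].
  assert (Hnu : 0 < M / (INR m + 1)) by (apply Rdiv_lt_0_compat; lra).
  eapply Rle_trans; [|apply (spread_lower (site u) _ (IZR (Z.abs (site v - site u)))); [lra|]].
  - apply exp_le. rewrite Hw. pose proof (IZR_abs_ge0 (site v - site u)).
    set (t := IZR (Z.abs (site v - site u))) in *. assert (Hnm : M / (INR m + 1) * INR m <= M).
    { apply (Rmult_le_reg_r (INR m + 1)); [lra|]. replace (M / (INR m + 1) * INR m * (INR m + 1)) with (M * INR m) by (field; lra). nra. }
    replace (M / (INR m + 1) * t * INR m) with (M / (INR m + 1) * INR m * t) by ring. nra.
  - intros v' Hv'. apply IZR_le. apply Hmax. now right.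
Qed.

Lemma spread_In z M w v : 0 <= M -> In v w -> spread z M w <= ew M (site v - z).
Proof.
  intros HM. induction w as [|a w IH]; intros [].
  - subst a. simpl. pose proof (spread_le1 z M w HM). pose proof (spread_pos z M w). pose proof (ew_pos M (site v - z)). nra.
  - simpl. specialize (IH H). pose proof (ew_le1 M (site a - z) HM). pose proof (ew_pos M (site a - z)). pose proof (spread_pos z M w). nra.
Qed.

Lemma map_site_combine ks l : length l = length ks -> map site (combine ks l) = l.
Proof. revert l. induction ks as [|k ks IH]; intros [|x l] H; try discriminate; [reflexivity|]. simpl. f_equal. apply IH. now injection H. Qed.

Lemma combine_types w : combine (map vt w) (map site w) = w.
Proof. induction w as [|[t x] w IH]; [reflexivity|]. simpl. f_equal. exact IH. Qed.

Lemma combine_sh ks l : combine ks (map (Z.add 1) l) = map sh (combine ks l).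
Proof.
  revert l. induction ks as [|k ks IH]; intros [|x l]; try reflexivity. cbn [map combine]. rewrite IH. f_equal.
  unfold sh; cbn [fst snd]. f_equal. lia.
Qed.

Lemma word_length (ks : list vtype) (l : list Z) : length l = length ks -> @length lvar (combine ks l) = length ks.
Proof. intros H. unfold lvar. pose proof (length_combine ks l). unfold vtype in *. lia. Qed.

(** The way back from words to coefficients: the first index in [TILC] plays the part of the head
    letter. *)
Lemma tilc_combine ks f B mu c : 0 <= B -> 0 < mu -> (forall m, length ks = S m -> head_bdd B mu m f) -> sh_inv (length ks) f ->
  TILC (length ks) (fun l => Cmult c (f (combine ks l))).
Proof.
  intros HB Hmu Hb Hs. apply (tilc_intro _ _ (Cmod c * B) mu Hmu).
  - intros l Hl. rewrite combine_sh, Hs; [reflexivity|]. now apply word_length.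
  - intros l Hl x Hx. rewrite Cmod_mult, Rmult_assoc. apply Rmult_le_compat_l; [apply Cmod_ge_0|].
    destruct ks as [|k ks], l as [|y l]; try discriminate; [destruct Hx|].
    simpl combine. injection Hl as Hl. simpl hd.
    assert (Hlen : @length lvar (combine ks l) = length ks) by now apply word_length.
    eapply Rle_trans; [apply (Hb (length ks) eq_refl (k, y)); assumption|]. apply Rmult_le_compat_l; [assumption|].
    change (site (k, y)) with y. destruct Hx as [->|Hx].
    + rewrite Z.sub_diag, ew_0. apply spread_le1; lra.
    + rewrite <- (map_site_combine ks l Hl) in Hx. apply in_map_iff in Hx. destruct Hx as (v & <- & Hv).
      replace (y - site v)%Z with (- (site v - y))%Z by lia. rewrite ew_opp. apply spread_In; [lra|assumption].
Qed.

Lemma pair_sh_tilc_combine ks f A M c : 0 <= A -> 0 < M -> pair_bdd A M (length ks) f -> sh_inv (length ks) f ->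
  TILC (length ks) (fun l => Cmult c (f (combine ks l))).
Proof.
  intros HA HM Hb Hs. destruct ks as [|k ks].
  - apply (tilc_combine [] f 0 1); auto; [lra|lra|discriminate].
  - pose proof (pos_INR (length ks)). apply (tilc_combine (k :: ks) f A (M / (INR (length ks) + 1))); auto.
    + apply Rdiv_lt_0_compat; lra.
    + intros m Hm. injection Hm as <-. now apply pair_head_bdd.
Qed.

(** * The decomposition *)

Lemma zsum_to_msum w (F : Z -> list lvar -> C) L :
  (forall w', length w' = length w -> zsum_to (fun k => F k w') (L w')) ->
  zsum_to (fun k => msum w (F k)) (msum w L).
Proof.
  revert F L. induction w as [|u w IH]; intros F L H.
  - now apply zsum_to_0.
  - simpl. apply zsum_to_plus; [now apply H|]. apply (IH (fun k => tr u (F k))).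
    intros [|v w'] Hw; simpl.
    + now apply zsum_to_0.
    + apply zsum_to_scal. apply H. simpl in *. lia.
Qed.

Lemma zsum_to_gsum n w (F : Z -> list lvar -> C) L : length w = n ->
  (forall w', length w' = n -> zsum_to (fun k => F k w') (L w')) ->
  zsum_to (fun k => gsum n (F k) w) (gsum n L w).
Proof.
  revert w F L. induction n as [|n IH]; intros w F L Hw H.
  - destruct w; [|discriminate]. simpl. now apply H.
  - simpl. apply (zsum_to_msum w (fun k => lift (gsum n) (F k))). intros [|v w'] Hw'; rewrite Hw in Hw'; [discriminate|].
    injection Hw' as Hw'. simpl. apply (IH w' (fun k x => F k (v :: x)) (fun x => L (v :: x)) Hw').
    intros x Hx. apply H. simpl; lia.
Qed.

Lemma graded_sym_filter n F (p : list lvar -> bool) : (forall x y, Permutation x y -> p x = p y) ->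
  graded_sym n F -> graded_sym n (fun x => if p x then F x else RtoC 0).
Proof.
  revert F p. induction n as [|n IH]; intros F p Hp HF; [exact I|]. destruct HF as [F1 F2]. split.
  - intros u v w Hl. rewrite (Hp (u :: v :: w) (v :: u :: w)) by apply perm_swap.
    destruct (p (v :: u :: w)); [now apply F1|ring].
  - intros u. apply (IH (fun x => F (u :: x)) (fun x => p (u :: x))); [|apply F2].
    intros x y H. apply Hp. now constructor.
Qed.

Lemma graded_sym_even n F w w' : graded_sym n F -> length w = n -> List.Forall (fun u => odd_var u = false) w ->
  Permutation w w' -> F w = F w'.
Proof.
  intros HF Hl He Hp. revert n F HF Hl He. induction Hp; intros n F HF Hl He.
  - reflexivity.
  - destruct n as [|n]; [discriminate|]. injection Hl as Hl. inversion He; subst.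
    now apply (IHHp (length l) (fun y => F (x :: y)) (proj2 HF x)).
  - destruct n as [|n]; [discriminate|]. injection Hl as Hl. rewrite (proj1 HF y x l) by lia.
    inversion He as [|? ? E _]; subst. unfold swap_sign. rewrite E. simpl. ring.
  - rewrite (IHHp1 n F HF Hl He). apply (IHHp2 n F HF).
    + now rewrite <- (Permutation_length Hp1).
    + apply (Permutation_Forall Hp1 He).
Qed.

(** The kinds fall into the pairs Phi, Chi and Chib, Fld. Excitation stays within a pair, so the
    differential respects the splitting of words by the presence of the second pair. *)
Fixpoint has_bar (w : list lvar) : bool :=
  match w with
  | [] => false
  | (_, Chib, _) :: _ | (_, Fld, _) :: _ => true
  | _ :: w' => has_bar w'
  end.

Lemma has_bar_existsb w : has_bar w = existsb (fun u => match u with (_, Chib, _) | (_, Fld, _) => true | _ => false end) w.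
Proof. induction w as [|[[s []] x] w IH]; simpl; auto. Qed.

Lemma existsb_perm {A} (p : A -> bool) x y : Permutation x y -> existsb p x = existsb p y.
Proof.
  intros H. apply eq_true_iff_eq. rewrite !existsb_exists.
  split; intros (u & H1 & H2); exists u; (split; [|assumption]).
  - now apply (Permutation_in u H).
  - now apply (Permutation_in u (Permutation_sym H)).
Qed.

Lemma forallb_perm {A} (p : A -> bool) x y : Permutation x y -> forallb p x = forallb p y.
Proof.
  intros H. apply eq_true_iff_eq. rewrite !forallb_forall.
  split; intros G u Hu; apply G.
  - now apply (Permutation_in u (Permutation_sym H)).
  - now apply (Permutation_in u H).
Qed.

Lemma NF_perm x y : Permutation x y -> NF x = NF y.
Proof. unfold NF. induction 1; simpl in *; lia. Qed.

Lemma nth_remove_rot (ns : list Z) r : (r < length ns)%nat ->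
  hd 0%Z (rot r ns) = nth r ns 0%Z /\ Permutation (tl (rot r ns)) (remove_nth r ns) /\ length (remove_nth r ns) = (length ns - 1)%nat.
Proof.
  intros Hr. unfold rot, remove_nth.
  assert (E : skipn r ns = nth r ns 0%Z :: skipn (S r) ns).
  { revert r Hr. induction ns as [|a ns IH]; intros [|r] Hr; simpl in *; try lia; [reflexivity|]. rewrite IH by lia. reflexivity. }
  rewrite E. simpl hd. simpl tl. split; [reflexivity|]. split; [apply Permutation_app_comm|].
  rewrite length_app, length_firstn, length_skipn. lia.
Qed.

Lemma remove_nth_map {A B} (h : A -> B) r l : remove_nth r (map h l) = map h (remove_nth r l).
Proof. unfold remove_nth. now rewrite map_app, firstn_map, skipn_map. Qed.

(** * Functionals in the fields of one sign *)

Section Sector.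
Variables (s : bool) (q : lvar -> lvar -> C) (nabla : Z -> C) (a1 a2 : C).
Hypotheses (Ha1 : a1 <> RtoC 0) (Ha2 : a2 <> RtoC 0).
Hypothesis q_odd : forall v u, odd_var v = odd_var u -> q v u = RtoC 0.
Hypothesis q_sign : forall v u, fst (fst v) <> fst (fst u) -> q v u = RtoC 0.
Hypothesis q_chi : forall k x, q (s, Chi, k) (s, Phi, x) = Cmult a1 (nabla (k - x)%Z).
Hypothesis q_fld : forall k x, q (s, Fld, k) (s, Chib, x) = Cmult a2 (nabla (k - x)%Z).
Hypothesis q_phi : forall k u, q (s, Phi, k) u = RtoC 0.
Hypothesis q_chib : forall k u, q (s, Chib, k) u = RtoC 0.
Hypothesis q_chi0 : forall k x, q (s, Chi, k) (s, Fld, x) = RtoC 0.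
Hypothesis q_fld0 : forall k x, q (s, Fld, k) (s, Chi, x) = RtoC 0.
Variables (A0 M0 : R).
Hypothesis HM0 : 0 < M0.
Hypothesis Hnabla : forall k, Cmod (nabla k) <= A0 * ew M0 k.
Hypothesis Hnz : exists k, nabla k <> RtoC 0.

Notation cop := (conv_op nabla a1 a2).
Notation diff := (deriv nabla a1 a2).
Notation dsite := (deriv_at q).

(** The words on which a functional of sign [s] and fermion number e can have a nonzero
    coefficient. *)
Fixpoint good (e : Z) (w : list lvar) : bool :=
  match w with
  | [] => Z.eqb e 0
  | u :: w' => Bool.eqb (fst (fst u)) s && good (e - NF_kind (snd (fst u))) w'
  end.

Lemma good_spec e w : good e w = true <-> List.Forall (fun t => fst t = s) (map vt w) /\ NF (map vt w) = e.
Proof.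
  revert e. induction w as [|u w IH]; intros e; simpl good.
  - rewrite Z.eqb_eq. unfold NF; simpl. split; [intros ->; split; [constructor|reflexivity]|intros [_ ->]; reflexivity].
  - rewrite andb_true_iff, IH, eqb_true_iff.
    change (NF (map vt (u :: w))) with (NF_kind (snd (fst u)) + NF (map vt w))%Z. cbn [map]. split.
    + intros (H1 & H2 & H3). split; [constructor; assumption|lia].
    + intros (H1 & H3). inversion H1; subst. split; [assumption|]. split; [assumption|]. lia.
Qed.

Lemma good_perm e x y : Permutation x y -> good e x = good e y.
Proof.
  assert (G : forall x y, Permutation x y -> good e x = true -> good e y = true).
  { intros x' y' H Hg. apply good_spec in Hg. destruct Hg as [H1 H2]. apply good_spec.
    pose proof (Permutation_map vt H) as Hm. split; [apply (Permutation_Forall Hm H1)|]. now rewrite <- (NF_perm _ _ Hm). }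
  intros H. apply eq_true_iff_eq. split; apply G; auto using Permutation_sym.
Qed.

Lemma raw_good P e w : pure_terms s e P -> good e w = false -> raw P w = RtoC 0.
Proof.
  intros HP Hg. apply csum_0. intros t Ht. apply (proj1 (List.Forall_forall _ _) HP) in Ht. destruct Ht as (_ & H1 & H2).
  unfold mono. destruct (types_match (fst t) w) eqn:E; [|reflexivity]. apply types_match_eq in E.
  assert (good e w = true) by (apply good_spec; rewrite E; auto). congruence.
Qed.

Lemma coef_good P e w : pure_terms s e P -> good e w = false -> coef P w = RtoC 0.
Proof.
  intros HP Hg. rewrite coef_gsum. rewrite (gsum_ext _ _ (fun _ => RtoC 0)); [apply gsum_0|].
  intros w' Hp. apply (raw_good P e w' HP). now rewrite <- (good_perm e _ _ Hp).
Qed.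

Definition signs (w : list lvar) : bool := forallb (fun u => Bool.eqb (fst (fst u)) s) w.

Lemma good_signs e w : good e w = true -> signs w = true.
Proof. revert e. induction w as [|u w IH]; intros e; simpl; [reflexivity|]. rewrite !andb_true_iff. intros [H1 H2]. split; eauto. Qed.

(** Among the types of sign [s] at most the excited partner of u has u in its image. The supercharge
    also acts on fields of the other sign, and those terms vanish with G. *)
Lemma qsum_ckern n u (G : lvar -> C) : (forall t, fst (fst t) <> s -> G t = RtoC 0) ->
  qsum q n u G = Cmult (ckern nabla a1 a2 u n) (G (excite u n)).
Proof.
  intros HG. destruct u as [[su ku] x]. destruct (bool_dec su s) as [->|Hs].
  - assert (H0 : forall st, fst st <> s -> Cmult (q (fst st, snd st, n) (s, ku, x)) (G (fst st, snd st, n)) = RtoC 0).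
    { intros st Hst. rewrite HG by assumption. ring. }
    assert (E : qsum q n (s, ku, x) G = Cplus (Cmult (q (s, Chi, n) (s, ku, x)) (G (s, Chi, n))) (Cmult (q (s, Fld, n) (s, ku, x)) (G (s, Fld, n)))).
    { unfold qsum, all_vtypes, csum. simpl. clear - H0 q_phi q_chib.
      pose proof (fun k => H0 (negb s, k)) as H1. simpl in H1.
      destruct s; simpl in H1; rewrite !H1 by discriminate; rewrite q_phi, q_chib; ring. }
    rewrite E. destruct ku; simpl.
    + rewrite q_chi, (q_odd (s, Fld, n)) by reflexivity. ring.
    + rewrite q_chi0, (q_odd (s, Fld, n)) by reflexivity. ring.
    + rewrite q_fld0, (q_odd (s, Chi, n)) by reflexivity. ring.
    + rewrite q_fld, (q_odd (s, Chi, n)) by reflexivity. ring.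
  - rewrite HG by (destruct ku; assumption).
    rewrite Cmult_0_r. apply csum_0. intros st _. destruct (bool_dec (fst st) s) as [Hst|Hst].
    + rewrite q_sign; [ring|]. simpl. congruence.
    + rewrite HG by assumption. ring.
Qed.

Lemma dsite_diff w f B : bdd (length w) B f -> (forall x, length x = length w -> signs x = false -> f x = RtoC 0) ->
  zsum_to (fun n => dsite n w f) (diff w f).
Proof.
  revert f. induction w as [|u w IH]; intros f HB Hs; simpl.
  - now apply zsum_to_0.
  - apply zsum_to_plus.
    + apply (zsum_to_ext (fun n => Cmult (ckern nabla a1 a2 u n) (f (excite u n :: w)))).
      * intros n. symmetry. apply (qsum_ckern n u (fun t => f (t :: w))).
        intros t Ht. apply Hs; [reflexivity|]. simpl. apply andb_false_intro1. now apply eqb_false_iff.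
      * apply zsum_correct, edom_asum. apply (cop_edom nabla a1 a2 A0 M0 HM0 Hnabla (fun t => f (t :: w)) u B).
        intros k. now apply HB.
    + apply zsum_to_scal. apply IH.
      * now apply bdd_cons.
      * intros x Hx Hsx. apply Hs; [simpl; lia|]. simpl. now apply andb_false_intro2.
Qed.

Lemma cop_zero G u : (forall k, G (excite u k) = RtoC 0) -> cop G u = RtoC 0.
Proof. intros H. apply zsum_0. intros k. rewrite H. ring. Qed.

Lemma diff_zero w : diff w (fun _ => RtoC 0) = RtoC 0.
Proof. now apply (diff_0 nabla a1 a2 A0 M0 HM0 Hnabla). Qed.

Lemma diff_has_bar w F : diff w (fun x => if has_bar x then F x else RtoC 0) = if has_bar w then diff w F else RtoC 0.
Proof.
  revert F. induction w as [|u w IH]; intros F; [reflexivity|].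
  cbn [deriv]. destruct (has_bar [u]) eqn:Eu.
  - assert (Hu : forall x, has_bar (u :: x) = true) by (intros x; destruct u as [[su []] y]; simpl in *; congruence).
    assert (Hk : forall k x, has_bar (excite u k :: x) = true) by (intros k x; destruct u as [[su []] y]; simpl in *; congruence).
    rewrite Hu. f_equal.
    + apply cop_ext. intros k. now rewrite Hk.
    + f_equal. apply diff_ext. intros x _. now rewrite Hu.
  - assert (Hu : forall x, has_bar (u :: x) = has_bar x) by (intros x; destruct u as [[su []] y]; simpl in *; congruence).
    assert (Hk : forall k x, has_bar (excite u k :: x) = has_bar x) by (intros k x; destruct u as [[su []] y]; simpl in *; congruence).
    rewrite Hu. rewrite (diff_ext nabla a1 a2 w _ (fun x => if has_bar x then F (u :: x) else RtoC 0)) by (intros; now rewrite Hu).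
    rewrite (IH (fun x => F (u :: x))). destruct (has_bar w) eqn:Ew.
    + f_equal. apply cop_ext. intros k. now rewrite Hk, Ew.
    + rewrite cop_zero; [ring|]. intros k. now rewrite Hk, Ew.
Qed.

(** Excitation raises the fermion number by 1, from Phi to Chi as well as from Chib to Fld, so
    values at e come from values at e + 1. *)
Lemma diff_good e w F : diff w (fun x => if good (e + 1) x then F x else RtoC 0) = if good e w then diff w F else RtoC 0.
Proof.
  revert e F. induction w as [|u w IH]; intros e F; [simpl; now destruct (Z.eqb e 0)|].
  cbn [deriv].
  rewrite (diff_ext nabla a1 a2 w _ (fun x => if good (e - NF_kind (snd (fst u)) + 1) x then (if Bool.eqb (fst (fst u)) s then F (u :: x) else RtoC 0) else RtoC 0)).
  2:{ intros x _. simpl. replace (e + 1 - NF_kind (snd (fst u)))%Z with (e - NF_kind (snd (fst u)) + 1)%Z by lia.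
      destruct (Bool.eqb (fst (fst u)) s), (good (e - NF_kind (snd (fst u)) + 1) x); reflexivity. }
  rewrite (IH _ (fun x => if Bool.eqb (fst (fst u)) s then F (u :: x) else RtoC 0)). simpl good.
  assert (Hk : exc u = false -> forall k, Bool.eqb (fst (fst (excite u k))) s && good (e + 1 - NF_kind (snd (fst (excite u k)))) w = Bool.eqb (fst (fst u)) s && good (e - NF_kind (snd (fst u))) w).
  { intros Hu k. destruct u as [[su []] y]; try discriminate; simpl; do 2 f_equal; lia. }
  destruct (exc u) eqn:Eu.
  - rewrite !cop_exc by assumption. destruct (Bool.eqb (fst (fst u)) s); simpl.
    + destruct (good _ w); [reflexivity|ring].
    + rewrite diff_zero. destruct (good _ w); ring.
  - rewrite (cop_ext nabla a1 a2 _ (fun t => if Bool.eqb (fst (fst u)) s && good (e - NF_kind (snd (fst u))) w then F (t :: w) else RtoC 0)).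
    2:{ intros k. now rewrite (Hk eq_refl k). }
    destruct (Bool.eqb (fst (fst u)) s); simpl.
    + destruct (good _ w); [reflexivity|]. rewrite cop_zero by reflexivity. ring.
    + rewrite cop_zero, diff_zero by reflexivity. destruct (good _ w); ring.
Qed.

Lemma good_exc_count e w : good e w = true -> (Z.of_nat (exc_count w) >= e)%Z /\ (has_bar w = true -> (Z.of_nat (exc_count w) >= e + 1)%Z).
Proof.
  revert e. induction w as [|[[su k] x] w IH]; intros e H.
  - simpl in H. apply Z.eqb_eq in H. subst. simpl. split; [lia|discriminate].
  - simpl in H. apply andb_prop in H. destruct H as [_ H]. destruct (IH _ H) as [H1 H2].
    destruct k; cbn [exc_count exc has_bar NF_kind Nat.add] in *; split; intros; try specialize (H2 ltac:(assumption)); lia.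
Qed.

Fixpoint one_chi (w : list lvar) : bool :=
  match w with
  | [] => false
  | (t, Phi, _) :: w' => Bool.eqb t s && one_chi w'
  | (t, Chi, _) :: w' => Bool.eqb t s && forallb (fun v => vtype_eqb (vt v) (s, Phi)) w'
  | _ => false
  end.

Lemma good_no_bar w e : good e w = true -> has_bar w = false ->
  (0 <= e)%Z /\ (e = 0%Z -> forallb (fun v => vtype_eqb (vt v) (s, Phi)) w = true) /\ (e = 1%Z -> one_chi w = true).
Proof.
  revert e. induction w as [|[[su k] x] w IH]; intros e Hg Hb.
  - simpl in Hg. apply Z.eqb_eq in Hg. subst. repeat split; try lia; discriminate.
  - simpl in Hg. apply andb_prop in Hg. destruct Hg as [Hs Hg].
    destruct k; simpl in Hb; try discriminate; destruct (IH _ Hg Hb) as (H0 & H1 & H2); simpl in *; rewrite ?Hs; simpl.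
    + split; [lia|]. split; intros; unfold vtype_eqb; simpl; rewrite ?Hs; simpl; [apply H1|apply H2]; lia.
    + split; [lia|]. split; intros; [lia|]. apply H1; lia.
Qed.

Lemma one_chi_no_bar w : one_chi w = true -> has_bar w = false.
Proof.
  assert (G : forall w, forallb (fun v => vtype_eqb (vt v) (s, Phi)) w = true -> has_bar w = false).
  { induction w0 as [|[[su k] x] w' IH]; [reflexivity|]. simpl. intros H. apply andb_prop in H. destruct H as [H1 H2].
    destruct k; simpl in *; auto; unfold vtype_eqb in H1; simpl in H1; rewrite andb_false_r in H1; discriminate. }
  induction w as [|[[su k] x] w IH]; [reflexivity|]. destruct k; simpl; try discriminate; intros H; apply andb_prop in H; destruct H; auto.
Qed.

Fixpoint words (n : nat) : list (list vtype) :=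
  match n with
  | O => [[]]
  | S m => flat_map (fun k => map (cons (s, k)) (words m)) [Phi; Fld; Chi; Chib]
  end.

Lemma words_In n ks : In ks (words n) -> length ks = n /\ List.Forall (fun k => fst k = s) ks.
Proof.
  revert ks. induction n as [|n IH]; intros ks H.
  - destruct H as [<-|[]]. split; [reflexivity|constructor].
  - cbn [words] in H. apply in_flat_map in H. destruct H as (k & _ & H). apply in_map_iff in H.
    destruct H as (ks' & <- & H). destruct (IH ks' H) as [H1 H2]. split; [simpl; now rewrite H1|now constructor].
Qed.

Lemma words_sum n w (X : C) :
  csum (map (fun ks => if types_match ks w then X else RtoC 0) (words n)) = if Nat.eqb (length w) n && signs w then X else RtoC 0.
Proof.
  revert w. induction n as [|n IH]; intros w.
  - destruct w; unfold csum; simpl; ring.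
  - cbn [words flat_map]. rewrite !map_app, !csum_app, !map_map. simpl map at 5. change (csum []) with (RtoC 0).
    destruct w as [|u w].
    + rewrite !csum_0 by reflexivity. simpl. ring.
    + assert (E : forall k, csum (map (fun x => if types_match ((s, k) :: x) (u :: w) then X else RtoC 0) (words n)) =
         if vtype_eqb (vt u) (s, k) then (if Nat.eqb (length w) n && signs w then X else RtoC 0) else RtoC 0).
      { intros k. rewrite <- IH. simpl. destruct (vtype_eqb (vt u) (s, k)); [reflexivity|]. now apply csum_0. }
      rewrite !E. destruct u as [[su ku] x]. unfold vtype_eqb; simpl.
      destruct (Bool.eqb su s); simpl; rewrite ?andb_false_r; [|ring]. destruct ku; simpl; ring.
Qed.

Lemma csum_filter {A} (F : A -> C) p l :
  csum (map F (filter p l)) = csum (map (fun x => if p x then F x else RtoC 0) l).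
Proof.
  induction l as [|x l IH]; [reflexivity|]. cbn [filter map]. destruct (p x); cbn [map]; rewrite !csum_cons, IH; [reflexivity|ring].
Qed.

(** One function g supplies the coefficient of every type word, and 1/n! offsets the n! permutations
    summed by [coef]. The filter on the fermion number also removes the empty word. *)
Definition functional_of (n : nat) (g : list lvar -> C) : list lterm :=
  map (fun ks => (ks, fun l => Cmult (RtoC (/ INR (fact n))) (g (combine ks l)))) (filter (fun ks => Z.eqb (NF ks) 2) (words n)).

Lemma functional_of_pure n g : pure_terms s 2 (functional_of n g).
Proof.
  apply List.Forall_forall. intros t Ht. apply in_map_iff in Ht. destruct Ht as (ks & <- & Ht).
  apply filter_In in Ht. destruct Ht as [H1 H2]. apply Z.eqb_eq in H2. simpl. split; [|split].
  - intros ->. discriminate.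
  - apply (words_In n ks H1).
  - assumption.
Qed.

Lemma functional_of_local n g B mu : 0 <= B -> 0 < mu -> (forall m, n = S m -> head_bdd B mu m g) -> sh_inv n g ->
  local_functional (functional_of n g).
Proof.
  intros HB Hmu Hb Hs. apply List.Forall_forall. intros t Ht. apply in_map_iff in Ht. destruct Ht as (ks & <- & Ht).
  apply filter_In in Ht. destruct Ht as [H1 _]. destruct (words_In n ks H1) as [<- _]. simpl.
  now apply (tilc_combine ks g B mu).
Qed.

Lemma raw_functional_of n g w : (forall x, good 2 x = false -> g x = RtoC 0) ->
  raw (functional_of n g) w = if Nat.eqb (length w) n then Cmult (RtoC (/ INR (fact n))) (g w) else RtoC 0.
Proof.
  intros Hg. unfold raw, functional_of. rewrite map_map, csum_filter. simpl.
  set (X := Cmult (RtoC (/ INR (fact n))) (g w)).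
  rewrite (csum_ext _ (fun ks => if types_match ks w then X else RtoC 0)).
  - rewrite words_sum. destruct (Nat.eqb (length w) n); simpl; [|reflexivity].
    destruct (signs w) eqn:E; [reflexivity|]. unfold X. rewrite Hg; [ring|].
    destruct (good 2 w) eqn:E2; [|reflexivity]. apply good_signs in E2. congruence.
  - intros ks _. unfold mono. destruct (types_match ks w) eqn:E; [|now destruct (NF ks =? 2)%Z].
    apply types_match_eq in E. subst ks. rewrite combine_types. fold X.
    destruct (Z.eqb_spec (NF (map vt w)) 2); [reflexivity|].
    unfold X. rewrite Hg; [ring|]. destruct (good 2 w) eqn:E; [|reflexivity]. apply good_spec in E. tauto.
Qed.

(** * Decomposition of one closed functional *)

Section Functional.
Variable P : list lterm.
Hypotheses (HP : local_functional P) (Hpure : pure_terms s 1 P).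
Hypothesis HQ : Q_image q (coef P) (fun _ => RtoC 0).

Lemma coef_diff w : diff w (coef P) = RtoC 0.
Proof.
  destruct (coef_pair_bdd P (length w) HP) as (A & M & HA & HM & HB).
  apply (zsum_to_unique (fun n => dsite n w (coef P))).
  (* The pairwise bound says nothing about the empty word, so its value is added to the bound. *)
  - apply (dsite_diff w (coef P) (Rmax A (Cmod (coef P [])))).
    + intros [|u x] Hx; [apply Rmax_r|]. eapply Rle_trans; [|apply Rmax_l].
      pose proof (HB (u :: x) Hx u u ltac:(now left) ltac:(now left)) as H. rewrite Z.sub_diag, ew_0 in H. lra.
    + intros x _ Hx. apply (coef_good P 1 x Hpure). destruct (good 1 x) eqn:E; [|reflexivity]. apply good_signs in E. congruence.
  - now apply (proj1 (Q_image_dsite q q_odd (coef P) _ (graded_sym_coef P)) HQ).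
Qed.

Lemma coef_not_good w : good 1 w = false -> coef P w = RtoC 0.
Proof. apply (coef_good P 1 w Hpure). Qed.

Definition bar_part (w : list lvar) : C := if has_bar w then coef P w else RtoC 0.

Lemma has_bar_sh w : has_bar (map sh w) = has_bar w.
Proof. induction w as [|[[su []] x] w IH]; simpl; auto. Qed.

Lemma good_sh e w : good e (map sh w) = good e w.
Proof. revert e. induction w as [|u w IH]; intros e; [reflexivity|]. simpl. now rewrite IH. Qed.

Lemma bar_part_graded_sym n : graded_sym n bar_part.
Proof.
  apply graded_sym_filter; [|apply graded_sym_coef].
  intros x y H. rewrite !has_bar_existsb. now apply existsb_perm.
Qed.

(** A letter of the pair Chib, Fld forces a second excited letter, so [diff_exact] applies. The
    coefficient of the functional built from its primitive is the graded average of that primitive;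
    [bar_part], being graded symmetric, is its own average. *)
Lemma bar_part_exact n : exists Qp, local_functional Qp /\ pure_terms s 2 Qp /\
  Q_image q (coef Qp) (fun w => if Nat.eqb (length w) n then bar_part w else RtoC 0).
Proof.
  destruct (coef_pair_bdd P n HP) as (A & M & HA & HM & HB).
  assert (HB' : pair_bdd A M n bar_part).
  { intros w Hw u v Hu Hv. unfold bar_part. destruct (has_bar w); [now apply HB|].
    rewrite Cmod_0. apply Rmult_le_pos; [assumption|left; apply ew_pos]. }
  pose proof (pos_INR (pred n)) as Hn0.
  destruct (diff_exact nabla a1 a2 A0 M0 Ha1 Ha2 HM0 Hnabla Hnz n bar_part A (M / (INR (pred n) + 1)) HA) as (g & B & mu & HBg & Hmu & Hb & Hs & Hd).
  - apply Rdiv_lt_0_compat; lra.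
  - intros m ->. simpl pred. now apply pair_head_bdd.
  - intros w _. unfold bar_part. now rewrite has_bar_sh, coef_sh.
  - intros w _. unfold bar_part. rewrite diff_has_bar, coef_diff. now destruct (has_bar w).
  - intros w _ Hw. unfold bar_part. destruct (has_bar w) eqn:Eb; [|reflexivity]. apply coef_not_good.
    destruct (good 1 w) eqn:E; [|reflexivity]. destruct (good_exc_count 1 w E) as [_ H]. specialize (H Eb). lia.
  (* Cutting the primitive down to fermion number 2 and sign [s] leaves its differential intact on
     the support of [bar_part]. *)
  - set (g' := fun x => if good 2 x then g x else RtoC 0).
    assert (Hg' : forall x, good 2 x = false -> g' x = RtoC 0) by (intros x Hx; unfold g'; now rewrite Hx).
    assert (Hb' : forall m, n = S m -> head_bdd B mu m g').
    { intros m Hm u w Hw. unfold g'. destruct (good 2 (u :: w)); [now apply (Hb m Hm)|].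
      rewrite Cmod_0. apply Rmult_le_pos; [assumption|left; apply spread_pos]. }
    assert (Hs' : sh_inv n g') by (intros w Hw; unfold g'; now rewrite good_sh, Hs).
    assert (Hd' : forall w, length w = n -> diff w g' = bar_part w).
    { intros w Hw. unfold g'. change 2%Z with (1 + 1)%Z. rewrite (diff_good 1 w g), Hd by assumption.
      destruct (good 1 w) eqn:E; [reflexivity|]. unfold bar_part. rewrite coef_not_good by assumption. now destruct (has_bar w). }
    exists (functional_of n g'). split; [now apply (functional_of_local n g' B mu)|]. split; [apply functional_of_pure|].
    apply (Q_image_dsite q q_odd); [intros; apply graded_sym_coef|]. intros w.
    destruct (Nat.eqb_spec (length w) n) as [Hw|Hw].
    + assert (Hc : forall x, length x = n -> coef (functional_of n g') x = gsum n (fun y => Cmult (RtoC (/ INR (fact n))) (g' y)) x).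
      { intros x Hx. rewrite coef_gsum, Hx. apply gsum_ext. intros y Hy. rewrite raw_functional_of by assumption.
        rewrite <- (Permutation_length Hy), Hx, Nat.eqb_refl. reflexivity. }
      assert (Hbd : bdd n B g').
      { destruct n as [|m]; [|apply (head_bdd_bdd B mu m g' HBg); [lra|now apply Hb']].
        intros [|] Hx; [|discriminate]. unfold g'. simpl. rewrite Cmod_0. assumption. }
      apply (zsum_to_ext (fun k => gsum n (fun x => dsite k x (fun y => Cmult (RtoC (/ INR (fact n))) (g' y))) w)).
      { intros k. rewrite <- (dsite_gsum q q_odd k n w) by assumption. apply dsite_ext. intros x Hx. symmetry. apply Hc. lia. }
      replace (bar_part w) with (gsum n (fun x => Cmult (RtoC (/ INR (fact n))) (bar_part x)) w).
      * apply zsum_to_gsum; [assumption|]. intros x Hx.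
        apply (zsum_to_ext (fun k => Cmult (RtoC (/ INR (fact n))) (dsite k x g'))); [intros; now rewrite dsite_scal|].
        apply zsum_to_scal. rewrite <- (Hd' x Hx). apply (dsite_diff x g' B); [now rewrite Hx|].
        intros y _ Hy. apply Hg'. destruct (good 2 y) eqn:E; [|reflexivity]. apply good_signs in E. congruence.
      * rewrite gsum_scal, (gsum_graded_sym n bar_part w (bar_part_graded_sym n) Hw), Cmult_assoc, <- RtoC_mult.
        rewrite Rinv_l by apply INR_fact_neq_0. ring.
    + apply zsum_to_0. intros k. transitivity (dsite k w (fun _ => Cmult (RtoC 0) (RtoC 0))).
      * apply dsite_ext. intros x Hx. rewrite coef_gsum. transitivity (gsum (length x) (fun _ => RtoC 0) x); [|rewrite gsum_0; ring].
        apply gsum_ext. intros y Hy. rewrite raw_functional_of by assumption.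
        rewrite <- (Permutation_length Hy). destruct (Nat.eqb_spec (length x) n); [lia|reflexivity].
      * rewrite (dsite_scal q k w (RtoC 0) (fun _ => RtoC 0)). ring.
Qed.

(** The supercharge preserves the number of letters, so each length is solved separately, with its
    own rate of decay, and the functionals are concatenated. *)
Lemma bar_part_exact_le N : exists Qp, local_functional Qp /\ pure_terms s 2 Qp /\
  Q_image q (coef Qp) (fun w => if Nat.ltb (length w) N then bar_part w else RtoC 0).
Proof.
  induction N as [|N (Qp & H1 & H2 & H3)].
  - exists []. split; [constructor|]. split; [constructor|].
    apply (Q_image_dsite q q_odd); [intros; apply graded_sym_coef|]. intros w. apply zsum_to_0. intros k.
    transitivity (dsite k w (fun _ => Cmult (RtoC 0) (RtoC 0))).
    + apply dsite_ext. intros; unfold coef, csum; simpl. ring.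
    + rewrite (dsite_scal q k w (RtoC 0) (fun _ => RtoC 0)). ring.
  - destruct (bar_part_exact N) as (Qp' & H1' & H2' & H3').
    exists (Qp ++ Qp'). split; [now apply List.Forall_app|]. split; [now apply List.Forall_app|].
    pose proof (proj1 (Q_image_dsite q q_odd _ _ (graded_sym_coef Qp)) H3) as G3.
    pose proof (proj1 (Q_image_dsite q q_odd _ _ (graded_sym_coef Qp')) H3') as G3'.
    apply (Q_image_dsite q q_odd); [intros; apply graded_sym_coef|]. intros w.
    replace (if Nat.ltb (length w) (S N) then bar_part w else RtoC 0) with
      (Cplus (if Nat.ltb (length w) N then bar_part w else RtoC 0) (if Nat.eqb (length w) N then bar_part w else RtoC 0)).
    + apply (zsum_to_ext (fun k => Cplus (dsite k w (coef Qp)) (dsite k w (coef Qp')))).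
      * intros k. rewrite <- dsite_plus. apply dsite_ext. intros x _. unfold coef. now rewrite map_app, csum_app.
      * apply zsum_to_plus; [apply G3|apply G3'].
    + destruct (Nat.ltb_spec (length w) (S N)), (Nat.ltb_spec (length w) N), (Nat.eqb_spec (length w) N); try lia; ring.
Qed.

(* Words chi phi ... phi: the part on which Q-closedness is the cyclic Leibniz rule. *)
Definition clr_types (k : nat) : list vtype := (s, Chi) :: repeat (s, Phi) k.

(** The factor 1/k! offsets the permutations of the k even letters, which all contribute equally to
    [coef]. *)
Definition clr_coef (k : nat) (l : list Z) : C :=
  Cmult (RtoC (/ INR (fact k))) (coef P (combine (clr_types k) l)).

Lemma clr_types_length k : length (clr_types k) = S k.
Proof. unfold clr_types. simpl. now rewrite repeat_length. Qed.

Lemma clr_coef_tilc k : TILC (S k) (clr_coef k).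
Proof.
  destruct (coef_pair_bdd P (S k) HP) as (A & M & HA & HM & HB).
  rewrite <- (clr_types_length k) in *. apply (pair_sh_tilc_combine _ _ A M); auto.
  intros w _. now apply coef_sh.
Qed.

Definition phi (x : Z) : lvar := (s, Phi, x).

Lemma combine_phi k ns : length ns = k -> combine (repeat (s, Phi) k) ns = map phi ns.
Proof. intros <-. induction ns as [|x ns IH]; [reflexivity|]. simpl. f_equal. exact IH. Qed.

Lemma clr_coef_eq k m ns : length ns = k ->
  clr_coef k (m :: ns) = Cmult (RtoC (/ INR (fact k))) (coef P ((s, Chi, m) :: map phi ns)).
Proof. intros H. unfold clr_coef, clr_types. simpl combine. now rewrite combine_phi. Qed.

Lemma phi_even ns : List.Forall (fun u => odd_var u = false) (map phi ns).
Proof. apply List.Forall_forall. intros u Hu. apply in_map_iff in Hu. destruct Hu as (x & <- & _). reflexivity. Qed.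

Lemma clr_coef_sym k m ns ns' : length ns = k -> Permutation ns ns' -> clr_coef k (m :: ns) = clr_coef k (m :: ns').
Proof.
  intros Hl Hp. rewrite !clr_coef_eq; [|now rewrite <- (Permutation_length Hp)|assumption]. f_equal.
  apply (graded_sym_even k (fun x => coef P ((s, Chi, m) :: x))).
  - apply (graded_sym_coef P (S k)).
  - now rewrite length_map.
  - apply phi_even.
  - now apply Permutation_map.
Qed.

(** Closedness is read off on words of letters phi only. They are even, so no signs occur; the term
    of the r-th letter is that of the r-th rotation, since symmetry makes the order of the remaining
    sites irrelevant. The scalar removes [a1] and inserts 1/k!. *)
Lemma clr_coef_CLR k : CLR nabla k (clr_coef k).
Proof.
  intros ns Hl. pose proof (HQ (map phi ns)) as H.
  apply (zsum_to_scal (Cmult (Cinv a1) (RtoC (/ INR (fact k))))) in H. rewrite Cmult_0_r in H.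
  eapply zsum_to_ext; [|exact H]. intros m. cbv beta. rewrite <- csum_scal. rewrite length_map, Hl.
  apply csum_ext. intros r Hr. apply in_seq in Hr.
  destruct (nth_remove_rot ns r ltac:(lia)) as (E1 & E2 & E3).
  assert (En : nth r (map phi ns) dflt_var = phi (nth r ns 0%Z)).
  { rewrite (nth_indep _ dflt_var (phi 0)) by (rewrite length_map; lia). apply map_nth. }
  cbv zeta. rewrite En, E1, remove_nth_map.
  assert (Ek : ksign (map phi ns) r = RtoC 1) by (unfold ksign; now rewrite En).
  rewrite Ek.
  change (csum (map (fun st => Cmult (q (fst st, snd st, m) (phi (nth r ns 0%Z))) (coef P ((fst st, snd st, m) :: map phi (remove_nth r ns)))) all_vtypes))
    with (qsum q m (phi (nth r ns 0%Z)) (fun t => coef P (t :: map phi (remove_nth r ns)))).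
  rewrite qsum_ckern.
  - simpl. rewrite (clr_coef_sym k m (tl (rot r ns)) (remove_nth r ns)); [|rewrite (Permutation_length E2); lia|assumption].
    rewrite clr_coef_eq by lia.
    set (c := RtoC (/ INR (fact k))). set (X := coef P _). set (y := nabla _). clearbody c X y.
    field. assumption.
  - intros t Ht. apply coef_not_good. simpl. apply andb_false_intro1. now apply eqb_false_iff.
Qed.

Definition all_phi (w : list lvar) : bool := forallb (fun v => vtype_eqb (vt v) (s, Phi)) w.
Definition chi_head (F : list lvar -> C) (w : list lvar) : C :=
  match w with v :: w' => if vtype_eqb (vt v) (s, Chi) && all_phi w' then F w else RtoC 0 | [] => RtoC 0 end.

(** A single letter, the chi, can lead; the sign of bringing it to the front is undone by the graded
    symmetry of F. *)
Lemma msum_chi_head F w : graded_sym (length w) F -> msum w (chi_head F) = if one_chi w then F w else RtoC 0.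
Proof.
  revert F. induction w as [|u w IH]; intros F HF; [reflexivity|]. destruct HF as [F1 F2].
  cbn [msum].
  rewrite (msum_ext w (tr u (chi_head F)) (fun x => if vtype_eqb (vt u) (s, Phi) then chi_head (fun y => F (u :: y)) x else RtoC 0)).
  - assert (O : one_chi (u :: w) = if vtype_eqb (vt u) (s, Phi) then one_chi w else vtype_eqb (vt u) (s, Chi) && all_phi w).
    { destruct u as [[su []] x]; unfold vtype_eqb; simpl; destruct (Bool.eqb su s); reflexivity. }
    assert (O' : vtype_eqb (vt u) (s, Phi) = true -> vtype_eqb (vt u) (s, Chi) = false).
    { destruct u as [[su []] x]; unfold vtype_eqb; simpl; rewrite ?andb_false_r; congruence. }
    rewrite O. change (chi_head F (u :: w)) with (if vtype_eqb (vt u) (s, Chi) && all_phi w then F (u :: w) else RtoC 0).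
    destruct (vtype_eqb (vt u) (s, Phi)).
    + rewrite O' by reflexivity. cbn [andb].
      etransitivity; [apply Cplus_0_l|]. exact (IH (fun y => F (u :: y)) (F2 u)).
    + rewrite msum_0. apply Cplus_0_r.
  - intros v w' Hp. apply Permutation_length in Hp. simpl in Hp. simpl. 
    destruct (vtype_eqb (vt u) (s, Phi)) eqn:Eu; simpl.
    + destruct (vtype_eqb (vt v) (s, Chi)) eqn:Ev; simpl; [|ring]. fold (all_phi w'). destruct (all_phi w'); [|ring].
      rewrite (F1 u v w') by lia. now rewrite swap_sign_sym.
    + rewrite andb_false_r. ring.
Qed.

(** Once the chi is in front, the k! orders of the letters phi give equal values, so symmetrization
    returns the coefficient of P itself. *)
Lemma symc_clr k w : symc (clr_types k) (fun l => Cmult (RtoC 1) (clr_coef k l)) w =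
  if Nat.eqb (length w) (S k) then (if one_chi w then coef P w else RtoC 0) else RtoC 0.
Proof.
  rewrite symc_gsum. destruct (Nat.eqb_spec (length w) (S k)) as [Hw|Hw].
  - rewrite Hw. cbn [gsum]. rewrite <- (msum_chi_head (coef P) w (graded_sym_coef P _)).
    apply msum_ext. intros v w' Hp. apply Permutation_length in Hp. rewrite Hw in Hp. simpl in Hp. injection Hp as Hp.
    cbn [lift].
    rewrite (gsum_ext k _ (fun x => Cmult (if vtype_eqb (vt v) (s, Chi) then RtoC (/ INR (fact k)) else RtoC 0) (if all_phi x then coef P (v :: x) else RtoC 0))).
    + rewrite gsum_scal, gsum_graded_sym; [| |now symmetry].
      * simpl. destruct (vtype_eqb (vt v) (s, Chi)); simpl; [|ring].
        destruct (all_phi w'); rewrite ?Cmult_0_r; [|ring].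
        rewrite Cmult_assoc, <- RtoC_mult, Rinv_l by apply INR_fact_neq_0. ring.
      * apply (graded_sym_filter k (fun x => coef P (v :: x))); [|apply (graded_sym_coef P (S k))].
        intros x y H. now apply forallb_perm.
    + intros x Hx. apply Permutation_length in Hx. unfold mono.
      assert (E : types_match (clr_types k) (v :: x) = vtype_eqb (vt v) (s, Chi) && all_phi x).
      { unfold clr_types. simpl. f_equal. rewrite Hp, Hx. unfold all_phi. clear.
        induction x as [|a x IH]; [reflexivity|]. simpl. now rewrite IH. }
      rewrite E. destruct (vtype_eqb (vt v) (s, Chi)) eqn:Ev; simpl andb; cbv iota; [|ring].
      destruct (all_phi x) eqn:Ex; [|ring]. simpl andb in E. apply types_match_eq in E.
      unfold clr_coef. rewrite <- E at 1. rewrite combine_types. ring.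
  - rewrite (gsum_ext _ _ (fun _ => RtoC 0)); [apply gsum_0|]. intros x Hx. apply Permutation_length in Hx.
    unfold mono. destruct (types_match (clr_types k) x) eqn:E; [|reflexivity]. apply types_match_eq in E.
    exfalso. apply Hw. rewrite Hx, <- (clr_types_length k), <- E, length_map. reflexivity.
Qed.

Definition clr_list (N : nat) : list (C * clr_data) := map (fun k => (RtoC 1, (k, clr_coef k))) (seq 0 N).

Lemma clr_list_coef N w : (length w <= N)%nat ->
  coef (clr_combination s (clr_list N)) w = if one_chi w then coef P w else RtoC 0.
Proof.
  intros Hw. unfold coef at 1, clr_combination, clr_list. rewrite !map_map. simpl.
  rewrite (csum_ext _ (fun k => if Nat.eqb (length w) (S k) then (if one_chi w then coef P w else RtoC 0) else RtoC 0)).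
  2:{ intros k _. apply symc_clr. }
  set (X := if one_chi w then coef P w else RtoC 0).
  assert (E : forall n, csum (map (fun k => if Nat.eqb (length w) (S k) then X else RtoC 0) (seq 0 n)) =
     if Nat.ltb 0 (length w) && Nat.leb (length w) n then X else RtoC 0).
  { induction n as [|n IH].
    - destruct w; reflexivity.
    - rewrite seq_S, map_app, csum_app, IH. cbn [map Nat.add]. rewrite csum_cons. change (csum []) with (RtoC 0).
      destruct (Nat.ltb_spec 0 (length w)), (Nat.leb_spec (length w) n), (Nat.leb_spec (length w) (S n)), (Nat.eqb_spec (length w) (S n)); cbn [andb]; try lia; ring. }
  rewrite E. unfold X. destruct w as [|u w]; [reflexivity|]. simpl Nat.ltb. rewrite (proj2 (Nat.leb_le _ _) Hw). reflexivity.
Qed.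

Lemma coef_long w N : List.Forall (fun t => (length (fst t) < N)%nat) P -> (N <= length w)%nat -> coef P w = RtoC 0.
Proof.
  intros HN Hw. rewrite coef_gsum. rewrite (gsum_ext _ _ (fun _ => RtoC 0)); [apply gsum_0|]. intros x Hx.
  apply Permutation_length in Hx. apply csum_0. intros t Ht. apply (proj1 (List.Forall_forall _ _) HN) in Ht.
  unfold mono. destruct (types_match (fst t) x) eqn:E; [|reflexivity]. apply types_match_eq in E.
  rewrite <- E, length_map in Ht. lia.
Qed.

Lemma length_bound : exists N, List.Forall (fun t => (length (fst t) < N)%nat) P.
Proof.
  clear. induction P as [|t l (N & IH)]; [exists 0%nat; constructor|].
  exists (S (max N (length (fst t)))). constructor; [lia|]. eapply Forall_impl; [|exact IH]. simpl. intros; lia.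
Qed.

(** At fermion number 1 a word either has a letter of the pair Chib, Fld, where the coefficient is
    an image, or is a chi among letters phi, where it is a CLR coefficient. Lengths beyond those of
    the terms of P contribute nothing, which keeps both lists finite. *)
Lemma sector_decomposition : exists (Cs : list (C * clr_data)) (Qp : list lterm),
  List.Forall (is_CLR_coef nabla) (map snd Cs) /\ local_functional Qp /\ pure_terms s 2 Qp /\
  exists h, Q_image q (coef Qp) h /\ forall w, coef P w = Cplus (coef (clr_combination s Cs) w) (h w).
Proof.
  destruct length_bound as [N HN]. destruct (bar_part_exact_le N) as (Qp & H1 & H2 & H3).
  exists (clr_list N), Qp. split; [|split; [assumption|split; [assumption|]]].
  - apply List.Forall_forall. intros d Hd. unfold clr_list in Hd. rewrite map_map in Hd. apply in_map_iff in Hd.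
    destruct Hd as (k & <- & _). split; [apply clr_coef_tilc|]. split; [apply clr_coef_sym|apply clr_coef_CLR].
  - eexists; split; [exact H3|]. intros w. cbv beta.
    destruct (Nat.ltb_spec (length w) N) as [Hw|Hw].
    + rewrite clr_list_coef by lia. unfold bar_part. destruct (one_chi w) eqn:E1.
      * rewrite (one_chi_no_bar w E1). ring.
      * destruct (has_bar w) eqn:Eb; [ring|]. rewrite coef_not_good; [ring|].
        destruct (good 1 w) eqn:E; [|reflexivity]. destruct (good_no_bar w 1 E Eb) as (_ & _ & H). rewrite H in E1; [discriminate|reflexivity].
    + rewrite (coef_long w N HN Hw).
      assert (E : coef (clr_combination s (clr_list N)) w = RtoC 0); [|rewrite E; ring].
      unfold coef, clr_combination, clr_list. rewrite !map_map. apply csum_0. intros k Hk. apply in_seq in Hk. simpl.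
      etransitivity; [apply symc_clr|]. rewrite (coef_long w N HN Hw). destruct (Nat.eqb _ _), (one_chi w); reflexivity.
Qed.
End Functional.
End Sector.

Theorem theorem1 (nabla : Z -> C)
  (Hnabla_tilc : TILC 2 (fun l => nabla (nth 0 l 0%Z - nth 1 l 0%Z)%Z))
  (Hnabla_1 : zsum_to nabla (RtoC 0))
  (Hnabla_nz : exists k, nabla k <> RtoC 0) :
  (forall P : list lterm,
     local_functional P -> pure_terms true 1%Z P ->
     Q_image (qminus nabla) (coef P) (fun _ => RtoC 0) ->
     exists (Cs : list (C * clr_data)) (Qp : list lterm),
       List.Forall (is_CLR_coef nabla) (map snd Cs) /\
       local_functional Qp /\ pure_terms true 2%Z Qp /\
       exists h : list lvar -> C,
         Q_image (qminus nabla) (coef Qp) h /\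
         forall w, coef P w = Cplus (coef (clr_combination true Cs) w) (h w))
  /\
  (forall P : list lterm,
     local_functional P -> pure_terms false 1%Z P ->
     Q_image (qplus nabla) (coef P) (fun _ => RtoC 0) ->
     exists (Cs : list (C * clr_data)) (Qm : list lterm),
       List.Forall (is_CLR_coef nabla) (map snd Cs) /\
       local_functional Qm /\ pure_terms false 2%Z Qm /\
       exists h : list lvar -> C,
         Q_image (qplus nabla) (coef Qm) h /\
         forall w, coef P w = Cplus (coef (clr_combination false Cs) w) (h w)).
Proof.
  destruct (nabla_bound nabla Hnabla_tilc) as (A & M & HM & HA).
  assert (HCi : Ci <> RtoC 0) by (intros E; injection E; lra).
  assert (HCi' : Copp Ci <> RtoC 0) by (intros E; injection E; lra).
  split; intros P HP Hpure HQ.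
  (* On the fields of sign plus, the factors of [nabla] are i on chi and -i on F; on those of sign
     minus both are -i. *)
  - apply (sector_decomposition true (qminus nabla) nabla (Ci) (Copp Ci)) with (A0 := A) (M0 := M); auto.
    + intros [[[] []] k] [[[] []] x] E; try reflexivity; discriminate E.
    + intros [[[] []] k] [[[] []] x] E; try reflexivity; now elim E.
  - apply (sector_decomposition false (qplus nabla) nabla (Copp Ci) (Copp Ci)) with (A0 := A) (M0 := M); auto.
    + intros [[[] []] k] [[[] []] x] E; try reflexivity; discriminate E.
    + intros [[[] []] k] [[[] []] x] E; try reflexivity; now elim E.
Qed.
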